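(* Let $a_i,b_i$ ($i=0,1,2$) and $c\neq 0$ be complex constants, let $L_1(f)=a_0f(z)+a_1f''(z)+a_2f(z+c)$ and $L_2(f)=b_0f(z)+b_1f''(z)+b_2f(z+c)$, let $\omega$ be a non-zero complex number with $\omega\neq\pm1$, put $\omega_1=-\omega+\sqrt{\omega^2-1}$ and $\omega_2=-\omega-\sqrt{\omega^2-1}$, let $g$ be a non-constant polynomial, and suppose that the matrix $\mathcal{A}=\begin{pmatrix}a_0&a_1&a_2\\ b_0&b_1&b_2\end{pmatrix}$ has rank $r(\mathcal{A})=2$. Put $\mathcal{A}_1=a_0b_1-a_1b_0$, $\mathcal{A}_2=a_1b_2-a_2b_1$, $\mathcal{A}_3=a_0b_2-a_2b_0$. If the equation $$(L_1(f))^2+2\omega L_1(f)L_2(f)+(L_2(f))^2=e^{2g(z)}$$ admits an entire solution $f$ with $\rho_2(f)<1$, then one of the following cases holds. (1) $g=\alpha z+\beta$, $\mathcal{A}_2=0$, and $f(z)=C_1e^{(A+\alpha)z}+C_2e^{(-A+\alpha)z}$, where $\alpha(\neq0),\beta,A,B$ are constants, and either $$C_1=\frac{(b_2\omega_2-a_2)e^{B+\beta}}{(\omega_2-\omega_1)\mathcal{A}_3}\ \text{ and }\ C_2=\frac{(a_2-b_2\omega_1)e^{-B+\beta}}{(\omega_2-\omega_1)\mathcal{A}_3},$$ or $$C_1=\frac{(b_1\omega_2-a_1)e^{B+\beta}}{(\omega_2-\omega_1)\mathcal{A}_1}\ \text{ and }\ C_2=\frac{(a_1-b_1\omega_1)e^{-B+\beta}}{(\omega_2-\omega_1)\mathcal{A}_1}.$$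 (2) $g=\alpha z+\beta$, $\mathcal{A}_2\neq0$, $\mathcal{A}_3=0$, and $$f(z)=\frac{1}{\mathcal{A}_2(\omega_2-\omega_1)}\cdot\begin{cases}\left(A_1e^{(\alpha+A)z}+A_2e^{(\alpha-A)z}\right)+C_3z+C_4,&\alpha\neq\pm A,\\ \left(D_1e^{2Az}+D_2z^2\right)+C_3z+C_4,&\alpha=A,\\ \left(C_1z^2+C_2e^{-2Az}\right)+C_3z+C_4,&\alpha=-A,\end{cases}$$ where $\alpha(\neq0),\beta,A,B,C_3,C_4$ are constants and $$A_1=\frac{(b_2\omega_2-a_2)e^{\beta+B}}{(\alpha+A)^2},\quad A_2=\frac{(a_2-b_2\omega_1)e^{\beta-B}}{(\alpha-A)^2},\quad D_1=\frac{(b_2\omega_2-a_2)e^{\beta+B}}{4A^2},$$ $$D_2=\frac{(a_2-b_2\omega_1)e^{\beta-B}}{2},\quad C_1=\frac{(b_2\omega_2-a_2)e^{\beta+B}}{2},\quad C_2=\frac{(a_2-b_2\omega_1)e^{\beta-B}}{4A^2}.$$ (3) $g=\alpha z+\beta$, $\mathcal{A}_2\neq0$, $\mathcal{A}_3\neq0$, and $$f(z)=C_1e^{\mu z}+C_2e^{-\mu z}+\begin{cases}P_1e^{k_1z}+P_2e^{k_2z},&k_1\neq\pm\mu,\ k_2\neq\pm\mu,\\ Q_1ze^{k_1z}+P_2e^{k_2z},&k_1=\pm\mu,\ k_2\neq\pm\mu,\\ P_1e^{k_1z}+Q_2ze^{k_2z},&k_1\neq\pm\mu,\ k_2=\pm\mu,\end{cases}$$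 where $\alpha(\neq0),\beta,C_1,C_2,A,B$ are constants, $\mu=\sqrt{-\frac{\mathcal{A}_3}{\mathcal{A}_2}}$, $k_1=\alpha+A$, $k_2=\alpha-A$, and $$P_1=\frac{(b_2\omega_2-a_2)e^{\beta+B}}{(\omega_2-\omega_1)[\mathcal{A}_2(\alpha+A)^2+\mathcal{A}_3]},\quad P_2=\frac{(a_2-b_2\omega_1)e^{\beta-B}}{(\omega_2-\omega_1)[\mathcal{A}_2(\alpha-A)^2+\mathcal{A}_3]},$$ $$Q_1=\frac{(b_2\omega_2-a_2)e^{\beta+B}}{2\mathcal{A}_2(\omega_2-\omega_1)(\alpha+A)},\quad Q_2=\frac{(a_2-b_2\omega_1)e^{\beta-B}}{2\mathcal{A}_2(\omega_2-\omega_1)(\alpha-A)}.$$ (4) $\deg g>1$, $\mathcal{A}_2=\mathcal{A}_1=0$, and $$f(z)=\frac{(a_2-b_2\omega_1)e^{g(z)-p(z)}}{\mathcal{A}_3(\omega_2-\omega_1)}\quad\text{or}\quad f(z)=\frac{(b_2\omega_2-a_2)e^{g(z)+p(z)}}{\mathcal{A}_3(\omega_2-\omega_1)},$$ where $p$ is a polynomial with $\deg p=\deg g-1$.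
   Context: All constants are complex numbers and functions are defined on $\mathbb{C}$. The hyper-order of an entire (or meromorphic) function $f$ is $\rho_2(f)=\limsup_{r\to\infty}\frac{\log^+\log^+T(r,f)}{\log r}$, where $T(r,f)$ is the Nevanlinna characteristic of $f$. The square root $\sqrt{\omega^2-1}$ denotes one fixed square root, the same in $\omega_1$ and $\omega_2$; likewise $\mu$ is a fixed square root of $-\mathcal{A}_3/\mathcal{A}_2$.
   Formalization: In case (3) the brace omits k_1=±μ and k_2=±μ (A=0, α=±μ), which occurs, e.g. for f=ze^z, so the three lines are not exhaustive; a fourth line Q_1ze^{k_1z}+Q_2ze^{k_2z} is added for exactly that situation. *)

(* Defs.v *)
From HB Require Import structures.
From mathcomp Require Import all_boot all_order all_algebra.
From mathcomp Require Import complex.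
From mathcomp Require Import all_classical all_reals all_analysis.

Set Implicit Arguments.
Unset Strict Implicit.
Unset Printing Implicit Defensive.

Import Order.TTheory GRing.Theory Num.Theory.
Import numFieldNormedType.Exports.

Local Open Scope ring_scope.

(* The field of complex numbers with its norm topology, as a normed module
   over itself: in [CC R -> CC R], [derivable] and the iterated derivative
   [f^`(n)] are the complex ones. *)
Notation CC R := (R[i]^o).

Section Defs.
Context {R : realType}.
Implicit Types (f : CC R -> CC R) (z c : R[i]).

Definition cexp z : R[i] :=
  (expR (complex.Re z))%:C%C * (cos (complex.Im z) +i* sin (complex.Im z))%C.

Definition entire f : Prop := forall z, derivable f z 1.

(* [ln] is 0 on nonpositive reals, so that [logp 0 = 0], as it should be. *)
Definition logp (x : R) : R := Num.max 0 (ln x).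

(* An entire function has no poles, so that its counting function N(r, f)
   vanishes and T(r, f) reduces to the proximity function m(r, f). *)
Definition nevanlinna_T f (r : R) : R :=
  (2 * pi)^-1 * \int[lebesgue_measure]_(t in `[0%R, (2 * pi)%R]%classic)
    logp (complex.Re `|f (r%:C%C * cexp (t%:C%C * 'i%C))|).

Definition hyper_order f : \bar R :=
  limf_esup (fun r : R => (logp (logp (nevanlinna_T f r)) / ln r)%:E)
    (pinfty_nbhs R).

Definition Lop (a0 a1 a2 c : R[i]) f z : R[i] :=
  a0 * f z + a1 * f^`(2)%classic z + a2 * f (z + c).

Definition coef_mx (a0 a1 a2 b0 b1 b2 : R[i]) : 'M[R[i]]_(2, 3) :=
  \matrix_(i < 2, j < 3)
    nth 0 (nth [::] [:: [:: a0; a1; a2]; [:: b0; b1; b2]] i) j.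

End Defs.

(* Main.v *)
(* The left-hand side factors as (L1 - w1 L2) (L1 - w2 L2), so that both factors are zero-free and equal to
   e^h1 and e^h2 with h1 + h2 = 2 g. The hyper-order hypothesis bounds |f(z)| by exp (K e^(eps |z|)) for every
   eps, and by Borel-Caratheodory h1 and h2 then have exponential type zero. Eliminating f from the two
   equations yields a relation between e^h1, e^h2, e^h1(z + c) and e^h2(z + c) with coefficients of exponential
   type zero. By a theorem of Borel type such a relation splits according to the classes of exponents modulo
   constants, and w' + w^2 is constant, for w of exponential type zero, only if w is. Hence either h1 and h2
   are affine, and f solves a linear equation with constant coefficients, or e^h1(z + c) is proportional to
   e^h2 (or conversely), and this makes (h1 - h2) / 2 the polynomial solution of p(z + c) + p(z) = q(z), where
   q has degree deg g - 1. *)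

Require Import Defs.
From mathcomp Require Import all_boot all_order all_algebra.
From mathcomp Require Import complex.
From mathcomp Require Import all_classical all_reals all_analysis.
From mathcomp Require Import ring lra.

Set Implicit Arguments.
Unset Strict Implicit.
Unset Printing Implicit Defensive.

Import Order.TTheory GRing.Theory Num.Theory.
Import numFieldNormedType.Exports.

Local Open Scope ring_scope.

(** * Complex differentiation *)

(** Exponential type zero is the right class because a non-constant entire function of period [c]
    has positive exponential type: within the class, [h (z + c) - h z] is constant only for affine
    [h], so that a shift of a non-affine exponent leaves its class modulo constants. The
    coefficients and the exponents both lie in this class, which is closed under sums, products,
    derivatives and shifts; hence the induction behind the theorem of Borel type, which
    differentiates and eliminates, never leaves it. Its base fact is that [a e^H = b], with [a] not
    identically zero and [a], [b] in the class, forces [H] to be constant. The zeros of [a] are the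
    obstacle there, and they are met by averaging over well chosen points of a circle. The
    characteristic is only an integral mean; pointwise bounds are recovered from it by a majorant of
    [log+ |f|] on a circle that is the real part of a polynomial. The eliminations follow Cramer's
    rule: the three minors of the coefficient matrix weigh the remaining unknowns among [f z],
    [f'' z] and [f (z + c)], and their vanishing decides which case of the theorem can occur. *)

Section ComplexBasics.
Variable R : realType.
Local Notation C := R[i].
Local Notation nm := (@Normc.normc R).
Implicit Types (f g : C -> C) (z w h l a b c k : C) (x y t : R).

Lemma nmE z : `|z| = (nm z)%:C%C. Proof. by case: z. Qed.
Lemma nm_ge0 z : 0 <= nm z.
Proof. by have := normr_ge0 z; rewrite nmE lecR. Qed.
Lemma nmD z w : nm (z + w) <= nm z + nm w. Proof. exact: le_normcD. Qed.
Lemma nmM z w : nm (z * w) = nm z * nm w. Proof. exact: Normc.normcM. Qed.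
Lemma nmN z : nm (- z) = nm z. Proof. exact: normcN. Qed.
Lemma nmB z w : nm (z - w) <= nm z + nm w. Proof. by rewrite -(nmN w) nmD. Qed.
Lemma nmBC z w : nm (z - w) = nm (w - z). Proof. by rewrite -nmN opprB. Qed.
Lemma nm0 : nm 0 = 0. Proof. exact: Normc.normc0. Qed.
Lemma nm1 : nm 1 = 1. Proof. exact: Normc.normc1. Qed.
Lemma nmV z : nm z^-1 = (nm z)^-1. Proof. exact: Normc.normcV. Qed.
Lemma nmX z n : nm (z ^+ n) = nm z ^+ n.
Proof. by elim: n => [|n IH]; rewrite ?expr0 ?nm1 // !exprS nmM IH. Qed.
Lemma nm_eq0 z : nm z = 0 -> z = 0. Proof. exact: Normc.eq0_normc. Qed.
Lemma nm_gt0 z : z != 0 -> 0 < nm z.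
Proof.
move=> z0; rewrite lt_neqAle nm_ge0 andbT eq_sym.
by apply/negP => /eqP/nm_eq0 /eqP; rewrite (negbTE z0).
Qed.
Lemma nmR x : nm x%:C%C = `|x|.
Proof. by rewrite /= expr0n addr0 sqrtr_sqr. Qed.
Lemma nmRp x : 0 <= x -> nm x%:C%C = x. Proof. by move=> x0; rewrite nmR ger0_norm. Qed.
Lemma nmn n : nm n%:R = n%:R.
Proof. by rewrite -(rmorph_nat (@real_complex R)) nmRp. Qed.
Lemma nmi : nm 'i%C = 1.
Proof. by rewrite /= expr0n add0r expr1n sqrtr1. Qed.
Lemma nm_sum (I : Type) (r : seq I) (P : pred I) (F : I -> C) :
  nm (\sum_(i <- r | P i) F i) <= \sum_(i <- r | P i) nm (F i).
Proof.
elim/big_ind2 : _ => [|x1 x2 y1 y2 h1 h2|//]; first by rewrite nm0.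
exact: le_trans (nmD _ _) (lerD _ _).
Qed.
Lemma nm_prod (I : Type) (r : seq I) (P : pred I) (F : I -> C) :
  nm (\prod_(i <- r | P i) F i) = \prod_(i <- r | P i) nm (F i).
Proof. exact: (big_morph nm nmM nm1). Qed.
Lemma nm_tri z w : nm z - nm w <= nm (z - w).
Proof. by rewrite lerBlDr -{1}(subrK w z) nmD. Qed.
Lemma Re_le z : `|complex.Re z| <= nm z.
Proof.
case: z => a b /=; rewrite -sqrtr_sqr ler_sqrt; last by rewrite addr_ge0 ?sqr_ge0.
by rewrite lerDl sqr_ge0.
Qed.
Lemma Im_le z : `|complex.Im z| <= nm z.
Proof.
case: z => a b /=; rewrite -sqrtr_sqr ler_sqrt; last by rewrite addr_ge0 ?sqr_ge0.
by rewrite lerDr sqr_ge0.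
Qed.
Lemma ReImE z : z = (complex.Re z)%:C%C + 'i%C * (complex.Im z)%:C%C.
Proof. by case: z => a b; apply/eqP; rewrite eq_complex /= ?(mul0r, mul1r, mulr0, add0r, addr0, subr0, oppr0) !eqxx. Qed.
Lemma nm_ReIm z : nm z <= `|complex.Re z| + `|complex.Im z|.
Proof. by rewrite {1}(ReImE z) (le_trans (nmD _ _))// nmM nmi mul1r !nmR. Qed.

(* Complex differentiability on [R[i]] itself, away from the instance [CC R]; [hasdP] is the bridge. *)
Definition hasd f z l := forall e : R, 0 < e -> exists2 d : R, 0 < d &
  forall h, nm h < d -> nm (f (z + h) - f z - l * h) <= e * nm h.

Definition cont_at f z := forall e : R, 0 < e -> exists2 d : R, 0 < d &
  forall h, nm h < d -> nm (f (z + h) - f z) <= e.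
Definition cont f := forall z, cont_at f z.

Lemma hasdP f z l : hasd f z l <-> is_derive (z : CC R) 1 (f : CC R -> CC R) l.
Proof.
have key : hasd f z l <-> ((fun h : CC R => h^-1 *: (((f : CC R -> CC R) \o shift (z: CC R)) (h *: (1 : CC R)) - f z)) @ (0 : CC R)^' --> (l : CC R))%classic.
  split.
    move=> H; apply/cvgrPdist_le => /= e e0.
    (* In the order of [R[i]] a positive element is real, so the radii occurring in the topology of
       [CC R] are real numbers. *)
    have e0' : 0 < complex.Re e by move: e0; rewrite ltcE => /andP[].
    have eE : e = (complex.Re e)%:C%C.
      by move: e0; rewrite ltcE => /andP[/eqP ie _]; rewrite {1}(complexE e) ie mulr0 addr0.
    have [d d0 Hd] := H _ e0'.
    near=> h.
    have h0 : h != 0 by near: h; exact: nbhs_dnbhs_neq.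
    have hd : nm h < d.
      have : `|h| < d%:C%C.
        near: h; apply: dnbhs0_lt; by rewrite ltcR.
      by rewrite nmE ltcR.
    have {Hd} := Hd _ hd.
    rewrite /= !(@scaler1) /shift /=.
    rewrite ?[h + z]addrC.
    rewrite /GRing.scale /=.
    rewrite (_ : l - h^-1 * (f (z + h) - f z) = - (h^-1 * (f (z + h) - f z - l * h))); last first.
      by field.
    rewrite normrN normrM normfV !nmE eE => Hd.
    rewrite -fmorphV -rmorphM lecR.
    by rewrite mulrC ler_pdivrMr// nm_gt0.
  move=> /cvgrPdist_le H e e0.
  have e0' : 0 < (e%:C%C : C) by rewrite ltcR.
  have := H _ e0'; rewrite /dnbhs /within /=.
  move=> /nbhs_ballP[d /= d0 Hd].
  have d0' : 0 < complex.Re d by move: d0; rewrite ltcE => /andP[].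
  have dE : d = (complex.Re d)%:C%C.
      by move: d0; rewrite ltcE => /andP[/eqP ie _]; rewrite {1}(complexE d) ie mulr0 addr0.
  exists (complex.Re d) => // h hd.
  have [->|h0] := eqVneq h 0; first by rewrite addr0 mulr0 !subrr nm0 mulr0.
  have := Hd h; rewrite -ball_normE /= sub0r normrN nmE dE ltcR => /(_ hd h0).
  rewrite /shift /=.
  rewrite /GRing.scale /= mulr1 [h + z]addrC.
  rewrite (_ : l - h^-1 * (f (z + h) - f z) = - (h^-1 * (f (z + h) - f z - l * h))); last first.
      by field.
  rewrite normrN normrM normfV !nmE.
  rewrite -fmorphV -rmorphM lecR.
  by rewrite mulrC ler_pdivrMr// nm_gt0.
rewrite key; split.
  move=> H; apply: DeriveDef; first by apply: cvgP H.
  by apply: cvg_lim H => //; exact: norm_hausdorff.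
by case=> df <-; exact: df.
Unshelve. all: by end_near. Qed.

Definition dd f : C -> C := (f : CC R -> CC R)^`()%classic.

Definition holo f : Prop := forall z, exists l, hasd f z l.

Lemma hasd_dd f z l : hasd f z l -> dd f z = l.
Proof. by move=> /hasdP[_ <-]; rewrite /dd derive1E. Qed.

Lemma holo_hasd f z : holo f -> hasd f z (dd f z).
Proof. by move=> /(_ z)[l hl]; rewrite (hasd_dd hl). Qed.

Lemma entire_holo f : entire (f : CC R -> CC R) -> holo f.
Proof. by move=> ef z; eexists; apply/hasdP; exact: derivableP (ef z). Qed.

Lemma hasd_holo f : (forall z, exists l, hasd f z l) -> holo f.
Proof. by []. Qed.

Lemma hasd_holo' f f' : (forall z, hasd f z (f' z)) -> holo f.
Proof. by move=> H z; exists (f' z). Qed.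

Lemma dd_fun f f' : (forall z, hasd f z (f' z)) -> dd f = f'.
Proof. by move=> H; apply/funext => z; exact: hasd_dd. Qed.

Lemma hasd_cst l z : hasd (fun=> l) z 0.
Proof. by apply/hasdP; exact: is_derive_cst. Qed.
Lemma hasd_id z : hasd (fun z => z) z 1.
Proof. by apply/hasdP; exact: is_derive_id. Qed.
Lemma hasdD f g z a b : hasd f z a -> hasd g z b -> hasd (fun z => f z + g z) z (a + b).
Proof. by move=> /hasdP h1 /hasdP h2; apply/hasdP; exact: (is_deriveD h1 h2). Qed.
Lemma hasdN f z a : hasd f z a -> hasd (fun z => - f z) z (- a).
Proof. by move=> /hasdP h1; apply/hasdP; exact: (is_deriveN h1). Qed.
Lemma hasdB f g z a b : hasd f z a -> hasd g z b -> hasd (fun z => f z - g z) z (a - b).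
Proof. by move=> h1 h2; apply: hasdD => //; exact: hasdN. Qed.
Lemma hasdM f g z a b : hasd f z a -> hasd g z b ->
  hasd (fun z => f z * g z) z (f z * b + g z * a).
Proof. by move=> /hasdP h1 /hasdP h2; apply/hasdP; exact: (is_deriveM h1 h2). Qed.
Lemma hasdZ f z k a : hasd f z a -> hasd (fun z => k * f z) z (k * a).
Proof. by move=> h1; have := hasdM (hasd_cst k z) h1; rewrite mulr0 addr0. Qed.

Lemma hasd_lip f z l : hasd f z l -> exists2 d : R, 0 < d &
  forall h, nm h < d -> nm (f (z + h) - f z) <= (1 + nm l) * nm h.
Proof.
move=> /(_ 1 ltr01)[d d0 H]; exists d => // h /H; rewrite mul1r => {}H.
rewrite -[X in nm X](subrK (l * h)) mulrDl mul1r.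
by apply: le_trans (nmD _ _) _; rewrite nmM lerD2r.
Qed.

Lemma hasd_cont f z l : hasd f z l -> cont_at f z.
Proof.
move=> /hasd_lip[d d0 H] e e0.
have p : 0 < 1 + nm l by rewrite ltr_wpDr ?nm_ge0.
exists (Num.min d (e / (1 + nm l))); first by rewrite lt_min d0 divr_gt0.
move=> h; rewrite lt_min => /andP[/H hd he]; apply: le_trans hd _.
by rewrite mulrC -ler_pdivlMr// ltW.
Qed.

Lemma holo_cont f : holo f -> cont f.
Proof. by move=> ef z; exact: hasd_cont (holo_hasd z ef). Qed.

Lemma hasd_comp f g z a b : hasd g z a -> hasd f (g z) b -> hasd (fun z => f (g z)) z (b * a).
Proof.
move=> hg hf e e0.
have [d1 d10 H1] := hasd_lip hg.
have p : 0 < 1 + nm a by rewrite ltr_wpDr ?nm_ge0.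
have q : 0 < 1 + nm b by rewrite ltr_wpDr ?nm_ge0.
have [d2 d20 H2] := hf (e / 2 / (1 + nm a)) (divr_gt0 (divr_gt0 e0 (ltr0n _ 2)) p).
have [d3 d30 H3] := hg (e / 2 / (1 + nm b)) (divr_gt0 (divr_gt0 e0 (ltr0n _ 2)) q).
exists (Num.min (Num.min d1 d3) (d2 / (1 + nm a))).
  by rewrite !lt_min d10 d30 divr_gt0.
move=> h; rewrite !lt_min => /andP[/andP[/H1 h1 /H3 h3] h2].
set k := g (z + h) - g z in h1 *.
have kd : nm k < d2.
  by apply: le_lt_trans h1 _; rewrite mulrC -ltr_pdivlMr.
have := H2 _ kd; rewrite {1}/k [g z + _]addrC subrK => {}H2.
rewrite (_ : _ - _ = (f (g (z + h)) - f (g z) - b * k) + b * (k - a * h)); last by ring.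
apply: le_trans (nmD _ _) _; rewrite nmM.
rewrite [leRHS](_ : _ = e / 2 * nm h + e / 2 * nm h); last by field.
apply: lerD.
  apply: le_trans H2 _; rewrite -mulrA ler_pM2l ?divr_gt0//.
  by rewrite mulrC ler_pdivrMr // mulrC.
apply: le_trans (ler_wpM2l (nm_ge0 b) h3) _.
rewrite mulrA ler_wpM2r ?nm_ge0//.
rewrite mulrCA ler_piMr ?(ltW (divr_gt0 e0 (ltr0n _ 2)))//.
by rewrite ler_pdivrMr // mul1r lerDr.
Qed.

Lemma hasd_shift f c z a : hasd f (z + c) a -> hasd (fun z => f (z + c)) z a.
Proof.
move=> h; rewrite -[a]mulr1; apply: (hasd_comp (g := fun z => z + c)) => //.
by rewrite -[1]addr0; apply: hasdD; [exact: hasd_id|exact: hasd_cst].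
Qed.

Lemma hasd_inv z : z != 0 -> hasd (fun z => z^-1) z (- z ^- 2).
Proof.
move=> z0 e e0.
have nz := nm_gt0 z0.
exists (Num.min (nm z / 2) (e * nm z ^+ 3 / 2)).
  by rewrite lt_min !divr_gt0// mulr_gt0// exprn_gt0.
move=> h; rewrite lt_min => /andP[h1 h2].
have n1 : nm z / 2 <= nm (z + h).
  have := nm_tri z (- h); rewrite nmN opprK; lra.
have zh0 : z + h != 0.
  by apply/eqP => zh; move: n1; rewrite zh nm0; lra.
rewrite (_ : _ - _ = h ^+ 2 / (z ^+ 2 * (z + h))); last by field; rewrite z0 zh0.
rewrite nmM nmV nmX nmM nmX ler_pdivrMr; last by rewrite mulr_gt0 ?exprn_gt0 ?nm_gt0.
rewrite expr2 [leRHS]mulrAC; apply: ler_wpM2r; first exact: nm_ge0.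
apply: ltW; apply: lt_le_trans h2 _.
rewrite (_ : _ / 2 = e * (nm z ^+ 2 * (nm z / 2))); last by field.
by rewrite ler_pM2l// ler_pM2l ?exprn_gt0.
Qed.

Lemma cont_atD f g z : cont_at f z -> cont_at g z -> cont_at (fun z => f z + g z) z.
Proof.
move=> hf hg e e0.
have e2 : 0 < e / 2 by rewrite divr_gt0.
have [d1 d10 H1] := hf _ e2; have [d2 d20 H2] := hg _ e2.
exists (Num.min d1 d2); first by rewrite lt_min d10.
move=> h; rewrite lt_min => /andP[/H1 h1 /H2 h2].
rewrite (_ : _ - _ = (f (z + h) - f z) + (g (z + h) - g z)); last by ring.
apply: le_trans (nmD _ _) _; lra.
Qed.

Lemma cont_atM f g z : cont_at f z -> cont_at g z -> cont_at (fun z => f z * g z) z.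
Proof.
move=> hf hg e e0.
set M := nm (f z) + nm (g z) + 1.
have M0 : 0 < M by rewrite ltr_wpDl// addr_ge0 ?nm_ge0.
have e2 : 0 < Num.min 1 (e / M) by rewrite lt_min ltr01 divr_gt0.
have [d1 d10 H1] := hf _ e2; have [d2 d20 H2] := hg _ e2.
exists (Num.min d1 d2); first by rewrite lt_min d10.
move=> h; rewrite lt_min => /andP[/H1 h1 /H2 h2].
set a := f (z + h) - f z in h1; set b := g (z + h) - g z in h2.
rewrite (_ : _ - _ = a * b + f z * b + g z * a); last by rewrite /a /b; ring.
apply: le_trans (nmD _ _) _; apply: le_trans (lerD (nmD _ _) (lexx _)) _.
rewrite !nmM; move: h1 h2; rewrite !le_min => /andP[a1 a2] /andP[b1 b2].
have : M * (e / M) = e by field; exact: lt0r_neq0.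
have := nm_ge0 a; have := nm_ge0 b; have := nm_ge0 (f z); have := nm_ge0 (g z).
rewrite /M; move: (e / _) a2 b2 => k a2 b2; nra.
Qed.

Lemma cont_at_comp f g z : cont_at g z -> cont_at f (g z) -> cont_at (fun z => f (g z)) z.
Proof.
move=> hg hf e e0.
have [d1 d10 H1] := hf _ e0.
have [d2 d20 H2] := hg _ (divr_gt0 d10 (ltr0n _ 2)).
exists d2 => // h /H2 h2.
have := H1 (g (z + h) - g z); rewrite [g z + _]addrC subrK; apply.
by apply: le_lt_trans h2 _; lra.
Qed.

Lemma contD f g : cont f -> cont g -> cont (fun z => f z + g z).
Proof. by move=> hf hg z; exact: cont_atD. Qed.
Lemma contM f g : cont f -> cont g -> cont (fun z => f z * g z).
Proof. by move=> hf hg z; exact: cont_atM. Qed.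
Lemma cont_comp f g : cont f -> cont g -> cont (fun z => f (g z)).
Proof. by move=> hf hg z; exact: cont_at_comp. Qed.
Lemma cont_cst l : cont (fun=> l).
Proof. by move=> z; exact: hasd_cont (hasd_cst l z). Qed.
Lemma cont_id : cont (fun z => z).
Proof. by move=> z; exact: hasd_cont (hasd_id z). Qed.
Lemma contZ k f : cont f -> cont (fun z => k * f z).
Proof. by move=> hf; apply: contM => //; exact: cont_cst. Qed.
Lemma contB f g : cont f -> cont g -> cont (fun z => f z - g z).
Proof.
move=> hf hg; apply: contD => // z.
by have := contZ (-1) hg z; under eq_fun do rewrite mulN1r.
Qed.

Lemma holoD f g : holo f -> holo g -> holo (fun z => f z + g z).
Proof. by move=> hf hg; apply: hasd_holo => z; eexists; apply: hasdD; exact: holo_hasd. Qed.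
Lemma holoB f g : holo f -> holo g -> holo (fun z => f z - g z).
Proof. by move=> hf hg; apply: hasd_holo => z; eexists; apply: hasdB; exact: holo_hasd. Qed.
Lemma holoM f g : holo f -> holo g -> holo (fun z => f z * g z).
Proof. by move=> hf hg; apply: hasd_holo => z; eexists; apply: hasdM; exact: holo_hasd. Qed.
Lemma holo_cst l : holo (fun _ : C => l).
Proof. by apply: hasd_holo => z; eexists; exact: hasd_cst. Qed.
Lemma holo_id : holo (fun z : C => z).
Proof. by apply: hasd_holo => z; eexists; exact: hasd_id. Qed.
Lemma holoZ k f : holo f -> holo (fun z => k * f z).
Proof. by move=> hf; apply: hasd_holo => z; eexists; apply: hasdZ; exact: holo_hasd. Qed.
Lemma holo_comp f g : holo f -> holo g -> holo (fun z => f (g z)).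
Proof. by move=> hf hg; apply: hasd_holo => z; eexists; apply: hasd_comp; exact: holo_hasd. Qed.
Lemma holo_shift f c : holo f -> holo (fun z => f (z + c)).
Proof. by move=> hf; apply: hasd_holo => z; eexists; apply: hasd_shift; exact: holo_hasd. Qed.

Lemma ddD f g : holo f -> holo g -> dd (fun z => f z + g z) = fun z => dd f z + dd g z.
Proof. by move=> hf hg; apply: dd_fun => z; apply: hasdD; exact: holo_hasd. Qed.
Lemma ddB f g : holo f -> holo g -> dd (fun z => f z - g z) = fun z => dd f z - dd g z.
Proof. by move=> hf hg; apply: dd_fun => z; apply: hasdB; exact: holo_hasd. Qed.
Lemma ddM f g : holo f -> holo g ->
  dd (fun z => f z * g z) = fun z => f z * dd g z + g z * dd f z.
Proof. by move=> hf hg; apply: dd_fun => z; apply: hasdM; exact: holo_hasd. Qed.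
Lemma ddZ k f : holo f -> dd (fun z => k * f z) = fun z => k * dd f z.
Proof. by move=> hf; apply: dd_fun => z; apply: hasdZ; exact: holo_hasd. Qed.
Lemma dd_shift f c : holo f -> dd (fun z => f (z + c)) = fun z => dd f (z + c).
Proof. by move=> hf; apply: dd_fun => z; apply: hasd_shift; exact: holo_hasd. Qed.
Lemma dd_cst l : dd (fun=> l) = fun=> 0.
Proof. by apply: dd_fun => z; exact: hasd_cst. Qed.
Lemma dd_id : dd (fun z => z) = fun=> 1.
Proof. by apply: dd_fun => z; exact: hasd_id. Qed.

Lemma hasd_eq f z l l' : hasd f z l -> l = l' -> hasd f z l'.
Proof. by move=> h <-. Qed.

Lemma hasd_lin k z : hasd (fun z => k * z) z k.
Proof. by apply: hasd_eq (hasdZ k (hasd_id z)) (mulr1 k). Qed.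

End ComplexBasics.

Opaque dd.

(** * The complex exponential *)

Section CExp.
Variable R : realType.
Local Notation C := R[i].
Local Notation nm := (@Normc.normc R).
Local Notation cexp := (@cexp R).
Implicit Types (f g : C -> C) (z w h l a b c k : C) (x y t : R).

(** The real counterpart of [hasdP]. It imports the derivatives of [expR], [cos] and [sin], and
    exports those of real and imaginary parts along a segment. *)
Lemma is_derive_epsP (f : R -> R) (x l : R) :
  is_derive x 1 f l <-> (forall e : R, 0 < e -> exists2 d : R, 0 < d &
    forall h : R, `|h| < d -> `|f (x + h) - f x - l * h| <= e * `|h|).
Proof.
have key : (forall e : R, 0 < e -> exists2 d : R, 0 < d &
    forall h : R, `|h| < d -> `|f (x + h) - f x - l * h| <= e * `|h|) <->
  ((fun h : R => h^-1 *: ((f \o shift x) (h *: (1 : R)) - f x)) @ (0 : R)^' --> (l : R))%classic.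
  split.
    move=> H; apply/cvgrPdist_le => /= e e0.
    have [d d0 Hd] := H _ e0.
    near=> h.
    have h0 : h != 0 by near: h; exact: nbhs_dnbhs_neq.
    have hd : `|h| < d by near: h; exact: dnbhs0_lt.
    have {Hd} := Hd _ hd.
    rewrite /= /shift /= /GRing.scale /= mulr1 [h + x]addrC.
    rewrite (_ : l - h^-1 * (f (x + h) - f x) = - (h^-1 * (f (x + h) - f x - l * h))); last first.
      by field.
    rewrite normrN normrM normfV => Hd.
    by rewrite mulrC ler_pdivrMr// normr_gt0.
  move=> /cvgrPdist_le H e e0.
  have := H _ e0; rewrite /dnbhs /within /=.
  move=> /nbhs_ballP[/= d d0 Hd].
  exists d => // h hd.
  have [->|h0] := eqVneq h 0; first by rewrite addr0 mulr0 !subrr normr0 mulr0.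
  have := Hd h; rewrite -ball_normE /= sub0r normrN => /(_ hd h0).
  rewrite /shift /= /GRing.scale /= mulr1 [h + x]addrC.
  rewrite (_ : l - h^-1 * (f (x + h) - f x) = - (h^-1 * (f (x + h) - f x - l * h))); last first.
    by field.
  rewrite normrN normrM normfV.
  by rewrite mulrC ler_pdivrMr// normr_gt0.
rewrite key; split.
  by case=> df <-; exact: df.
move=> H; apply: DeriveDef; first by apply: cvgP H.
by apply: cvg_lim H => //; exact: norm_hausdorff.
Unshelve. all: by end_near. Qed.

Lemma cexpE z : cexp z = (expR (complex.Re z) * cos (complex.Im z) +i* (expR (complex.Re z) * sin (complex.Im z)))%C.
Proof. by rewrite /cexp; simpc. Qed.

Lemma cexpD z w : cexp (z + w) = cexp z * cexp w.
Proof.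
case: z w => [a b] [c d]; rewrite !cexpE /= expRD cosD sinD.
by apply/eqP; rewrite eq_complex /=; apply/andP; split; apply/eqP; ring.
Qed.

Lemma cexp_real x : cexp x%:C%C = (expR x)%:C%C.
Proof. by rewrite cexpE /= cos0 sin0 mulr1 mulr0. Qed.

Lemma cexp0 : cexp 0 = 1.
Proof. by rewrite cexp_real expR0. Qed.

Lemma cexpNV z : cexp (- z) * cexp z = 1.
Proof. by rewrite -cexpD addNr cexp0. Qed.

Lemma cexp_neq0 z : cexp z != 0.
Proof.
by apply/eqP => H; have := cexpNV z; rewrite H mulr0 => /eqP; rewrite eq_sym oner_eq0.
Qed.

Lemma cexpN z : cexp (- z) = (cexp z)^-1.
Proof. by apply: (mulIf (cexp_neq0 z)); rewrite cexpNV mulVf ?cexp_neq0. Qed.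

Lemma cexpB z w : cexp (z - w) = cexp z / cexp w.
Proof. by rewrite cexpD cexpN. Qed.

Lemma cexpMn z n : cexp (z *+ n) = cexp z ^+ n.
Proof. by elim: n => [|n IH]; rewrite ?mulr0n ?cexp0// mulrS cexpD IH exprS. Qed.

Lemma nm_cexp z : nm (cexp z) = expR (complex.Re z).
Proof.
rewrite cexpE /= !exprMn -mulrDr cos2Dsin2 mulr1 sqrtr_sqr ger0_norm//.
Qed.

Lemma cexp_2pi z : cexp (z + 'i%C * (2 * pi)%:C%C) = cexp z.
Proof.
rewrite cexpD [X in _ * X](_ : _ = 1) ?mulr1// cexpE /=.
rewrite ?(mul0r, mul1r, mulr0, addr0, add0r, subr0, oppr0) expR0.
by rewrite [2 * _]mulrC mulr_natr cos2pi sin2pi mulr1 mulr0.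
Qed.

Lemma cexp_surj z : z != 0 -> exists w, cexp w = z.
Proof.
move=> z0; have n0 := nm_gt0 z0.
set u := z / (nm z)%:C%C.
have nu : nm u = 1 by rewrite nmM nmV nmRp ?nm_ge0// divff// gt_eqF.
have zE : z = (nm z)%:C%C * u by rewrite /u mulrC divfK// fmorph_eq0 gt_eqF.
clearbody u; case: u nu zE => x y nu zE.
have xy : x ^+ 2 + y ^+ 2 = 1.
  by have := congr1 (fun t => t ^+ 2) nu; rewrite /= sqr_sqrtr ?addr_ge0 ?sqr_ge0// expr1n.
have x1 : -1 <= x <= 1.
  apply/andP; split; have := sqr_ge0 y; nra.
(* The values of [acos] lie in the upper half turn, so the sign of [y] chooses between [acos x] and
   its opposite. *)
have [t ct st] : exists2 t, cos t = x & sin t = y.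
  have [y0|y0] := leP 0 y.
    exists (acos x); first by rewrite acosK// in_itv.
    by rewrite sin_acos// -xy addrC addKr sqrtr_sqr ger0_norm.
  exists (- acos x); first by rewrite cosN acosK// in_itv.
  by rewrite sinN sin_acos// -xy addrC addKr sqrtr_sqr ltr0_norm// opprK.
exists ((ln (nm z)) +i* t)%C; rewrite /cexp /= ct st lnK//; exact: esym.
Qed.

Lemma hasd_cexp0 : hasd cexp 0 1.
Proof.
move=> e e0; rewrite cexp0.
(* The error budget: [B1] costs [(1 + 3) e / 8] and [B2] costs [3 e / 8 + 2 e / 16], together [e].
   The alternative tolerance 1 is there for the crude bounds [E1] and [E2]. *)
have [d1 d10 H1] := (is_derive_epsP expR 0 (expR 0)).1 (is_derive_expR 0) (Num.min 1 (e / 8)) ltac:(by rewrite lt_min ltr01 divr_gt0).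
have [d2 d20 H2] := (is_derive_epsP cos 0 (- sin 0)).1 (is_derive_cos 0) (e / 8) ltac:(by rewrite divr_gt0).
have [d3 d30 H3] := (is_derive_epsP sin 0 (cos 0)).1 (is_derive_sin 0) (e / 8) ltac:(by rewrite divr_gt0).
exists (Num.min (Num.min d1 (Num.min d2 d3)) (Num.min 1 (e / 16))).
  by rewrite !lt_min d10 d20 d30 ltr01 divr_gt0.
move=> h; rewrite !lt_min => /andP[/andP[h1 /andP[h2 h3]] /andP[h4 h5]].
have rx := Re_le h; have ry := Im_le h.
have {}H1 := H1 _ (le_lt_trans rx h1); have {}H2 := H2 _ (le_lt_trans ry h2).
have {}H3 := H3 _ (le_lt_trans ry h3).
move: rx ry h4 h5 H1 H2 H3; move: (nm_ge0 h).
rewrite !add0r expR0 cos0 sin0 !mul1r subr0 oppr0 mul0r subr0.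
set n := nm h; set x := complex.Re h; set y := complex.Im h.
move=> n0 xn yn n1 ne H1 H2 H3.
have -> : cexp h - 1 - h = ((expR x * cos y - 1 - x) +i* (expR x * sin y - y))%C.
  rewrite cexpE -/x -/y; apply/eqP; rewrite eq_complex /x /y; apply/andP.
  by case: (h) => p q; split; apply/eqP => /=; ring.
apply: le_trans (nm_ReIm _) _ => /=.
set E := expR x in H1 *.
have E1 : `|E - 1| <= 2 * n.
  rewrite -(subrK x (E - 1)); apply: le_trans (ler_normD _ _) _.
  have : `|E - 1 - x| <= `|x|.
    by apply: le_trans H1 _; rewrite ler_piMl ?normr_ge0// ge_min lexx.
  lra.
have E2 : `|E| <= 3.
  rewrite -(subrK 1 E); apply: le_trans (ler_normD _ _) _; rewrite normr1; lra.
have A1 : `|E - 1 - x| <= e / 8 * n.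
  apply: le_trans H1 _; apply: (@le_trans _ _ (e / 8 * `|x|)).
    by rewrite ler_wpM2r// ge_min lexx orbT.
  by rewrite ler_wpM2l// ltW// divr_gt0.
have A2 : `|cos y - 1| <= e / 8 * n.
  by apply: le_trans H2 _; rewrite ler_wpM2l// ltW// divr_gt0.
have A3 : `|sin y - y| <= e / 8 * n.
  by apply: le_trans H3 _; rewrite ler_wpM2l// ltW// divr_gt0.
have B1 : `|E * cos y - 1 - x| <= e / 8 * n + 3 * (e / 8 * n).
  rewrite (_ : _ - x = (E - 1 - x) + E * (cos y - 1)); last by ring.
  apply: le_trans (ler_normD _ _) _; apply: lerD => //.
  by rewrite normrM ler_pM.
have B2 : `|E * sin y - y| <= 3 * (e / 8 * n) + 2 * n * (e / 16).
  rewrite (_ : _ - y = E * (sin y - y) + (E - 1) * y); last by ring.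
  apply: le_trans (ler_normD _ _) _; apply: lerD => //; rewrite normrM ler_pM//.
  lra.
lra.
Qed.

Lemma hasd_cexp z : hasd cexp z (cexp z).
Proof.
move=> e e0.
have e1 : 0 < e / expR (complex.Re z) by rewrite divr_gt0// expR_gt0.
have [d d0 H] := hasd_cexp0 e1; exists d => // h /H.
rewrite add0r cexp0 => {}H.
rewrite cexpD (_ : _ - _ = cexp z * (cexp h - 1 - 1 * h)); last by ring.
rewrite nmM nm_cexp.
rewrite mulrC -ler_pdivlMr ?expR_gt0//; apply: le_trans H _.
by rewrite mulrAC.
Qed.

Lemma holo_cexp : holo cexp.
Proof. exact: hasd_holo' hasd_cexp. Qed.

Lemma hasd_cexp_comp f z l : hasd f z l -> hasd (fun z => cexp (f z)) z (cexp (f z) * l).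
Proof. by move=> hf; apply: hasd_comp hf (hasd_cexp _). Qed.

Lemma holo_cexp_comp f : holo f -> holo (fun z => cexp (f z)).
Proof. by move=> hf; apply: hasd_holo => z; eexists; apply: hasd_comp (holo_hasd z hf) (hasd_cexp _). Qed.

Lemma dd_cexp f : holo f -> dd (fun z => cexp (f z)) = fun z => cexp (f z) * dd f z.
Proof. by move=> hf; apply: dd_fun => z; apply: hasd_comp (holo_hasd z hf) (hasd_cexp _). Qed.

End CExp.

Arguments Normc.normc : simpl never.
Opaque cexp.

(** * Integrals over segments and the theorem of Goursat *)

Section CIntegral.
Variable R : realType.
Local Notation C := R[i].
Local Notation nm := (@Normc.normc R).
Local Notation cexp := (@cexp R).
Local Notation mu := (@lebesgue_measure R).
Implicit Types (f g : C -> C) (u v : R -> R) (z w h l : C) (a b c d x y t : R).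

Definition rint u a b : R := \int[mu]_(t in `[a, b]%classic) u t.
Definition cint f a b : C :=
  (rint (fun t => complex.Re (f t%:C%C)) a b +i* rint (fun t => complex.Im (f t%:C%C)) a b)%C.

Lemma cont_integrable u a b : continuous u -> mu.-integrable `[a, b]%classic (EFin \o u).
Proof.
move=> cu; apply: continuous_compact_integrable; first exact: segment_compact.
exact: continuous_subspaceT.
Qed.

Lemma rintD u v a b : continuous u -> continuous v ->
  rint (fun t => u t + v t) a b = rint u a b + rint v a b.
Proof. by move=> cu cv; rewrite /rint RintegralD//; exact: cont_integrable. Qed.

Lemma rintZ (k : R) u a b : continuous u -> rint (fun t => k * u t) a b = k * rint u a b.
Proof. by move=> cu; rewrite /rint RintegralZl//; exact: cont_integrable. Qed.

Lemma rint_le u v a b : continuous u -> continuous v ->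
  (forall t, a <= t <= b -> u t <= v t) -> rint u a b <= rint v a b.
Proof.
move=> cu cv H; apply: le_Rintegral => //; try exact: cont_integrable.
Qed.

Lemma rint_eq u v a b : (forall t, a <= t <= b -> u t = v t) -> rint u a b = rint v a b.
Proof. by move=> H; apply: eq_Rintegral => t; rewrite inE /= in_itv /=; exact: H. Qed.

Lemma rint_cst (k : R) a b : a <= b -> rint (fun=> k) a b = k * (b - a).
Proof.
move=> ab; transitivity (k * fine (mu `[a, b]%classic)); first exact: Rintegral_cst.
rewrite (@lebesgue_measure_itv R `[a, b]) /=.
case: ifP => /=; rewrite lte_fin => h //; congr (_ * _).
by have -> : a = b; [apply/eqP; rewrite eq_le ab leNgt h|rewrite subrr].
Qed.

Lemma rint_cat u a b c : continuous u -> a <= b -> b <= c ->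
  rint u a c = rint u a b + rint u b c.
Proof.
move=> cu ab bc; rewrite -(subrK (rint u a b) (rint u a c)) addrC; congr (_ + _).
rewrite /rint Rintegral_itvB ?bnd_simp//; last exact: cont_integrable.
rewrite Rintegral_itv_obnd_cbnd//.
apply: integrableS (cont_integrable b c cu) => //.
by apply: subset_itv; rewrite bnd_simp.
Qed.

Lemma rint_FTC (U u : R -> R) a b : a <= b -> continuous u ->
  (forall t, is_derive t 1 U (u t)) -> rint u a b = U b - U a.
Proof.
rewrite le_eqVlt => /orP[/eqP -> _ _|ab cu H].
  by rewrite /rint set_itv1 Rintegral_set1 subrr.
have cU : continuous U.
  by move=> t; apply/differentiable_continuous/derivable1_diffP; case: (H t).
rewrite /rint /Rintegral (@continuous_FTC2 _ _ U)//.
- exact: continuous_subspaceT.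
- split; first by move=> t _; case: (H t).
  + by apply: cvg_at_right_filter; exact: cU.
  + by apply: cvg_at_left_filter; exact: cU.
- by move=> t _; rewrite derive1E; case: (H t).
Qed.

Lemma cont_Re f : cont f -> continuous (fun t : R => complex.Re (f t%:C%C)).
Proof.
move=> cf t; apply/cvgrPdist_le => e e0; have [d d0 H] := cf t%:C%C e e0.
near=> s; rewrite distrC -raddfB /=.
apply: le_trans (Re_le _) _.
have := H (s - t)%:C%C; rewrite nmR -rmorphD /= [t + _]addrC subrK; apply.
rewrite distrC; near: s; exact: (@cvgr_dist_lt _ _ _ (nbhs t) _ id t cvg_id _ d0).
Unshelve. all: by end_near. Qed.

Lemma cont_Im f : cont f -> continuous (fun t : R => complex.Im (f t%:C%C)).
Proof.
move=> cf t; apply/cvgrPdist_le => e e0; have [d d0 H] := cf t%:C%C e e0.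
near=> s; rewrite distrC -raddfB /=.
apply: le_trans (Im_le _) _.
have := H (s - t)%:C%C; rewrite nmR -rmorphD /= [t + _]addrC subrK; apply.
rewrite distrC; near: s; exact: (@cvgr_dist_lt _ _ _ (nbhs t) _ id t cvg_id _ d0).
Unshelve. all: by end_near. Qed.

Lemma cintD f g a b : cont f -> cont g -> cint (fun z => f z + g z) a b = cint f a b + cint g a b.
Proof.
move=> cf cg; apply/eqP; rewrite eq_complex /=; apply/andP; split; apply/eqP.
  rewrite -rintD; [|exact: cont_Re|exact: cont_Re].
  by apply: rint_eq => t _; rewrite raddfD.
rewrite -rintD; [|exact: cont_Im|exact: cont_Im].
by apply: rint_eq => t _; rewrite raddfD.
Qed.

Lemma cintZ (k : C) f a b : cont f -> cint (fun z => k * f z) a b = k * cint f a b.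
Proof.
move=> cf; have c1 := cont_Re cf; have c2 := cont_Im cf.
have zl (m : R) (v : R -> R) : continuous v -> continuous (fun t => m * v t).
  by move=> cv t; apply: cvgM; [exact: cvg_cst|exact: cv].
case: k => p q; apply/eqP; rewrite eq_complex /=; apply/andP; split; apply/eqP.
  rewrite -mulNr -!rintZ// -rintD; [|exact: zl|exact: zl].
  by apply: rint_eq => t _; case: (f _) => ? ? /=; rewrite mulNr.
rewrite -!rintZ// -rintD; [|exact: zl|exact: zl].
by apply: rint_eq => t _; case: (f _) => ? ? /=.
Qed.

Lemma cintB f g a b : cont f -> cont g -> cint (fun z => f z - g z) a b = cint f a b - cint g a b.
Proof.
move=> cf cg; rewrite -mulN1r -cintZ// -cintD//; last exact: contZ.
by congr cint; apply/funext => z; rewrite mulN1r.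
Qed.

Lemma cint_eq f g a b : (forall t, a <= t <= b -> f t%:C%C = g t%:C%C) -> cint f a b = cint g a b.
Proof. by move=> H; congr (_ +i* _)%C; apply: rint_eq => t /H ->. Qed.

Lemma cint_cst (k : C) a b : a <= b -> cint (fun=> k) a b = k * (b - a)%:C%C.
Proof. by move=> ab; rewrite /cint !rint_cst//; case: k => p q; simpc. Qed.

Lemma cint_cat f a b c : cont f -> a <= b -> b <= c -> cint f a c = cint f a b + cint f b c.
Proof.
by move=> cf ab bc; rewrite /cint (rint_cat (cont_Re cf) ab bc) (rint_cat (cont_Im cf) ab bc); simpc.
Qed.

(** The factor 2 comes from bounding real and imaginary parts separately. Sharp constants do not
    matter in what follows, and this 2 propagates to the Cauchy estimates. *)
Lemma cint_nm f (M : R) a b : cont f -> a <= b ->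
  (forall t, a <= t <= b -> nm (f t%:C%C) <= M) -> nm (cint f a b) <= 2 * M * (b - a).
Proof.
move=> cf ab H.
have key v : continuous v -> (forall t, a <= t <= b -> `|v t| <= M) -> `|rint v a b| <= M * (b - a).
  move=> cv Hv; have cM (m : R) : continuous (fun _ : R => m) by move=> ?; exact: cvg_cst.
  rewrite ler_norml; apply/andP; split.
    rewrite -mulNr -rint_cst//; apply: rint_le => // t /Hv.
    by rewrite ler_norml => /andP[].
  rewrite -rint_cst//; apply: rint_le => // t /Hv.
  by rewrite ler_norml => /andP[].
apply: le_trans (nm_ReIm _) _ => /=.
rewrite (_ : 2 * M * (b - a) = M * (b - a) + M * (b - a)); last by ring.
apply: lerD; apply: key.
- exact: cont_Re.
- by move=> t /H; apply: le_trans; exact: Re_le.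
- exact: cont_Im.
- by move=> t /H; apply: le_trans; exact: Im_le.
Qed.

Lemma cint_FTC (F f : C -> C) a b : a <= b -> cont f -> (forall z, hasd F z (f z)) ->
  cint f a b = F b%:C%C - F a%:C%C.
Proof.
move=> ab cf H.
have -> : cint f a b = ((complex.Re (F b%:C%C) - complex.Re (F a%:C%C)) +i* (complex.Im (F b%:C%C) - complex.Im (F a%:C%C)))%C.
  congr (_ +i* _)%C.
    apply: (@rint_FTC (fun t => complex.Re (F t%:C%C))) => //; first exact: cont_Re.
    move=> t; apply/is_derive_epsP => e e0; have [d d0 Hd] := H t%:C%C e e0.
    exists d => // s sd; have := Hd s%:C%C; rewrite nmR => /(_ sd); apply: le_trans.
    apply: le_trans (Re_le _); rewrite rmorphD /=.
    by case: (F _) (F _) (f _) => [? ?] [? ?] [? ?] /=; rewrite mulr0 subr0.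
  apply: (@rint_FTC (fun t => complex.Im (F t%:C%C))) => //; first exact: cont_Im.
  move=> t; apply/is_derive_epsP => e e0; have [d d0 Hd] := H t%:C%C e e0.
  exists d => // s sd; have := Hd s%:C%C; rewrite nmR => /(_ sd); apply: le_trans.
  apply: le_trans (Im_le _); rewrite rmorphD /=.
  by case: (F _) (F _) (f _) => [? ?] [? ?] [? ?] /=; rewrite mulr0 add0r.
by case: (F _) (F _) => [? ?] [? ?].
Qed.

End CIntegral.

(** * Boundary integrals of rectangles and bisection *)

Section Goursat.
Variable R : realType.
Local Notation C := R[i].
Local Notation nm := (@Normc.normc R).
Implicit Types (f g : C -> C) (z w h l k : C) (a b c d x y t : R).

Definition vert x z : C := x%:C%C + 'i%C * z.
Definition horz y z : C := z + 'i%C * y%:C%C.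
Definition hseg f a b y := cint (fun z => f (horz y z)) a b.
Definition vseg f c d x := cint (fun z => f (vert x z)) c d.
(** The counterclockwise boundary integral, bottom minus top plus right minus left; the factor ['i]
    is the derivative of [vert]. *)
Definition rectint f a b c d : C :=
  hseg f a b c - hseg f a b d + 'i%C * (vseg f c d b - vseg f c d a).

Lemma hasd_vert x z : hasd (vert x) z 'i%C.
Proof.
have := hasdD (hasd_cst x%:C%C z) (hasdZ 'i%C (hasd_id z)).
by rewrite add0r mulr1.
Qed.
Lemma hasd_horz y z : hasd (horz y) z 1.
Proof.
have := hasdD (hasd_id z) (hasd_cst ('i%C * y%:C%C) z).
by rewrite addr0.
Qed.
Lemma cont_vert f x : cont f -> cont (fun z => f (vert x z)).
Proof. by move=> cf; apply: cont_comp => // z; exact: hasd_cont (hasd_vert _ _). Qed.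
Lemma cont_horz f y : cont f -> cont (fun z => f (horz y z)).
Proof. by move=> cf; apply: cont_comp => // z; exact: hasd_cont (hasd_horz _ _). Qed.

Lemma sqri : 'i%C * 'i%C = -1 :> C.
Proof. by apply/eqP; rewrite eq_complex /=; apply/andP; split; apply/eqP; ring. Qed.

Lemma rectintD f g a b c d : cont f -> cont g ->
  rectint (fun z => f z + g z) a b c d = rectint f a b c d + rectint g a b c d.
Proof.
move=> cf cg; rewrite /rectint /hseg /vseg.
rewrite !cintD; try by [exact: cont_vert|exact: cont_horz].
by ring.
Qed.

Lemma rectint_split f a b c d m n : cont f -> a <= m <= b -> c <= n <= d ->
  rectint f a b c d = rectint f a m c n + rectint f m b c n
    + rectint f a m n d + rectint f m b n d.
Proof.
move=> cf /andP[am mb] /andP[cn nd]; rewrite /rectint /hseg /vseg.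
rewrite !(@cint_cat _ _ a m b)//; try exact: cont_horz.
rewrite !(@cint_cat _ _ c n d)//; try exact: cont_vert.
by ring.
Qed.

Lemma rectint_prim (F f : C -> C) a b c d : a <= b -> c <= d -> cont f ->
  (forall z, hasd F z (f z)) -> rectint f a b c d = 0.
Proof.
move=> ab cd cf H; rewrite /rectint /hseg /vseg.
have Hh y : cint (fun z => f (horz y z)) a b = F (horz y b%:C%C) - F (horz y a%:C%C).
  rewrite (@cint_FTC _ (fun z => F (horz y z)))//; first exact: cont_horz.
  by move=> z; rewrite -[f _]mulr1; apply: hasd_comp (H _); exact: hasd_horz.
have Hv x : cint (fun z => f (vert x z)) c d = - 'i%C * (F (vert x d%:C%C) - F (vert x c%:C%C)).
  rewrite mulrBr (@cint_FTC _ (fun z => - 'i%C * F (vert x z)))//; first exact: cont_vert.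
  move=> z; rewrite [f _](_ : _ = - 'i%C * (f (vert x z) * 'i%C)); last first.
    by rewrite mulrCA mulNr sqri opprK mulr1.
  by apply: hasdZ; apply: hasd_comp (H _); exact: hasd_vert.
rewrite !Hh !Hv /horz /vert.
have i2 := sqri.
rewrite mulrBr !mulrA !mulrN !mulNr !i2.
by ring.
Qed.

Lemma rectint_nm f (M : R) a b c d : cont f -> a <= b -> c <= d ->
  (forall x y, a <= x <= b -> c <= y <= d -> nm (f (x%:C%C + 'i%C * y%:C%C)) <= M) ->
  nm (rectint f a b c d) <= 4 * M * ((b - a) + (d - c)).
Proof.
move=> cf ab cd H.
have h1 y : c <= y <= d -> nm (hseg f a b y) <= 2 * M * (b - a).
  by move=> cyd; apply: cint_nm => //; [exact: cont_horz|move=> t abt; exact: H].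
have h2 x : a <= x <= b -> nm (vseg f c d x) <= 2 * M * (d - c).
  by move=> axb; apply: cint_nm => //; [exact: cont_vert|move=> t abt; exact: H].
have := h1 c; have := h1 d; have := h2 a; have := h2 b.
rewrite !lexx ab cd => /(_ isT) k1 /(_ isT) k2 /(_ isT) k3 /(_ isT) k4.
apply: le_trans (nmD _ _) _; rewrite nmM nmi mul1r.
have := nmB (hseg f a b c) (hseg f a b d).
have := nmB (vseg f c d b) (vseg f c d a).
lra.
Qed.

(** A rectangle is coded by its two sides, [r.1] the interval of real parts and [r.2] that of
    imaginary parts. *)
Definition quarter (r s : (R * R) * (R * R)) :=
  [\/ s = ((r.1.1, (r.1.1 + r.1.2) / 2), (r.2.1, (r.2.1 + r.2.2) / 2)),
      s = (((r.1.1 + r.1.2) / 2, r.1.2), (r.2.1, (r.2.1 + r.2.2) / 2)),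
      s = ((r.1.1, (r.1.1 + r.1.2) / 2), ((r.2.1 + r.2.2) / 2, r.2.2)) |
      s = (((r.1.1 + r.1.2) / 2, r.1.2), ((r.2.1 + r.2.2) / 2, r.2.2))].

Lemma pow2_small (S e : R) : 0 <= S -> 0 < e -> exists n, S / 2 ^+ n < e.
Proof.
move=> S0 e0; exists (Num.bound (S / e)).
have := archi_boundP (divr_ge0 S0 (ltW e0)); set n := Num.bound _.
rewrite ltr_pdivrMr// => H; rewrite ltr_pdivrMr ?exprn_gt0// mulrC; apply: lt_le_trans H _.
by rewrite ler_pM2r// -natrX ler_nat ltnW// ltn_expl.
Qed.

Lemma nested_limit (p q : nat -> R) : (forall n, p n <= q n) ->
  (forall n, p n <= p n.+1) -> (forall n, q n.+1 <= q n) ->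
  exists x, forall n, p n <= x <= q n.
Proof.
move=> pq pi qd.
have pm m n : (m <= n)%N -> p m <= p n.
  by move=> /subnK <-; elim: (n - m)%N => // k IH; rewrite addSn (le_trans IH).
have qm m n : (m <= n)%N -> q n <= q m.
  by move=> /subnK <-; elim: (n - m)%N => // k IH; rewrite addSn; apply: le_trans IH.
have ub n : ubound (range p) (q n).
  move=> _ [m _ <-]; apply: le_trans (pm m (maxn m n) (leq_maxl _ _)) _.
  by apply: le_trans (pq _) (qm _ _ (leq_maxr _ _)).
have hs : has_sup (range p).
  by split; [exists (p 0%N), 0%N|exists (q 0%N); exact: ub].
exists (sup (range p)) => n; apply/andP; split.
  by apply: sup_upper_bound => //; exists n.
by apply: sup_le_ub; [exists (p 0%N), 0%N|exact: ub].
Qed.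

Definition rvalid (r : (R * R) * (R * R)) := r.1.1 <= r.1.2 /\ r.2.1 <= r.2.2.
Definition rsize (r : (R * R) * (R * R)) := (r.1.2 - r.1.1) + (r.2.2 - r.2.1).
Definition inrect (r : (R * R) * (R * R)) z :=
  r.1.1 <= complex.Re z <= r.1.2 /\ r.2.1 <= complex.Im z <= r.2.2.

Lemma quarterP (t s : (R * R) * (R * R)) : quarter t s -> rvalid t -> rvalid s /\
    [/\ t.1.1 <= s.1.1, s.1.2 <= t.1.2, t.2.1 <= s.2.1, s.2.2 <= t.2.2 & rsize s = rsize t / 2].
Proof.
rewrite /rvalid /rsize; case: t => [[p q] [u v]] /= qt [h1 h2].
by split; [case: qt => -> /=; split; lra|case: qt => -> /=; split; lra].
Qed.

Lemma inrect_quarter (t : (R * R) * (R * R)) z : inrect t z -> exists2 s, quarter t s & inrect s z.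
Proof.
move=> [/andP[a1 a2] /andP[b1 b2]].
have [ha|/ltW ha] := leP (complex.Re z) ((t.1.1 + t.1.2) / 2);
have [hb|/ltW hb] := leP (complex.Im z) ((t.2.1 + t.2.2) / 2).
- by eexists; [exact: Or41|split; apply/andP].
- by eexists; [exact: Or43|split; apply/andP].
- by eexists; [exact: Or42|split; apply/andP].
- by eexists; [exact: Or44|split; apply/andP].
Qed.

(** Compactness of a rectangle as an induction principle. If [P] failed on [r0], it would fail on a
    nested sequence of quarters shrinking to a point, against the local hypothesis there. Goursat's
    theorem, boundedness and uniform continuity on discs are all instances. *)
Lemma bisect (P : (R * R) * (R * R) -> Prop) r0 : rvalid r0 ->
  (forall r, rvalid r -> (forall s, quarter r s -> P s) -> P r) ->
  (forall z, inrect r0 z -> exists2 e : R, 0 < e &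
     forall s, rvalid s -> inrect s z -> rsize s < e -> P s) ->
  P r0.
Proof.
move=> v0 Hq Hloc; apply: contrapT => nP0.
have step r : exists s, rvalid r -> ~ P r -> quarter r s /\ ~ P s.
  have [[vr nPr]|H] := pselect (rvalid r /\ ~ P r); last by exists r => v n; case: H.
  apply: contrapT => /forallNP H; apply/nPr/Hq => // s qs; apply: contrapT => nPs.
  by apply: (H s) => _ _.
have [nxt Hn] := choice step.
pose r := fix r n := if n is m.+1 then nxt (r m) else r0.
have inv n : [/\ rvalid (r n), ~ P (r n) & rsize (r n) = rsize r0 / 2 ^+ n].
  elim: n => [|n [h1 h2 h3]]; first by rewrite expr0 divr1.
  have [qr nP] := Hn (r n) h1 h2; have [v' [_ _ _ _ sz]] := quarterP qr h1.
  by split => //; rewrite sz h3 exprS invfM; ring.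
have mono n : [/\ (r n).1.1 <= (r n.+1).1.1, (r n.+1).1.2 <= (r n).1.2,
    (r n).2.1 <= (r n.+1).2.1 & (r n.+1).2.2 <= (r n).2.2].
  have [h1 h2 _] := inv n; have [qr _] := Hn (r n) h1 h2.
  by have [_ []] := quarterP qr h1.
have [x hx] : exists x, forall n, (r n).1.1 <= x <= (r n).1.2.
  by apply: nested_limit => n; [case: (inv n) => -[]|case: (mono n)|case: (mono n)].
have [y hy] : exists x, forall n, (r n).2.1 <= x <= (r n).2.2.
  by apply: nested_limit => n; [case: (inv n) => -[]|case: (mono n)|case: (mono n)].
have [e e0 He] := Hloc (x +i* y)%C (conj (hx 0%N) (hy 0%N)).
have S0 : 0 <= rsize r0 by case: v0 => ? ?; rewrite addr_ge0// subr_ge0.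
have [n Hn2] := pow2_small S0 e0.
have [h1 h2 h3] := inv n.
apply: h2; apply: (He _ h1); first by split; [exact: hx|exact: hy].
by rewrite h3.
Qed.

(** The bound [4 e size^2] is stable under bisection: a quarter has half the size, hence a quarter
    of the allowance. Near a point, [f] differs by at most [e size] from its affine part, whose
    boundary integral vanishes because it has a primitive. Differentiability is asked on the
    rectangle alone, so that exceptional points outside it are harmless. *)
Lemma goursat f a b c d : cont f -> a <= b -> c <= d ->
  (forall x y, a <= x <= b -> c <= y <= d -> exists l, hasd f (x%:C%C + 'i%C * y%:C%C) l) ->
  rectint f a b c d = 0.
Proof.
move=> cf ab cd H.
pose rint_of r := rectint f r.1.1 r.1.2 r.2.1 r.2.2.
suff key e : 0 < e -> nm (rint_of ((a, b), (c, d))) <= 4 * e * rsize ((a, b), (c, d)) ^+ 2.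
  apply: nm_eq0; apply/eqP; rewrite eq_le nm_ge0 andbT; apply/ler_addgt0Pr => e e0; rewrite add0r.
  set S := rsize ((a, b), (c, d)) in key *.
  have q0 : 0 < 4 * S ^+ 2 + 1 by rewrite ltr_wpDl// mulr_ge0// sqr_ge0.
  apply: le_trans (key _ (divr_gt0 e0 q0)) _.
  rewrite [leLHS](_ : _ = (4 * S ^+ 2) / (4 * S ^+ 2 + 1) * e); last by field; rewrite lt0r_neq0.
  by rewrite ler_piMl ?ltW// ltr_pdivrMr// mul1r ltrDl.
move=> e0; apply: (@bisect (fun r => nm (rint_of r) <= 4 * e * rsize r ^+ 2)) => //.
  move=> r [v1 v2] Hs.
  have m1 : r.1.1 <= (r.1.1 + r.1.2) / 2 <= r.1.2 by apply/andP; split; lra.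
  have m2 : r.2.1 <= (r.2.1 + r.2.2) / 2 <= r.2.2 by apply/andP; split; lra.
  rewrite /rint_of (rectint_split cf m1 m2).
  have hs (t : (R * R) * (R * R)) : quarter r t -> nm (rint_of t) <= e * rsize r ^+ 2.
    move=> qt; apply: le_trans (Hs _ qt) _; have [_ [_ _ _ _ ->]] := quarterP qt (conj v1 v2).
    by rewrite expr_div_n; lra.
  rewrite -mulrA (_ : 4 * _ = e * rsize r ^+ 2 + e * rsize r ^+ 2 + e * rsize r ^+ 2 + e * rsize r ^+ 2); last by ring.
  apply: le_trans (nmD _ _) (lerD _ (hs _ (Or44 _ _ _ erefl))).
  apply: le_trans (nmD _ _) (lerD _ (hs _ (Or43 _ _ _ erefl))).
  exact: le_trans (nmD _ _) (lerD (hs _ (Or41 _ _ _ erefl)) (hs _ (Or42 _ _ _ erefl))).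
move=> z zr; have [l hl] : exists l, hasd f z l.
  by have [zr1 zr2] := zr; rewrite (ReImE z); exact: H.
have [dl dl0 Hd] := hl _ e0; exists dl => // -[[p q] [u v]] [pq uv] zs sz.
pose af w := f z + l * (w - z).
have caf : cont af.
  by apply: contD; [exact: cont_cst|apply: contZ; apply: contB; [exact: cont_id|exact: cont_cst]].
have -> : rint_of ((p, q), (u, v)) = rectint (fun z => f z - af z) p q u v.
  have fE : (fun z => af z + (f z - af z)) = f by apply/funext => w; rewrite addrC subrK.
  rewrite /rint_of -[in LHS]fE rectintD//; last exact: contB.
  rewrite (@rectint_prim (fun w => f z * w + l * (2^-1 * ((w - z) * (w - z)))))// ?add0r//.
  move=> w; rewrite /af; apply: hasdD; first exact: hasd_lin.
  apply: hasdZ; rewrite (_ : w - z = 2^-1 * ((w - z) * (1 - 0) + (w - z) * (1 - 0))); last by field.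
  by apply: hasdZ; apply: hasdM; apply: hasdB; [exact: hasd_id|exact: hasd_cst|exact: hasd_id|exact: hasd_cst].
apply: le_trans (@rectint_nm _ (e * rsize ((p, q), (u, v))) _ _ _ _ (contB cf caf) pq uv _) _.
  move=> x y hx hy; set w := x%:C%C + 'i%C * y%:C%C.
  have zz : nm (w - z) <= rsize ((p, q), (u, v)).
    rewrite (_ : w - z = (x - complex.Re z)%:C%C + 'i%C * (y - complex.Im z)%:C%C); last first.
      by rewrite [in LHS](ReImE z) /w !rmorphB /=; ring.
    apply: le_trans (nmD _ _) _; rewrite nmM nmi mul1r !nmR /rsize /=.
    move: zs hx hy => [/= /andP[? ?] /andP[? ?]] /andP[? ?] /andP[? ?].
    by apply: lerD; rewrite ler_norml; apply/andP; split; lra.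
  have := Hd (w - z) (le_lt_trans zz sz).
  rewrite [X in nm X <= _](_ : _ = f w - af w); last first.
    by rewrite [z + _]addrC subrK /af; ring.
  by move=> /le_trans; apply; rewrite ler_wpM2l// ltW.
by rewrite /rsize /=; lra.
Qed.

Lemma inrect_ball (K : R) z : nm z <= K -> inrect ((- K, K), (- K, K)) z.
Proof.
move=> zK; split => /=; rewrite -ler_norml; apply: le_trans zK; first exact: Re_le.
exact: Im_le.
Qed.

Lemma cont_bounded f K : cont f -> exists M, forall z, nm z <= K -> nm (f z) <= M.
Proof.
move=> cf; have [K0|K0] := ltP K 0.
  by exists 0 => z zK; have := nm_ge0 z; lra.
suff [M HM] : exists M, forall z, inrect ((- K, K), (- K, K)) z -> nm (f z) <= M.
  by exists M => z zK; apply: HM; exact: inrect_ball.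
apply: (@bisect (fun r => exists M, forall z, inrect r z -> nm (f z) <= M)).
- by split => /=; lra.
- move=> r _ Hs.
  have [M1 H1] := Hs _ (Or41 _ _ _ erefl); have [M2 H2] := Hs _ (Or42 _ _ _ erefl).
  have [M3 H3] := Hs _ (Or43 _ _ _ erefl); have [M4 H4] := Hs _ (Or44 _ _ _ erefl).
  exists (Num.max (Num.max M1 M2) (Num.max M3 M4)) => z zr.
  rewrite !le_max; have [t qt zt] := inrect_quarter zr.
  case: qt zt => -> zt; [rewrite H1|rewrite H2|rewrite H3|rewrite H4]; by rewrite ?orbT.
- move=> z _; have [d d0 Hd] := cf z 1 ltr01.
  exists d => // s vs zs ss; exists (nm (f z) + 1) => w ws.
  rewrite -[f w](subrK (f z)) addrC; apply: le_trans (nmD _ _) _; rewrite lerD2l.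
  rewrite -[w](subrK z) [_ + z]addrC; apply: Hd; apply: le_lt_trans ss.
  apply: le_trans (nm_ReIm _) _; rewrite !raddfB /rsize.
  move: ws zs => [/andP[? ?] /andP[? ?]] [/andP[? ?] /andP[? ?]].
  by apply: lerD; rewrite ler_norml; apply/andP; split; lra.
Qed.

Lemma cont_unif f K e : cont f -> 0 < e -> exists2 d : R, 0 < d &
  forall z w, nm z <= K -> nm (w - z) < d -> nm (f w - f z) <= e.
Proof.
move=> cf e0; have [K0|K0] := ltP K 0.
  by exists 1 => // z w zK; have := nm_ge0 z; lra.
suff [d d0 HM] : exists2 d : R, 0 < d & forall z, inrect ((- K, K), (- K, K)) z ->
    forall w, nm (w - z) < d -> nm (f w - f z) <= e.
  by exists d => // z w zK; apply: HM; exact: inrect_ball.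
apply: (@bisect (fun r => exists2 d : R, 0 < d & forall z, inrect r z ->
    forall w, nm (w - z) < d -> nm (f w - f z) <= e)).
- by split => /=; lra.
- move=> r _ Hs.
  have [M1 p1 H1] := Hs _ (Or41 _ _ _ erefl); have [M2 p2 H2] := Hs _ (Or42 _ _ _ erefl).
  have [M3 p3 H3] := Hs _ (Or43 _ _ _ erefl); have [M4 p4 H4] := Hs _ (Or44 _ _ _ erefl).
  exists (Num.min (Num.min M1 M2) (Num.min M3 M4)); first by rewrite !lt_min p1 p2 p3.
  move=> z zr w; rewrite !lt_min => /andP[/andP[w1 w2] /andP[w3 w4]].
  have [t qt zt] := inrect_quarter zr.
  by case: qt zt => -> zt; [exact: H1 zt _ _|exact: H2 zt _ _|exact: H3 zt _ _|exact: H4 zt _ _].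
- move=> z _; have [d d0 Hd] := cf z (e / 2) ltac:(by rewrite divr_gt0).
  exists (d / 2); first by rewrite divr_gt0.
  move=> s vs zs ss; exists (d / 2) => [|v vs' w wv]; first by rewrite divr_gt0.
  have vz : nm (v - z) < d / 2.
    apply: le_lt_trans ss; apply: le_trans (nm_ReIm _) _; rewrite !raddfB /rsize.
    move: vs' zs => [/andP[? ?] /andP[? ?]] [/andP[? ?] /andP[? ?]].
    by apply: lerD; rewrite ler_norml; apply/andP; split; lra.
  have wz : nm (w - z) < d.
    rewrite (_ : w - z = (w - v) + (v - z)); last by ring.
    by apply: le_lt_trans (nmD _ _) _; lra.
  have h1 := Hd _ wz; have h2 := Hd (v - z) ltac:(by apply: lt_trans vz _; lra).
  rewrite [z + _]addrC subrK in h1; rewrite [z + _]addrC subrK in h2.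
  rewrite (_ : f w - f v = (f w - f z) - (f v - f z)); last by ring.
  by apply: le_trans (nmB _ _) _; lra.
Qed.

End Goursat.

(** * Taylor coefficients *)

Section Cauchy.
Variable R : realType.
Local Notation C := R[i].
Local Notation nm := (@Normc.normc R).
Local Notation cexp := (@cexp R).
Implicit Types (f g phi : C -> C) (z w h l k : C) (a b x y t M r : R).

Lemma eps_nm0 z (K : R) : (forall y, 0 < y -> y <= 1 -> nm z <= K * y) -> z = 0.
Proof.
move=> H; apply: nm_eq0; apply/eqP; rewrite eq_le nm_ge0 andbT leNgt; apply/negP => z0.
have H1 := H 1 ltr01 (lexx _); rewrite mulr1 in H1.
have K0 : 0 < K by exact: lt_le_trans H1.
have := H (nm z / (2 * K)); rewrite divr_gt0 ?mulr_gt0// => /(_ isT).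
rewrite ler_pdivrMr ?mulr_gt0// mul1r => /(_ ltac:(lra)).
rewrite (_ : K * _ = nm z / 2); last by field; exact: lt0r_neq0.
lra.
Qed.

Definition circ phi x := vseg phi 0 (2 * pi) x.
Definition iperiodic phi := forall z, phi (z + 'i%C * (2 * pi)%:C%C) = phi z.

Lemma pi2_gt0 : 0 < 2 * pi :> R. Proof. by rewrite mulr_gt0// pi_gt0. Qed.
Lemma pi2_ge0 : 0 <= 2 * pi :> R. Proof. exact/ltW/pi2_gt0. Qed.
Lemma pi2C_neq0 : ((2 * pi)%:C%C : C) != 0.
Proof. by rewrite fmorph_eq0 gt_eqF// pi2_gt0. Qed.

Lemma circ_nm phi x M : cont phi -> (forall z, complex.Re z = x -> nm (phi z) <= M) ->
  nm (circ phi x) <= 2 * M * (2 * pi).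
Proof.
move=> cp H; rewrite -[X in _ * X]subr0; apply: cint_nm; [exact: cont_vert|exact: pi2_ge0|].
by move=> t _; apply: H; rewrite /vert /= !mul0r !mul1r subr0 addr0.
Qed.

Lemma circD f g x : cont f -> cont g -> circ (fun z => f z + g z) x = circ f x + circ g x.
Proof. by move=> cf cg; rewrite /circ /vseg cintD//; exact: cont_vert. Qed.
Lemma circB f g x : cont f -> cont g -> circ (fun z => f z - g z) x = circ f x - circ g x.
Proof. by move=> cf cg; rewrite /circ /vseg cintB//; exact: cont_vert. Qed.
Lemma circZ k f x : cont f -> circ (fun z => k * f z) x = k * circ f x.
Proof. by move=> cf; rewrite /circ /vseg cintZ//; exact: cont_vert. Qed.

Lemma cont_sum (I : Type) (s : seq I) (F : I -> C -> C) :
  (forall i, cont (F i)) -> cont (fun z => \sum_(i <- s) F i z).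
Proof.
move=> H; elim: s => [|i s IH].
  by under eq_fun do rewrite big_nil; exact: cont_cst.
by under eq_fun do rewrite big_cons; exact: contD.
Qed.

Lemma circ_sum (I : Type) (s : seq I) (F : I -> C -> C) x : (forall i, cont (F i)) ->
  circ (fun z => \sum_(i <- s) F i z) x = \sum_(i <- s) circ (F i) x.
Proof.
move=> H; elim: s => [|i s IH].
  under [X in circ X]eq_fun do rewrite big_nil.
  by rewrite big_nil /circ /vseg cint_cst ?pi2_ge0// mul0r.
under [X in circ X]eq_fun do rewrite big_cons.
by rewrite big_cons circD ?IH//; exact: cont_sum.
Qed.

(** The horizontal sides of the rectangle cancel by periodicity, and Goursat's theorem equates the
    vertical ones. *)
Lemma circ_const phi a b : cont phi -> iperiodic phi -> a <= b ->
  (forall z, a <= complex.Re z <= b -> exists l, hasd phi z l) -> circ phi a = circ phi b.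
Proof.
move=> cp per ab H; have := @goursat R phi a b 0 (2 * pi) cp ab pi2_ge0.
rewrite /rectint => /(_ _)/wrap[].
  by move=> x y xab _; apply: H; rewrite /= !mul0r !mul1r subr0 addr0.
rewrite (_ : hseg phi a b 0 = hseg phi a b (2 * pi)); last first.
  apply: cint_eq => t _; rewrite /horz per; congr phi.
  by rewrite mulr0 addr0.
rewrite subrr add0r => /eqP; rewrite mulf_eq0 => /orP[/eqP/(congr1 nm)|].
  by rewrite nmi nm0 => /eqP; rewrite oner_eq0.
by rewrite subr_eq0 => /eqP.
Qed.

Lemma circ_cont phi x e : cont phi -> 0 < e -> exists2 d : R, 0 < d &
  forall y, `|y - x| < d -> nm (circ phi y - circ phi x) <= e.
Proof.
move=> cp e0.
have e1 : 0 < e / (2 * (2 * pi)) by rewrite divr_gt0// mulr_gt0// pi2_gt0.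
have [d d0 H] := cont_unif (`|x| + 2 * pi) cp e1.
exists d => // y yd; rewrite /circ /vseg -cintB; try exact: cont_vert.
apply: le_trans (@cint_nm _ _ (e / (2 * (2 * pi))) _ _ _ _ _) _.
- by apply: contB; exact: cont_vert.
- exact: pi2_ge0.
- move=> t /andP[t0 t1]; apply: H.
    apply: le_trans (nmD _ _) _; rewrite nmM nmi mul1r !nmR lerD2l.
    by rewrite ger0_norm.
  rewrite /vert opprD addrACA subrr addr0 -rmorphB nmR//.
- rewrite subr0 le_eqVlt; apply/orP; left; apply/eqP.
  by have p0 := lt0r_neq0 pi2_gt0; move: (2 * pi) p0 => P p0; field.
Qed.

Lemma circ_const_except phi x0 a b : cont phi -> iperiodic phi ->
  (forall z, complex.Re z != x0 -> exists l, hasd phi z l) -> circ phi a = circ phi b.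
Proof.
move=> cp per H.
suff key x : circ phi x = circ phi x0 by rewrite !key.
apply/eqP; rewrite -subr_eq0; apply/eqP; apply: (@eps_nm0 _ 1) => e e0 _; rewrite mul1r.
have [d d0 Hd] := circ_cont x0 cp e0.
have [->|xx0] := eqVneq x x0; first by rewrite subrr nm0 ltW.
have [xl|xg] := ltP x x0.
  have := Hd (Num.max x (x0 - d / 2)).
  have xm : x <= Num.max x (x0 - d / 2) by rewrite le_max lexx.
  rewrite -(circ_const cp per xm); last first.
    move=> z /andP[_ zx]; apply: H; apply/eqP => zE; move: zx; rewrite zE le_max.
    by apply/negP; rewrite negb_or -!ltNge; apply/andP; split; lra.
  apply; rewrite ltr0_norm; last by rewrite subr_lt0 gt_max xl /=; lra.
  rewrite opprB ltrBlDr -ltrBlDl lt_max; apply/orP; right; lra.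
have := Hd (Num.min x (x0 + d / 2)).
have xm : Num.min x (x0 + d / 2) <= x by rewrite ge_min lexx.
rewrite (circ_const cp per xm); last first.
  move=> z /andP[zx _]; apply: H; apply/eqP => zE; move: zx; rewrite zE ge_min.
  apply/negP; rewrite negb_or -!ltNge; apply/andP; split; last by lra.
  by rewrite lt_neqAle xg eq_sym xx0.
apply; rewrite gtr0_norm.
  rewrite ltrBlDr gt_min; apply/orP; right; lra.
rewrite subr_gt0 lt_min; apply/andP; split; last by lra.
by rewrite lt_neqAle xg eq_sym xx0.
Qed.

Lemma hasd_expn (n : nat) z : hasd (fun z => cexp (- (n%:R * z))) z (- n%:R * cexp (- (n%:R * z))).
Proof.
have := hasd_cexp_comp (hasdN (hasd_lin n%:R z)).
by move/hasd_eq; apply; ring.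
Qed.

Lemma cont_expn (n : nat) : cont (fun z => cexp (- (n%:R * z))).
Proof. by move=> z; exact: hasd_cont (hasd_expn n z). Qed.

Lemma cexp_2pin (n : nat) z : cexp (z + n%:R * ('i%C * (2 * pi)%:C%C)) = cexp z.
Proof.
elim: n => [|n IH]; first by rewrite mul0r addr0.
by rewrite -natr1 mulrDl mul1r addrA cexp_2pi.
Qed.

Lemma iper_expn (n : nat) : iperiodic (fun z => cexp (- (n%:R * z))).
Proof. by move=> z; rewrite -[LHS](cexp_2pin n); congr cexp; ring. Qed.

Lemma circ_expn0 x (n : nat) : circ (fun z => cexp (- (n.+1%:R * z))) x = 0.
Proof.
rewrite /circ /vseg.
have k0 : - (n.+1%:R * 'i%C) != 0 :> C.
  rewrite oppr_eq0 mulf_neq0 ?pnatr_eq0//; apply/eqP => /(congr1 nm).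
  by rewrite nmi nm0 => /eqP; rewrite oner_eq0.
rewrite (@cint_FTC _ (fun z => (- (n.+1%:R * 'i%C))^-1 * cexp (- (n.+1%:R * vert x z))))//.
- rewrite -mulrBr (_ : vert x (2 * pi)%:C%C = vert x 0 + 'i%C * (2 * pi)%:C%C); last first.
    by rewrite /vert mulr0 addr0.
  by rewrite (iper_expn n.+1) subrr mulr0.
- exact: pi2_ge0.
- by apply: (@cont_comp _ (fun z => cexp (- (n.+1%:R * z)))); [exact: cont_expn|move=> z; exact: hasd_cont (hasd_vert _ _)].
- move=> z; apply: hasd_eq (hasdZ _ (hasd_comp (hasd_vert x z) (hasd_expn n.+1 _))) _.
  set E := cexp _; rewrite (_ : - n.+1%:R * E * 'i%C = - (n.+1%:R * 'i%C) * E); last by ring.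
  by rewrite mulKf.
Qed.

Lemma circ_one x : circ (fun=> 1) x = (2 * pi)%:C%C.
Proof. by rewrite /circ /vseg cint_cst ?pi2_ge0// mul1r subr0. Qed.

(* Circles are the images under [cexp] of vertical segments of length [2 * pi], so that Cauchy's theorem
   on circles is Goursat's theorem on rectangles. *)
Definition coef_int f (n : nat) z := f (cexp z) * cexp (- (n%:R * z)).
Definition coef f (n : nat) : C := ((2 * pi)%:C%C)^-1 * circ (coef_int f n) 0.

Lemma cont_cexp : cont cexp.
Proof. exact/holo_cont/holo_cexp. Qed.

Lemma cont_coef_int f n : cont f -> cont (coef_int f n).
Proof. by move=> cf; apply: contM (cont_expn n); apply: cont_comp cf _; exact: cont_cexp. Qed.

Lemma iper_cexp f : iperiodic (fun z => f (cexp z)).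
Proof. by move=> z; rewrite cexp_2pi. Qed.

Lemma iperM f g : iperiodic f -> iperiodic g -> iperiodic (fun z => f z * g z).
Proof. by move=> pf pg z; rewrite pf pg. Qed.

Lemma circ_coef f n x : holo f -> circ (coef_int f n) x = (2 * pi)%:C%C * coef f n.
Proof.
move=> ef; rewrite /coef mulVKf ?pi2C_neq0//.
apply: (@circ_const_except _ 0); first exact/cont_coef_int/holo_cont.
  by apply: iperM; [exact: iper_cexp|exact: iper_expn].
move=> z _; eexists; apply: hasdM (hasd_expn n z); apply: hasd_comp (hasd_cexp z) _.
exact: holo_hasd.
Qed.

Lemma nm_cexp_ln r z : 0 < r -> complex.Re z = ln r -> nm (cexp z) = r.
Proof. by move=> r0 zr; rewrite nm_cexp zr lnK. Qed.

Lemma nm_expn n z : nm (cexp (- (n%:R * z))) = (nm (cexp z) ^+ n)^-1.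
Proof. by rewrite cexpN mulr_natl cexpMn nmV nmX. Qed.

Lemma coef_bound f n r M : holo f -> 0 < r -> (forall z, nm z = r -> nm (f z) <= M) ->
  nm (coef f n) * r ^+ n <= 2 * M.
Proof.
move=> ef r0 H; have cf := holo_cont ef.
have rn : 0 < r ^+ n by rewrite exprn_gt0.
have := @circ_nm (coef_int f n) (ln r) (M / r ^+ n) (cont_coef_int n cf).
move=> /(_ _)/wrap[].
  move=> z zx; rewrite nmM nm_expn (nm_cexp_ln r0 zx) ler_wpM2r// ?invr_ge0 ?(ltW rn)//.
  by apply: H; rewrite (nm_cexp_ln r0 zx).
rewrite circ_coef// nmM nmRp ?pi2_ge0// mulrC ler_pM2r ?pi2_gt0// => h.
by rewrite -ler_pdivlMr// -mulrA.
Qed.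

Definition dquot f w z := if z == w then dd f w else (f z - f w) / (z - w).

Lemma hasd_near f g z l (d : R) : 0 < d -> (forall h, nm h < d -> f (z + h) = g (z + h)) ->
  hasd g z l -> hasd f z l.
Proof.
move=> d0 fg hg e e0; have [d1 d10 H] := hg e e0.
exists (Num.min d d1); first by rewrite lt_min d0.
move=> h; rewrite lt_min => /andP[h1 h2].
have := fg 0; rewrite nm0 addr0 => /(_ d0) ->.
by rewrite fg//; exact: H.
Qed.

Lemma hasd_dquot f w z : holo f -> z != w -> exists l, hasd (dquot f w) z l.
Proof.
move=> ef zw; have zw0 : z - w != 0 by rewrite subr_eq0.
eexists; apply: (@hasd_near _ (fun z => (f z - f w) * (z - w)^-1) _ _ (nm (z - w))).
- exact: nm_gt0.
- move=> h hd; rewrite /dquot; case: eqP => // zhw; exfalso.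
  have hE : h = - (z - w) by rewrite -zhw; ring.
  by move: hd; rewrite hE nmN ltxx.
- apply: hasdM; first exact: hasdB (holo_hasd z ef) (hasd_cst _ _).
  apply: (@hasd_comp _ (fun z => z^-1) (fun z => z - w)); last exact: hasd_inv.
  exact: hasdB (hasd_id _) (hasd_cst _ _).
Qed.

Lemma cont_dquot f w : holo f -> cont (dquot f w).
Proof.
move=> ef z; have [->|zw] := eqVneq z w; last first.
  by have [l hl] := hasd_dquot ef zw; exact: hasd_cont hl.
move=> e e0; have [d d0 H] := holo_hasd w ef e0.
exists d => // h /H hd; rewrite /dquot eqxx.
have [->|h0] := eqVneq h 0; first by rewrite addr0 eqxx subrr nm0 ltW.
rewrite ifF; last by apply/negbTE; rewrite -subr_eq0 addrC addrA addNr add0r.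
rewrite [w + h - w]addrAC subrr add0r.
rewrite (_ : _ / h - _ = (f (w + h) - f w - dd f w * h) / h); last by field.
by rewrite nmM nmV ler_pdivrMr// nm_gt0.
Qed.

Lemma dquotE f w z : (z - w) * dquot f w z = f z - f w.
Proof.
rewrite /dquot; case: eqP => [->|/eqP zw]; first by rewrite !subrr mul0r.
by rewrite mulrC divfK// subr_eq0.
Qed.

(** Cauchy's formula in disguise. The integral does not depend on the radius, and on the circle of
    radius [y] it is of order [y], because the difference quotient is bounded on the unit disc and
    [cexp z] has norm [y]. *)
Lemma circ_dquot f w x : holo f -> circ (fun z => cexp z * dquot f w (cexp z)) x = 0.
Proof.
move=> ef; set phi := fun z => _.
have cp : cont phi.
  by apply: contM cont_cexp _; apply: cont_comp cont_cexp; exact: cont_dquot.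
have per : iperiodic phi by apply: iperM (iper_cexp (fun z => z)) (iper_cexp _).
have [M HM] := cont_bounded 1 (cont_dquot w ef).
have H z : complex.Re z != ln (nm w) -> exists l, hasd phi z l.
  move=> zw; have ez : cexp z != w.
    by apply: contra zw => /eqP <-; rewrite nm_cexp expRK.
  have [l hl] := hasd_dquot ef ez.
  by eexists; apply: hasdM (hasd_cexp z) _; exact: hasd_comp (hasd_cexp z) hl.
apply: (@eps_nm0 _ (2 * M * (2 * pi))) => y y0 y1.
rewrite (circ_const_except x (ln y) cp per H).
rewrite mulrAC -[X in X * (2 * pi)]mulrA [M * y]mulrC.
apply: circ_nm => // z zy; rewrite nmM (nm_cexp_ln y0 zy) ler_wpM2l ?(ltW y0)//.
by apply: HM; rewrite (nm_cexp_ln y0 zy).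
Qed.

(** The finite geometric series of [1 / (z - w)], obtained by iterating [z * dquot f w z = (f z - f
    w) + w * dquot f w z]; no division by [z - w] occurs. *)
Lemma geom_expand f w z N : z != 0 ->
  z * dquot f w z = \sum_(i < N) w ^+ i * ((f z - f w) / z ^+ i) + w ^+ N * (z * dquot f w z / z ^+ N).
Proof.
move=> z0; elim: N => [|N IH]; first by rewrite big_ord0 add0r !expr0 divr1 mul1r.
rewrite big_ord_recr /= {1}IH -addrA; congr (_ + _).
rewrite -(dquotE f w) !exprS; field.
by rewrite z0 expf_neq0.
Qed.

(** [geom_expand] is integrated over the circle of radius [r]. The left-hand side vanishes by
    [circ_dquot], the terms of the sum yield the coefficients, where [f w] survives only for
    [i = 0], and the last term is the remainder. *)
Lemma taylor_raw f w N r M : holo f -> nm w < r -> (forall z, nm z = r -> nm (f z) <= M) ->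
  nm (f w - \sum_(i < N.+1) coef f i * w ^+ i) <= 2 * (M + nm (f w)) * r / (r - nm w) * (nm w / r) ^+ N.+1.
Proof.
move=> ef wr H; have r0 : 0 < r by exact: le_lt_trans (nm_ge0 _) wr.
have cf := holo_cont ef.
set psi := fun z => cexp z * dquot f w (cexp z) * cexp (- (N.+1%:R * z)).
have cq : cont (fun z => cexp z * dquot f w (cexp z)).
  by apply: contM cont_cexp _; apply: cont_comp cont_cexp; exact: cont_dquot.
have cpsi : cont psi by apply: contM cq (cont_expn _).
have expV (i : nat) z : (cexp z ^+ i)^-1 = cexp (- (i%:R * z)).
  by rewrite cexpN mulr_natl cexpMn.
have key : (2 * pi)%:C%C * (\sum_(i < N.+1) coef f i * w ^+ i - f w) + w ^+ N.+1 * circ psi (ln r) = 0.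
  rewrite -[RHS](circ_dquot w (ln r) ef).
  have -> : (fun z => cexp z * dquot f w (cexp z)) = fun z =>
    \sum_(i < N.+1) w ^+ i * (coef_int f i z - f w * cexp (- (i%:R * z))) + w ^+ N.+1 * psi z.
    apply/funext => z; rewrite (geom_expand _ _ N.+1 (cexp_neq0 z)); congr (_ + _ * _).
      by apply: eq_bigr => i _; rewrite expV mulrBl.
    by rewrite expV.
  have ci (i : nat) : cont (fun z => w ^+ i * (coef_int f i z - f w * cexp (- (i%:R * z)))).
    by apply: contZ; apply: contB; [exact: cont_coef_int|apply: contZ; exact: cont_expn].
  rewrite circD; [|exact: (@cont_sum _ _ (fun i z => w ^+ nat_of_ord i * (coef_int f i z - f w * cexp (- (i%:R * z)))))|exact: contZ].
  rewrite circZ//; congr (_ + _).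
  rewrite (circ_sum _ (F := fun (i : 'I_N.+1) z => w ^+ i * (coef_int f i z - f w * cexp (- (i%:R * z)))))//.
  rewrite [\sum_(i < N.+1) coef f i * _]big_ord_recl [\sum_(i < N.+1) circ _ _]big_ord_recl mulrBr mulrDr.
  have E0 : circ (fun z => cexp (- (0%:R * z))) (ln r) = (2 * pi)%:C%C.
    by rewrite -(circ_one (ln r)); congr circ; apply/funext => z; rewrite mul0r oppr0 cexp0.
  have ce (i : nat) : circ (fun z => w ^+ i * (coef_int f i z - f w * cexp (- (i%:R * z)))) (ln r) =
      w ^+ i * ((2 * pi)%:C%C * coef f i - f w * circ (fun z => cexp (- (i%:R * z))) (ln r)).
    rewrite circZ; last by apply: contB; [exact: cont_coef_int|apply: contZ; exact: cont_expn].
    by rewrite circB ?circZ ?circ_coef//; [exact: cont_expn|exact: cont_coef_int|apply: contZ; exact: cont_expn].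
  rewrite ce E0 /= expr0 mul1r mulr1.
  have -> : \sum_(i < N) circ (fun z => w ^+ bump 0 i * (coef_int f (bump 0 i) z - f w * cexp (- ((bump 0 i)%:R * z)))) (ln r)
     = (2 * pi)%:C%C * \sum_(i < N) coef f (bump 0 i) * w ^+ bump 0 i.
    rewrite mulr_sumr; apply: eq_bigr => i _; rewrite ce /bump circ_expn0 mulr0 subr0.
    by rewrite mulrCA [w ^+ _ * _]mulrC.
  by ring.
have -> : f w - \sum_(i < N.+1) coef f i * w ^+ i = ((2 * pi)%:C%C)^-1 * (w ^+ N.+1 * circ psi (ln r)).
  apply: (mulfI pi2C_neq0); rewrite mulVKf ?pi2C_neq0//.
  by apply/eqP; rewrite -subr_eq0 -oppr_eq0; apply/eqP; rewrite -[RHS]key; ring.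
have psiB : nm (circ psi (ln r)) <= 2 * (r * ((M + nm (f w)) / (r - nm w)) / r ^+ N.+1) * (2 * pi).
  apply: circ_nm => // z zr; have rz := nm_cexp_ln r0 zr.
  rewrite /psi nmM nmM nm_expn rz ler_wpM2r ?invr_ge0 ?exprn_ge0 ?(ltW r0)// ler_wpM2l ?(ltW r0)//.
  have rw : 0 < r - nm w by rewrite subr_gt0.
  have zw : r - nm w <= nm (cexp z - w) by rewrite -{1}rz nm_tri.
  rewrite ler_pdivlMr//; apply: le_trans (ler_wpM2l (nm_ge0 _) zw) _.
  rewrite -nmM mulrC dquotE; apply: le_trans (nmB _ _) _; rewrite lerD2r.
  exact: H.
rewrite nmM nmV nmRp ?pi2_ge0// nmM nmX mulrC ler_pdivrMr ?pi2_gt0//.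
apply: le_trans (ler_wpM2l (exprn_ge0 _ (nm_ge0 _)) psiB) _.
rewrite le_eqVlt; apply/orP; left; apply/eqP.
rewrite expr_div_n; move: (nm w) wr (2 * pi) (nm w ^+ _) => v vr P W.
have rn : r ^+ N.+1 != 0 by rewrite expf_neq0// gt_eqF.
by move: (r ^+ N.+1) rn => Q Q0; field; rewrite Q0 subr_eq0 gt_eqF.
Qed.

Lemma geom_half N : \sum_(i < N) (2^-1 : R) ^+ i <= 2.
Proof.
suff -> : \sum_(i < N) (2^-1 : R) ^+ i = 2 - 2 * 2^-1 ^+ N.
  by rewrite lerBlDr lerDl mulr_ge0// exprn_ge0// invr_ge0.
elim: N => [|N IH]; first by rewrite big_ord0 expr0; ring.
by rewrite big_ord_recr /= IH exprS; field.
Qed.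

(** A substitute for the maximum principle. The remainder in [taylor_raw] involves the unknown
    [nm (f w)] but tends to 0 with [N], while the partial sums are bounded by [4 M]: 2 from
    [coef_bound] and 2 from the geometric series of ratio at most 1/2. *)
Lemma cauchy_bound f w r M : holo f -> 0 < r -> nm w <= r / 2 ->
  (forall z, nm z = r -> nm (f z) <= M) -> nm (f w) <= 4 * M.
Proof.
move=> ef r0 wr H.
have M0 : 0 <= M by apply: le_trans (nm_ge0 _) (H r%:C%C _); rewrite nmRp ?ltW.
have wr' : nm w < r by lra.
have q1 : nm w / r <= 2^-1 by rewrite ler_pdivrMr// mulrC.
have q0 : 0 <= nm w / r by rewrite divr_ge0 ?nm_ge0 ?ltW.
apply/ler_addgt0Pr => e e0.
have K0 : 0 <= 4 * (M + nm (f w)) by rewrite mulr_ge0// addr_ge0// nm_ge0.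
have [N HN] := pow2_small K0 e0.
have := @taylor_raw f w N r M ef wr' H.
have sb : nm (\sum_(i < N.+1) coef f i * w ^+ i) <= 4 * M.
  apply: le_trans (nm_sum _ _ _) _.
  apply: (@le_trans _ _ (\sum_(i < N.+1) 2 * M * 2^-1 ^+ i)).
    apply: ler_sum => i _; have cb := coef_bound i ef r0 H.
    rewrite nmM nmX.
    have -> : nm w ^+ i = (nm w / r) ^+ i * r ^+ i by rewrite -exprMn divfK// gt_eqF.
    rewrite mulrCA mulrC ler_pM// ?mulr_ge0 ?nm_ge0 ?exprn_ge0 ?(ltW r0)//.
    by apply: lerXn2r; rewrite ?nnegrE ?invr_ge0.
  rewrite -mulr_sumr (_ : 4 * M = 2 * M * 2); last by ring.
  by rewrite ler_wpM2l ?geom_half// mulr_ge0.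
have -> : 2 * (M + nm (f w)) * r / (r - nm w) * (nm w / r) ^+ N.+1 =
   2 * (M + nm (f w)) * (r / (r - nm w)) * (nm w / r) ^+ N.+1 by rewrite !mulrA.
move=> h; have h2 : 2 * (M + nm (f w)) * (r / (r - nm w)) * (nm w / r) ^+ N.+1 <= 4 * (M + nm (f w)) / 2 ^+ N.
  apply: ler_pM.
  - have rw : 0 <= r - nm w by lra.
    by rewrite mulr_ge0 ?(divr_ge0 (ltW r0))// mulr_ge0 ?addr_ge0 ?nm_ge0.
  - exact: exprn_ge0.
  - rewrite (_ : 4 * _ = 2 * (M + nm (f w)) * 2); last by ring.
    rewrite ler_wpM2l ?mulr_ge0 ?addr_ge0 ?nm_ge0//.
    by rewrite ler_pdivrMr ?subr_gt0//; lra.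
  - rewrite -exprVn exprS; apply: le_trans (_ : 1 * (nm w / r) ^+ N <= _).
      by rewrite ler_wpM2r ?exprn_ge0//; lra.
    by rewrite mul1r; apply: lerXn2r; rewrite ?nnegrE ?invr_ge0.
rewrite -(subrK (\sum_(i < N.+1) coef f i * w ^+ i) (f w)) addrC.
apply: le_trans (nmD _ _) _; apply: lerD => //.
by apply: le_trans h (le_trans h2 (ltW HN)).
Qed.

(** [cauchy_bound] removes [f w] from the remainder: [2 (M + 4 M) r / (r - nm w)] is at most [20 M]
    on the half disc. *)
Lemma taylor f w N r M : holo f -> 0 < r -> nm w <= r / 2 ->
  (forall z, nm z = r -> nm (f z) <= M) ->
  nm (f w - \sum_(i < N) coef f i * w ^+ i) <= 20 * M * (nm w / r) ^+ N.
Proof.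
move=> ef r0 wr H; have h4 := cauchy_bound ef r0 wr H.
have M0 : 0 <= M by apply: le_trans (nm_ge0 _) (H r%:C%C _); rewrite nmRp ?ltW.
case: N => [|N]; first by rewrite big_ord0 subr0 expr0 mulr1; lra.
have wr' : nm w < r by lra.
apply: le_trans (taylor_raw N ef wr' H) _.
rewrite ler_wpM2r ?exprn_ge0 ?divr_ge0 ?nm_ge0 ?(ltW r0)//.
rewrite ler_pdivrMr ?subr_gt0//.
move: (nm (f w)) (nm w) h4 wr wr' (nm_ge0 (f w)) (nm_ge0 w) => p q; nra.
Qed.

End Cauchy.

(** * Derivatives, primitives, logarithms and uniqueness for entire functions *)

Section EntireTheory.
Variable R : realType.
Local Notation C := R[i].
Local Notation nm := (@Normc.normc R).
Local Notation cexp := (@cexp R).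
Implicit Types (f g q : C -> C) (z w h l k a b : C) (x y t M r : R).

Lemma nm_le0 z : nm z <= 0 -> z = 0.
Proof. by move=> h; apply: nm_eq0; apply/eqP; rewrite eq_le h nm_ge0. Qed.

Lemma coef0 f : holo f -> coef f 0 = f 0.
Proof.
move=> ef; have [M HM] := cont_bounded 1 (holo_cont ef).
have := @taylor R f 0 1 1 M ef ltr01; rewrite nm0 => /(_ ltac:(lra)) /(_ _)/wrap[].
  by move=> z z1; apply: HM; rewrite z1.
rewrite big_ord_recl big_ord0 addr0 expr0 mulr1 mul0r expr1 mulr0.
by move=> /nm_le0/eqP; rewrite subr_eq0 => /eqP ->.
Qed.

Lemma taylor2 f h r M : holo f -> 0 < r -> nm h <= r / 2 ->
  (forall z, nm z = r -> nm (f z) <= M) ->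
  nm (f h - f 0 - coef f 1 * h) <= 20 * M * (nm h / r) ^+ 2.
Proof.
move=> ef r0 hr H; have := taylor 2 ef r0 hr H.
by rewrite !big_ord_recl big_ord0 addr0 expr0 mulr1 coef0// expr1 opprD addrA.
Qed.

Lemma coef1 f : holo f -> coef f 1 = dd f 0.
Proof.
move=> ef; apply/esym/hasd_dd => e e0.
have [M HM] := cont_bounded 1 (holo_cont ef).
have M0 : 0 <= M by apply: le_trans (nm_ge0 _) (HM 0 _); rewrite nm0.
have q0 : 0 < 20 * M + 1 by rewrite ltr_wpDl// mulr_ge0.
exists (Num.min (1 / 2) (e / (20 * M + 1))).
  by rewrite lt_min !divr_gt0.
move=> h; rewrite lt_min add0r => /andP[h1 h2].
apply: le_trans (taylor2 ef ltr01 (ltW h1) _) _.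
  by move=> z z1; apply: HM; rewrite z1.
rewrite divr1 expr2 mulrA ler_wpM2r ?nm_ge0//.
move: h2; rewrite ltr_pdivlMr// => h2; have := nm_ge0 h; lra.
Qed.

Lemma dd_coef f a : holo f -> dd f a = coef (fun z => f (z + a)) 1.
Proof.
move=> ef; rewrite coef1; last exact: holo_shift.
by rewrite (dd_shift a ef) add0r.
Qed.

Lemma cauchy_est f a r M : holo f -> 0 < r -> (forall z, nm z = r -> nm (f (z + a)) <= M) ->
  nm (dd f a) * r <= 2 * M.
Proof.
move=> ef r0 H; rewrite dd_coef//.
have := @coef_bound R _ 1 r M (@holo_shift _ f a ef) r0 H.
by rewrite expr1.
Qed.

(** The constant is uniform in the base point [a], as differentiation under an integral sign
    requires. *)
Lemma quad_approx f K : holo f -> exists2 B : R, 0 <= B &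
  forall a h, nm a <= K -> nm h <= 1 -> nm (f (a + h) - f a - dd f a * h) <= B * nm h ^+ 2.
Proof.
move=> ef; have [M HM] := cont_bounded (K + 2) (holo_cont ef).
have [K0|K0] := ltP K 0.
  by exists 0 => // a h aK; have := nm_ge0 a; lra.
have M0 : 0 <= M by apply: le_trans (nm_ge0 _) (HM 0 _); rewrite nm0; lra.
exists (5 * M); first by rewrite mulr_ge0.
move=> a h aK h1.
have := @taylor2 (fun z => f (z + a)) h 2 M (@holo_shift _ f a ef) ltac:(lra) ltac:(lra).
move=> /(_ _)/wrap[].
  by move=> z z2; apply: HM; apply: le_trans (nmD _ _) _; rewrite z2; lra.
rewrite -dd_coef// add0r [h + a]addrC expr_div_n => hh; apply: le_trans hh _.
by rewrite le_eqVlt; apply/orP; left; apply/eqP; field.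
Qed.

Lemma coef1_nm f M : cont f -> (forall z, nm z = 1 -> nm (f z) <= M) -> nm (coef f 1) <= 2 * M.
Proof.
move=> cf H; rewrite /coef nmM nmV nmRp ?pi2_ge0//.
have := @circ_nm R (coef_int f 1) 0 M (cont_coef_int 1 cf).
move=> /(_ _)/wrap[].
  move=> z z0; rewrite nmM nm_expn nm_cexp z0 expR0 expr1n invr1 mulr1.
  by apply: H; rewrite nm_cexp z0 expR0.
by move=> hh; rewrite mulrC ler_pdivrMr ?pi2_gt0.
Qed.

Lemma coef_sub f g n : cont f -> cont g -> coef (fun z => f z - g z) n = coef f n - coef g n.
Proof.
move=> cf cg; rewrite /coef -mulrBr -circB; [|exact: cont_coef_int|exact: cont_coef_int].
by congr (_ * _); congr circ; apply/funext => z; rewrite /coef_int mulrBl.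
Qed.

Lemma coef_scale k f n : cont f -> coef (fun z => k * f z) n = k * coef f n.
Proof.
move=> cf; rewrite /coef [RHS]mulrCA -(circZ k _ (cont_coef_int n cf)).
by congr (_ * _); congr circ; apply/funext => z; rewrite /coef_int mulrA.
Qed.

Lemma cont_shift f a : cont f -> cont (fun z => f (z + a)).
Proof. by move=> cf; apply: cont_comp cf _; apply: contD; [exact: cont_id|exact: cont_cst]. Qed.

Lemma cont_dd f : holo f -> cont (dd f).
Proof.
move=> ef a e e0.
have e2 : 0 < e / 2 by rewrite divr_gt0.
have [d d0 H] := cont_unif (nm a + 1) (holo_cont ef) e2.
exists d => // h hd; rewrite !dd_coef// -coef_sub; try exact/cont_shift/holo_cont.
apply: le_trans (@coef1_nm _ (e / 2) _ _) _.
- by apply: contB; exact/cont_shift/holo_cont.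
- move=> z z1; apply: H; first by apply: le_trans (nmD _ _) _; rewrite z1 addrC.
  by rewrite (_ : _ - _ = h) //; ring.
- lra.
Qed.

(** By [dd_coef] the derivative at [a] is a fixed integral functional applied to the translate
    [f (z + a)], and [quad_approx] allows differentiation in [a] under that integral. *)
Lemma holo_dd f : holo f -> holo (dd f).
Proof.
move=> ef; apply: hasd_holo => a.
exists (coef (fun z => dd f (z + a)) 1) => e e0.
have [B B0 HB] := quad_approx (nm a + 1) ef.
exists (Num.min 1 (e / (2 * B + 1))).
  by rewrite lt_min ltr01 divr_gt0// ltr_wpDl// mulr_ge0.
move=> h; rewrite lt_min => /andP[h1 h2].
have c1 (b : C) := cont_shift b (holo_cont ef).
have c2 (b : C) := cont_shift b (cont_dd ef).
rewrite (dd_coef (a + h) ef) (dd_coef a ef) [coef (fun z => dd f _) 1 * h]mulrC -coef_scale// -coef_sub// -coef_sub; last 2 first.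
- exact: contB.
- exact: contZ.
apply: le_trans (@coef1_nm _ (B * nm h ^+ 2) _ _) _.
- by apply: contB; [exact: contB|exact: contZ].
- move=> z z1; rewrite [z + (a + h)]addrA [h * _]mulrC; apply: HB; last exact: ltW.
  by apply: le_trans (nmD _ _) _; rewrite z1 addrC.
- rewrite expr2 !mulrA ler_wpM2r ?nm_ge0//.
  move: h2; rewrite ltr_pdivlMr; last by rewrite ltr_wpDl// mulr_ge0.
  move=> h2; have := nm_ge0 h; lra.
Qed.

Lemma holo_line a h : holo (fun z : C => a + z * h ).
Proof. by apply: holoD; [exact: holo_cst|apply: holoM; [exact: holo_id|exact: holo_cst]]. Qed.

Lemma holo_seg f a h : holo f -> holo (fun z => f (a + z * h)).
Proof. by move=> ef; apply: holo_comp ef _; exact: holo_line. Qed.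

Lemma dd_seg f a h : holo f -> dd (fun z => f (a + z * h)) = fun z => dd f (a + z * h) * h.
Proof.
move=> ef; apply: dd_fun => z.
apply: (@hasd_comp _ f (fun z => a + z * h)); last exact: holo_hasd.
have := hasdD (hasd_cst a z) (hasdM (hasd_id z) (hasd_cst h z)).
by move/hasd_eq; apply; ring.
Qed.

Lemma FTC_holo f : holo f -> cint (dd f) 0 1 = f 1 - f 0.
Proof.
move=> ef; rewrite (@cint_FTC _ f)//; first exact: cont_dd.
by move=> z; exact: holo_hasd.
Qed.

Lemma mean_value f a h M : holo f -> (forall t, 0 <= t <= 1 -> nm (dd f (a + t%:C%C * h)) <= M) ->
  nm (f (a + h) - f a) <= 2 * M * nm h.
Proof.
move=> ef H; have es := @holo_seg f a h ef.
have := FTC_holo es; rewrite mul1r mul0r addr0 => <-.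
have := @cint_nm _ (dd (fun z => f (a + z * h))) (M * nm h) 0 1 (cont_dd es) ler01.
rewrite subr0 mulr1 mulrA; apply => t /H; rewrite dd_seg// nmM => ht.
by rewrite ler_wpM2r ?nm_ge0.
Qed.

Lemma dd0_const f : holo f -> (forall z, dd f z = 0) -> forall z, f z = f 0.
Proof.
move=> ef H z; have := @mean_value f 0 z 0 ef.
rewrite add0r mulr0 mul0r => /(_ _)/wrap[].
  by move=> t _; rewrite H nm0.
by move=> /nm_le0/eqP; rewrite subr_eq0 => /eqP.
Qed.

Lemma primitive_hasd q z : holo q -> hasd (fun z => z * cint (fun t : C => q (0 + t * z)) 0 1) z (q z).
Proof.
move=> eq e e0.
have cs z := holo_cont (@holo_seg q 0 z eq).
have cds z := holo_cont (@holo_seg (dd q) 0 z (holo_dd eq)).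
have ctz k f : cont f -> cont (fun t : C => t * k * f t).
  by move=> cf; apply: contM cf; apply: contM; [exact: cont_id|exact: cont_cst].
have [B B0 HB] := quad_approx (nm z) eq.
have [M HM] := cont_bounded (nm z) (cont_dd eq).
have M0 : 0 <= M by apply: le_trans (nm_ge0 _) (HM z (lexx _)).
set L := 2 * (M + (nm z + 1) * B) + 1.
have L0 : 0 < L by rewrite ltr_wpDl// mulr_ge0// addr_ge0// mulr_ge0// addr_ge0// nm_ge0.
(* [q z] is the integral over [0, 1] of the derivative of [t q(t z)]; this puts the whole difference
   quotient under a single integral. *)
have qE : q z = cint (fun t : C => q (0 + t * z) + t * z * dd q (0 + t * z)) 0 1.
  have et : holo (fun t : C => t * q (0 + t * z)) by apply: holoM; [exact: holo_id|exact: holo_seg].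
  have := FTC_holo et; rewrite mul0r subr0 !mul1r add0r => <-; congr cint.
  rewrite ddM; [|exact: holo_id|exact: holo_seg].
  by rewrite (dd_seg 0 z eq) dd_id; apply/funext => t; ring.
exists (Num.min 1 (e / L)); first by rewrite lt_min ltr01 divr_gt0.
move=> h; rewrite lt_min => /andP[h1 h2].
have k1 := contZ (z + h) (cs (z + h)).
have k2 := contZ z (cs z).
have k0 : cont (fun t : C => q (0 + t * z) + t * z * dd q (0 + t * z)).
  exact: contD (cs z) (ctz z _ (cds z)).
have k3 := contZ h k0.
rewrite [q z * h]mulrC {1}qE -!cintZ//.
rewrite -(cintB _ _ k1 k2) -(cintB _ _ (contB k1 k2) k3).
apply: le_trans (@cint_nm _ _ ((M + (nm z + 1) * B) * nm h ^+ 2) 0 1 _ ler01 _) _.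
- exact: contB (contB k1 k2) k3.
- move=> t /andP[t0 t1]; rewrite !add0r mulrDr.
  set tc := t%:C%C; have tn : nm tc <= 1 by rewrite nmRp.
  set E := q (tc * z + tc * h) - q (tc * z) - dd q (tc * z) * (tc * h).
  have zn : nm (tc * z) <= nm z by rewrite nmM ler_piMl ?nm_ge0.
  have hn : nm (tc * h) <= nm h by rewrite nmM ler_piMl ?nm_ge0.
  have En : nm E <= B * nm h ^+ 2.
    apply: le_trans (HB _ _ zn (le_trans hn (ltW h1))) _.
    by rewrite ler_wpM2l// lerXn2r// nnegrE nm_ge0.
  rewrite (_ : _ - _ = dd q (tc * z) * tc * h ^+ 2 + (z + h) * E); last by rewrite /E; ring.
  rewrite [leRHS]mulrDl; apply: le_trans (nmD _ _) _; apply: lerD.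
    rewrite nmM nmX nmM ler_wpM2r ?exprn_ge0 ?nm_ge0//.
    by apply: le_trans (HM _ zn); rewrite ler_piMr ?nm_ge0.
  rewrite nmM -mulrA ler_pM ?nm_ge0//.
  by apply: le_trans (nmD _ _) _; rewrite lerD2l ltW.
rewrite subr0 mulr1 expr2 !mulrA ler_wpM2r ?nm_ge0//.
move: h2; rewrite ltr_pdivlMr// /L => h2.
by have := nm_ge0 h; lra.
Qed.

Lemma primitive q : holo q -> exists2 Q : C -> C, holo Q & dd Q = q.
Proof.
move=> eq; exists (fun z => z * cint (fun t : C => q (0 + t * z)) 0 1).
  by apply: (@hasd_holo' _ _ q) => z; exact: primitive_hasd.
by apply: dd_fun => z; exact: primitive_hasd.
Qed.

Lemma holoV f : holo f -> (forall z, f z != 0) -> holo (fun z => (f z)^-1).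
Proof.
move=> ef f0; apply: hasd_holo => z; eexists.
exact: hasd_comp (holo_hasd z ef) (hasd_inv (f0 z)).
Qed.

Lemma holo_log f : holo f -> (forall z, f z != 0) ->
  exists2 H : C -> C, holo H & forall z, f z = cexp (H z).
Proof.
move=> ef f0.
have eq : holo (fun z => dd f z * (f z)^-1) by apply: holoM; [exact: holo_dd|exact: holoV].
have [Q eQ dQ] := primitive eq.
have [k Hk] := cexp_surj (f0 0).
exists (fun z => Q z - Q 0 + k).
  exact: holoD (holoB eQ (holo_cst (Q 0))) (holo_cst k).
have eE : holo (fun z => cexp (- 1 * Q z)) by apply: holo_cexp_comp; exact: holoZ.
have eG : holo (fun z => f z * cexp (- 1 * Q z)) by exact: holoM.
move=> z; have := dd0_const eG; rewrite ddM// dd_cexp; last exact: holoZ.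
rewrite ddZ// dQ => /(_ _)/wrap[].
  by move=> w /=; field.
move=> /(_ z); rewrite !mulN1r !cexpN -Hk => HG.
by rewrite cexpD cexpB; apply: (mulIf (invr_neq0 (cexp_neq0 (Q z)))); rewrite HG; field; rewrite !cexp_neq0.
Qed.

(** All Taylor coefficients at [a] vanish by Cauchy's inequality on a small circle, and the Taylor
    remainder at any point tends to 0. *)
Lemma identity_thm f a (d : R) : holo f -> 0 < d -> (forall h, nm h < d -> f (a + h) = 0) ->
  forall z, f z = 0.
Proof.
move=> ef d0 H; pose g z := f (z + a).
have eg : holo g by exact: holo_shift.
have cg n : coef g n = 0.
  have d2 : 0 < d / 2 by rewrite divr_gt0.
  have := @coef_bound _ g n (d / 2) 0 eg d2.
  rewrite mulr0 => /(_ _)/wrap[].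
    by move=> z zd; rewrite /g addrC H ?nm0// zd; lra.
  by rewrite pmulr_lle0 ?exprn_gt0// => /nm_le0.
move=> z; rewrite -(subrK a z) -/(g (z - a)); set w := z - a.
apply: nm_le0; apply/ler_addgt0Pr => e e0; rewrite add0r.
have r0 : 0 < 2 * (nm w + 1) by rewrite mulr_gt0// ltr_wpDl// nm_ge0.
have [M HM] := cont_bounded (2 * (nm w + 1)) (holo_cont eg).
have M0 : 0 <= M by apply: le_trans (nm_ge0 _) (HM 0 _); rewrite nm0 ltW.
have [N HN] := pow2_small (mulr_ge0 (ler0n _ 20) M0) e0.
have wr : nm w <= 2 * (nm w + 1) / 2 by have := nm_ge0 w; lra.
have := taylor N eg r0 wr (fun z hz => HM z (eq_ind_r (fun t => t <= _) (lexx _) hz)).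
rewrite big1; last by move=> i _; rewrite cg mul0r.
rewrite subr0 => h; apply: le_trans h (le_trans _ (ltW HN)).
rewrite ler_wpM2l ?mulr_ge0// -exprVn lerXn2r ?nnegrE ?invr_ge0 ?divr_ge0 ?nm_ge0 ?(ltW r0)//.
by rewrite ler_pdivrMr//; lra.
Qed.

(** The quotient [f / g] cannot be formed at the zeros of [g]. With [k] its value at a point [a]
    where [g] does not vanish, [Z = f - k g] satisfies [Z' g = Z g'] and [Z a = 0]; a Gronwall
    iteration gives [Z = 0] near [a], and the identity theorem does the rest. *)
Lemma wronskian0 f g : holo f -> holo g -> (exists z, g z != 0) ->
  (forall z, dd f z * g z = f z * dd g z) -> exists k, forall z, f z = k * g z.
Proof.
move=> ef eg [a ga] W.
set k := f a / g a; exists k => z.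
pose Z z := f z - k * g z.
have eZ : holo Z by exact: holoB ef (holoZ k eg).
have ZW w : dd Z w * g w = Z w * dd g w.
  by rewrite /Z ddB ?ddZ//=; last exact: holoZ; rewrite mulrBl W; ring.
have Za : Z a = 0 by rewrite /Z /k divfK// subrr.
have n0 := nm_gt0 ga.
have [d d0 Hd] := holo_cont eg a (divr_gt0 n0 (ltr0n _ 2)).
have [M1 H1] := cont_bounded (nm a + 1) (cont_dd eg).
have M0 : 0 <= M1 by apply: le_trans (nm_ge0 _) (H1 a _); rewrite lerDl.
have [S HS] := cont_bounded (nm a + 1) (holo_cont eZ).
have S0 : 0 <= S by apply: le_trans (nm_ge0 _) (HS a _); rewrite lerDl.
(* The radius is such that [g] keeps half its size and one application of [mean_value] halves the
   bound on [Z]: its factor is [4 M1 nm h / nm (g a)], at most 1/2. *)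
set rho := Num.min (Num.min 1 (d / 2)) (nm (g a) / (8 * (M1 + 1))).
have rho0 : 0 < rho by rewrite !lt_min ltr01 !divr_gt0// mulr_gt0// ltr_wpDl.
have r1 : rho <= 1 by rewrite !ge_min lexx.
have r2 : rho < d.
  by apply: (@le_lt_trans _ _ (d / 2)); [rewrite !ge_min lexx orbT|lra].
have r3 : rho * (8 * (M1 + 1)) <= nm (g a).
  by rewrite -ler_pdivlMr ?mulr_gt0 ?ltr_wpDl// !ge_min lexx orbT.
have gl h : nm h <= rho -> nm (g a) / 2 <= nm (g (a + h)).
  move=> hr; have := Hd h (le_lt_trans hr r2); have := nm_tri (g a) (g a - g (a + h)).
  rewrite [nm (g a - g _)]nmBC (_ : g a - (g a - g (a + h)) = g (a + h)); last by ring.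
  lra.
have step n h : nm h <= rho -> nm (Z (a + h)) <= S / 2 ^+ n.
  elim: n h => [|n IH] h hr.
    rewrite expr0 divr1; apply: HS; apply: le_trans (nmD _ _) _; rewrite lerD2l.
    exact: le_trans hr r1.
  have Sn : 0 <= S / 2 ^+ n by rewrite divr_ge0// exprn_ge0.
  have := @mean_value Z a h (S / 2 ^+ n * M1 / (nm (g a) / 2)) eZ.
  rewrite Za subr0 => /(_ _)/wrap[].
    move=> t /andP[t0 t1].
    have thr : nm (t%:C%C * h) <= rho.
      by apply: le_trans hr; rewrite nmM nmRp// ler_piMl ?nm_ge0.
    rewrite ler_pdivlMr ?divr_gt0//.
    apply: le_trans (ler_wpM2l (nm_ge0 _) (gl _ thr)) _.
    rewrite -nmM ZW nmM ler_pM ?nm_ge0 ?IH//.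
    apply: H1; apply: le_trans (nmD _ _) _; rewrite lerD2l.
    exact: le_trans thr r1.
  move=> /le_trans; apply.
  have -> : S / 2 ^+ n.+1 = S / 2 ^+ n / 2 by rewrite exprS invfM; ring.
  rewrite (_ : 2 * _ * nm h = S / 2 ^+ n * (4 * M1 * nm h / nm (g a))); last by field; rewrite gt_eqF//= expf_neq0.
  rewrite ler_wpM2l// ler_pdivrMr//.
  have : M1 * nm h <= M1 * rho by rewrite ler_wpM2l.
  have := nm_ge0 h; lra.
have := @identity_thm Z a rho eZ rho0.
move=> /(_ _)/wrap[].
  move=> h hr; apply: nm_le0; apply/ler_addgt0Pr => e e0; rewrite add0r.
  have [n Hn] := pow2_small S0 e0.
  exact: le_trans (step n h (ltW hr)) (ltW Hn).
by move=> /(_ z)/eqP; rewrite subr_eq0 => /eqP.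
Qed.

End EntireTheory.

Opaque coef circ cint.

(** * Functions of exponential type zero *)

Section ExponentialTypeZero.
Variable R : realType.
Local Notation C := R[i].
Local Notation nm := (@Normc.normc R).
Local Notation cexp := (@cexp R).
Implicit Types (f g q : C -> C) (z w h l k a b : C) (x y t M r e : R).

(* These play the role of the small functions of Nevanlinna theory. *)
Definition small f := holo f /\ forall e, 0 < e -> exists M, forall z, nm (f z) <= M * expR (e * nm z).

Lemma small_holo f : small f -> holo f. Proof. by case. Qed.

Lemma small_bound f e : small f -> 0 < e -> exists2 M, 0 <= M &
  forall z, nm (f z) <= M * expR (e * nm z).
Proof.
move=> [_ H] e0; have [M HM] := H _ e0; exists M => //.
have := le_trans (nm_ge0 _) (HM 0).
by rewrite nm0 mulr0 expR0 mulr1.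
Qed.

Lemma expR_ge1 x : 0 <= x -> 1 <= expR x.
Proof. by move=> x0; rewrite -expR0 ler_expR. Qed.

Lemma small_cst k : small (fun=> k).
Proof.
split=> [|e e0]; first exact: holo_cst.
exists (nm k) => z; rewrite ler_peMr ?nm_ge0// expR_ge1// mulr_ge0 ?nm_ge0 ?(ltW e0)//.
Qed.

Lemma smallD f g : small f -> small g -> small (fun z => f z + g z).
Proof.
move=> [hf Hf] [hg Hg]; split=> [|e e0]; first exact: holoD.
have [M HM] := Hf _ e0; have [M' HM'] := Hg _ e0; exists (M + M') => z.
by rewrite mulrDl; apply: le_trans (nmD _ _) _; apply: lerD.
Qed.

Lemma smallM f g : small f -> small g -> small (fun z => f z * g z).
Proof.
move=> sf sg; split=> [|e e0]; first by apply: holoM; exact: small_holo.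
have e2 : 0 < e / 2 by rewrite divr_gt0.
have [M M0 HM] := small_bound sf e2; have [M' M'0 HM'] := small_bound sg e2.
exists (M * M') => z; rewrite nmM.
rewrite (_ : e * nm z = e / 2 * nm z + e / 2 * nm z); last by field.
by rewrite expRD mulrACA ler_pM ?nm_ge0.
Qed.

Lemma smallZ k f : small f -> small (fun z => k * f z).
Proof. by move=> sf; apply: smallM => //; exact: small_cst. Qed.

Lemma smallB f g : small f -> small g -> small (fun z => f z - g z).
Proof.
move=> sf sg; have := smallD sf (smallZ (-1) sg).
by under eq_fun do rewrite mulN1r.
Qed.

Lemma small_shift f a : small f -> small (fun z => f (z + a)).
Proof.
move=> sf; split=> [|e e0]; first exact/holo_shift/small_holo.
have [M M0 HM] := small_bound sf e0.
exists (M * expR (e * nm a)) => z; apply: le_trans (HM _) _.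
rewrite -mulrA -expRD ler_wpM2l// ler_expR -mulrDr ler_wpM2l ?(ltW e0)//.
by rewrite addrC; exact: nmD.
Qed.

Lemma small_dd f : small f -> small (dd f).
Proof.
move=> sf; split=> [|e e0]; first exact/holo_dd/small_holo.
have [M M0 HM] := small_bound sf e0.
exists (2 * (M * expR e)) => z.
have := @cauchy_est R f z 1 (M * expR e * expR (e * nm z)) (small_holo sf) ltr01.
rewrite mulr1 !mulrA; apply => w w1; apply: le_trans (HM _) _.
rewrite -mulrA ler_wpM2l// -expRD ler_expR.
have : e * nm (w + z) <= e * (1 + nm z) by rewrite ler_wpM2l ?(ltW e0)// -w1 nmD.
by rewrite mulrDr mulr1.
Qed.

Lemma small_id : small (fun z => z).
Proof.
split=> [|e e0]; first exact: holo_id.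
exists e^-1 => z; rewrite mulrC ler_pdivlMr// mulrC.
by apply: le_trans (expR_ge1Dx _); rewrite lerDr.
Qed.

Lemma small_poly (p : {poly C}) : small (horner p).
Proof.
elim/poly_ind: p => [|p k IH].
  by rewrite (_ : horner 0 = fun=> 0); [exact: small_cst|apply/funext => w; rewrite horner0].
rewrite (_ : horner _ = fun w => p.[w] * w + k); last by apply/funext => w; rewrite !hornerE.
by apply: smallD (small_cst k); apply: smallM small_id.
Qed.

Lemma small_sum (I : finType) (P : pred I) (F : I -> C -> C) :
  (forall i, P i -> small (F i)) -> small (fun z => \sum_(i | P i) F i z).
Proof.
move=> H; suff K (s : seq I) : small (fun z => \sum_(i <- s | P i) F i z) by exact: K.
elim: s => [|i s IH].
  by under eq_fun do rewrite big_nil; exact: small_cst.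
rewrite (_ : (fun z => _) = if P i then fun z => F i z + \sum_(j <- s | P j) F j z
   else fun z => \sum_(j <- s | P j) F j z); last first.
  by apply/funext => z; rewrite big_cons; case: ifP.
by case: ifP => // Pi; apply: smallD => //; exact: H.
Qed.

Lemma holo_sum (I : finType) (P : pred I) (F : I -> C -> C) :
  (forall i, P i -> holo (F i)) -> holo (fun z => \sum_(i | P i) F i z) /\
   dd (fun z => \sum_(i | P i) F i z) = fun z => \sum_(i | P i) dd (F i) z.
Proof.
move=> H; suff K (s : seq I) z : hasd (fun z => \sum_(i <- s | P i) F i z) z (\sum_(i <- s | P i) dd (F i) z).
  by split=> [z|]; [eexists; exact: K|apply: dd_fun => z; exact: K].
elim: s => [|i s IH].
  by under eq_fun do rewrite big_nil; rewrite big_nil; exact: hasd_cst.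
rewrite (_ : (fun z => _) = if P i then fun z => F i z + \sum_(j <- s | P j) F j z
   else fun z => \sum_(j <- s | P j) F j z); last first.
  by apply/funext => z'; rewrite big_cons; case: ifP.
rewrite big_cons; case: ifP => // Pi.
exact: hasdD (holo_hasd z (H _ Pi)) IH.
Qed.

Lemma holo_prod (I : finType) (F : I -> C -> C) :
  (forall i, holo (F i)) -> holo (fun z => \prod_i F i z).
Proof.
move=> H; suff K (s : seq I) : holo (fun z => \prod_(i <- s) F i z) by exact: K.
elim: s => [|i s IH].
  by under eq_fun do rewrite big_nil; exact: holo_cst.
by under eq_fun do rewrite big_cons; exact: holoM.
Qed.

(** * Roots of unity as sampling points on circles *)

Lemma cos_lt1 x : 0 < x < 2 * pi -> cos x != 1.
Proof.
move=> /andP[x0 x2].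
suff key y : 0 < y -> y <= pi -> cos y != 1.
  have [xp|xp] := leP x pi; first exact: key.
  rewrite -cosN -(cosD2pi (- x)); apply: key; rewrite -mulr_natr; lra.
move=> y0 yp; rewrite -cos0 lt_eqF// ltr_cos// in_itv/= ?lexx ?pi_ge0// ?yp ?(ltW y0)//.
Qed.

Lemma cexp_i x : cexp ('i%C * x%:C%C) = (cos x +i* sin x)%C.
Proof.
rewrite cexpE (_ : complex.Re _ = 0); last by rewrite /=; ring.
rewrite (_ : complex.Im _ = x); last by rewrite /=; ring.
by rewrite expR0 !mul1r.
Qed.

Definition zeta (N : nat) : C := cexp ('i%C * (2 * pi / N%:R)%:C%C).

Lemma nm_zeta N : nm (zeta N) = 1.
Proof. by rewrite nm_cexp /= !mul0r mulr0 subr0 expR0. Qed.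

Lemma zetaX N (j : nat) : zeta N ^+ j = cexp ('i%C * (2 * pi / N%:R * j%:R)%:C%C).
Proof. rewrite /zeta -cexpMn; congr cexp.
by rewrite -[LHS]mulr_natr -(rmorph_nat (@real_complex R)) -mulrA -rmorphM. Qed.

Lemma zetaN N : (0 < N)%N -> zeta N ^+ N = 1.
Proof.
move=> N0; rewrite zetaX divfK ?pnatr_eq0 -?lt0n//.
by rewrite -[LHS]mul1r -{1}cexp0 -cexpD add0r -[X in cexp X]add0r cexp_2pi cexp0.
Qed.

Lemma zetaX_neq1 N j : (0 < j < N)%N -> zeta N ^+ j != 1.
Proof.
move=> /andP[j0 jN]; apply/eqP => /(congr1 (@complex.Re R)).
rewrite zetaX cexp_i; apply/eqP/cos_lt1.
have N0 : 0 < N%:R :> R by rewrite ltr0n (leq_ltn_trans _ jN).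
have jr : 0 < j%:R :> R by rewrite ltr0n.
rewrite mulr_gt0 ?divr_gt0 ?pi2_gt0//= -mulrA gtr_pMr ?pi2_gt0// mulrC ltr_pdivrMr// mul1r.
by rewrite ltr_nat.
Qed.

Lemma zeta_sum N (j : nat) : (0 < N)%N ->
  \sum_(k < N) (zeta N ^+ k) ^+ j = if (N %| j)%N then N%:R else 0.
Proof.
move=> N0; under eq_bigr => k _ do rewrite -exprM mulnC exprM.
have -> : zeta N ^+ j = zeta N ^+ (j %% N)%N.
  by rewrite {1}(divn_eq j N) exprD mulnC exprM zetaN// expr1n mul1r.
case: ifP => [/eqP ->|/negbT nd].
  by rewrite expr0; under eq_bigr do rewrite expr1n; rewrite sumr_const card_ord.
have jm : (0 < j %% N < N)%N by rewrite lt0n nd ltn_mod.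
have z1 : zeta N ^+ (j %% N) - 1 != 0 by rewrite subr_eq0 zetaX_neq1.
apply: (mulfI z1); rewrite mulr0 -subrX1 -exprM mulnC exprM zetaN// expr1n subrr//.
Qed.

(** Discrete Fourier inversion: the sum over [N] equidistant points against the [m]-th power
    isolates the coefficient whose index is [- m] modulo [N]. *)
Lemma zeta_poly N (p : nat -> C) z1 (m j0 : nat) : (m < N)%N -> (j0 < N)%N -> (N %| j0 + m)%N ->
  \sum_(k < N) (\sum_(j < N) p j * (z1 * zeta N ^+ k) ^+ j) * (zeta N ^+ k) ^+ m = N%:R * (p j0 * z1 ^+ j0).
Proof.
move=> mN jN dv; have N0 : (0 < N)%N by exact: leq_ltn_trans mN.
under eq_bigr do rewrite mulr_suml.
rewrite exchange_big /=.
transitivity (\sum_(j < N) p j * z1 ^+ j * (if (N %| j + m)%N then N%:R else 0)).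
  apply: eq_bigr => j _; rewrite -zeta_sum// mulr_sumr; apply: eq_bigr => k _.
  by rewrite exprMn exprD; ring.
rewrite (bigD1 (Ordinal jN)) //= dv big1 ?addr0; first by rewrite mulrC.
move=> j jj; rewrite ifF ?mulr0//; apply/negbTE; apply: contra jj => dj.
apply/eqP/val_inj => /=.
have : j = j0 %[mod N].
  by apply/eqP; rewrite -(eqn_modDr m); move: dj dv; rewrite /dvdn => /eqP -> /eqP ->.
by rewrite !modn_small.
Qed.

Lemma conj_unit z : nm z = 1 -> z^*%C = z^-1.
Proof.
move=> z1; have z0 : z != 0 by apply/eqP => h; move: z1; rewrite h nm0 => /eqP; rewrite eq_sym oner_eq0.
apply: (mulfI z0); rewrite divff//.
case: z z1 {z0} => p q /= pq; apply/eqP; rewrite eq_complex /= mulrN opprK mulrN [q * p]mulrC addNr eqxx andbT.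
have := congr1 (fun t => t ^+ 2) pq; rewrite /Normc.normc /= sqr_sqrtr ?addr_ge0 ?sqr_ge0// expr1n.
by rewrite !expr2 => ->.
Qed.

Lemma pow2_small_ge (S e0 : R) (n0 : nat) : 0 <= S -> 0 < e0 -> exists N1, forall N, (N1 <= N)%N -> S / 2 ^+ N < e0.
Proof.
move=> S0 e00; have [N1 H1] := pow2_small S0 e00; exists N1 => N NN.
apply: le_lt_trans H1; rewrite ler_wpM2l// lef_pV2 ?posrE ?exprn_gt0//.
by rewrite ler_weXn2l// ler1n.
Qed.

Lemma conj_sum (I : Type) (s : seq I) (F : I -> C) : (\sum_(i <- s) F i)^*%C = \sum_(i <- s) (F i)^*%C.
Proof. exact: raddf_sum. Qed.

(* The mean over a circle is taken over [N] equidistant points, with [N] arbitrarily large and a starting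
   point [z1] of our choice: this leaves room to avoid the zeros of a denominator. *)
Lemma borel_caratheodory (H : C -> C) r (n : nat) (A : R) : holo H -> 0 < r -> (0 < n)%N ->
  (forall N0 : nat, exists N z1, [/\ (N0 <= N)%N, nm z1 = r &
     \sum_(k < N) Num.max 0 (complex.Re (H (z1 * zeta N ^+ k))) <= A * N%:R]) ->
  nm (coef H n) * r ^+ n <= 4 * A + 2 * nm (H 0).
Proof.
move=> hH r0 n0 HA.
have r20 : 0 < 2 * r by rewrite mulr_gt0.
have [M HM] := cont_bounded (2 * r) (holo_cont hH).
have M0 : 0 <= M by apply: le_trans (nm_ge0 _) (HM 0 _); rewrite nm0 ltW.
have HM' z : nm z = 2 * r -> nm (H z) <= M by move=> zr; apply: HM; rewrite zr.
apply/ler_addgt0Pr => e e0.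
have [N1 HN1] := @pow2_small_ge (80 * M + 2 * M * 2 ^+ n) e 0 ltac:(by rewrite addr_ge0// mulr_ge0// ?mulr_ge0// exprn_ge0) e0.
have [N [z1 [NN z1r HS]]] := HA (maxn N1 n.+1).
have nN : (n < N)%N by apply: leq_trans NN; exact: leq_maxr.
have N0 : (0 < N)%N by exact: leq_ltn_trans nN.
have Nr : 0 < N%:R :> R by rewrite ltr0n.
have He := HN1 N (leq_trans (leq_maxl _ _) NN).
set w := fun k : nat => z1 * zeta N ^+ k.
have nzk (k : nat) : nm (zeta N ^+ k) = 1 by rewrite nmX nm_zeta expr1n.
have wr (k : nat) : nm (w k) = r by rewrite nmM nzk mulr1.
set d := 20 * M / 2 ^+ N.
have tay (k : nat) : nm (H (w k) - \sum_(j < N) coef H j * w k ^+ j) <= d.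
  have := taylor N hH r20 _ HM'; move=> /(_ (w k)); rewrite wr => /(_ ltac:(lra)).
  by rewrite (_ : r / (2 * r) = 2^-1) ?exprVn//; field; rewrite gt_eqF.
have fourier (m j0 : nat) : (m < N)%N -> (j0 < N)%N -> (N %| j0 + m)%N ->
    nm (\sum_(k < N) H (w k) * (zeta N ^+ k) ^+ m - N%:R * (coef H j0 * z1 ^+ j0)) <= N%:R * d.
  move=> mN jN dv; rewrite -(zeta_poly (coef H) z1 mN jN dv) -sumrB.
  apply: le_trans (nm_sum _ _ _) _; rewrite mulr_natl -[X in _ *+ X]card_ord -sumr_const.
  apply: ler_sum => k _; rewrite -mulrBl nmM nmX nzk expr1n mulr1; exact: tay.
have mN : (N - n < N)%N by rewrite ltn_subrL n0 N0.
(* [S1] isolates the coefficient of index [n], [S2] that of index [N - n], and [S3] the constant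
   one. The second is negligible, since the coefficients are controlled on the radius [2 r]. The
   conjugate of [S2] carries the same powers of [zeta] as [S1], so their sum involves real parts
   only. *)
have F1 := fourier (N - n)%N n mN nN ltac:(by rewrite subnKC// ltnW).
have F2 := fourier n (N - n)%N nN mN ltac:(by rewrite subnK// ltnW).
have F3 := fourier 0%N 0%N N0 N0 (dvdn0 _).
rewrite coef0// expr0 mulr1 in F3.
set S1 := \sum_(k < N) H (w k) * (zeta N ^+ k) ^+ (N - n) in F1.
set S2 := \sum_(k < N) H (w k) * (zeta N ^+ k) ^+ n in F2.
set S3 := \sum_(k < N) H (w k) * (zeta N ^+ k) ^+ 0 in F3.
have cS2 : S2^*%C = \sum_(k < N) (H (w k))^*%C * (zeta N ^+ k) ^+ (N - n).
  rewrite conj_sum; apply: eq_bigr => k _; rewrite rmorphM /=; congr (_ * _).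
  rewrite rmorphXn /= conj_unit// exprVn; apply/esym/(mulIf (_ : (zeta N ^+ k) ^+ n != 0)).
    by rewrite !expf_neq0// cexp_neq0.
  rewrite mulVf; last by rewrite !expf_neq0// cexp_neq0.
  by rewrite -exprD subnK ?(ltnW nN)// -exprM mulnC exprM zetaN// expr1n.
have nconj z : nm z^*%C = nm z by case: z => p q; rewrite /Normc.normc /= sqrrN.
have c2 : nm (coef H (N - n)) * r ^+ (N - n) <= 2 * M * 2 ^+ n / 2 ^+ N.
  have := coef_bound (N - n) hH r20 HM'.
  rewrite exprMn => h; rewrite ler_pdivlMr ?exprn_gt0//.
  have -> : 2 ^+ N = 2 ^+ (N - n) * 2 ^+ n :> R by rewrite -exprD subnK// ltnW.
  rewrite !mulrA ler_pM2r ?exprn_gt0//; apply: le_trans h; rewrite -mulrA.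
  by rewrite [X in nm _ * X]mulrC lexx.
have F2' : nm S2 <= N%:R * d + N%:R * (2 * M * 2 ^+ n / 2 ^+ N).
  rewrite -[S2](subrK (N%:R * (coef H (N - n) * z1 ^+ (N - n)))).
  apply: le_trans (nmD _ _) _; apply: lerD => //.
  by rewrite nmM nmn nmM nmX z1r ler_wpM2l.
set Sr := \sum_(k < N) `|complex.Re (H (w k))|.
have Sr12 : nm (S1 + S2^*%C) <= 2 * Sr.
  rewrite cS2 -big_split /=; apply: le_trans (nm_sum _ _ _) _; rewrite mulr_sumr.
  apply: ler_sum => k _; rewrite -mulrDl nmM nmX nzk expr1n mulr1.
  rewrite (_ : H (w k) + _ = (2 * complex.Re (H (w k)))%:C%C) ?nmR ?normrM ?(ger0_norm (ler0n _ 2))//.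
  by case: (H (w k)) => p q; apply/eqP; rewrite eq_complex /= addrN eqxx andbT; apply/eqP; ring.
have ReS3 : complex.Re S3 = \sum_(k < N) complex.Re (H (w k)).
  by rewrite raddf_sum; apply: eq_bigr => k _; rewrite expr0 mulr1.
(* Pointwise [|x| = 2 max(0, x) - x], and the mean of the real parts is nearly that of [H 0]: an
   upper bound on the positive part is enough. *)
have SrE : Sr = 2 * (\sum_(k < N) Num.max 0 (complex.Re (H (w k)))) - complex.Re S3.
  rewrite ReS3 mulr_sumr -sumrB; apply: eq_bigr => k _.
  have [h|h] := leP 0 (complex.Re (H (w k))).
    by rewrite ger0_norm//; ring.
  by rewrite ltr0_norm//; ring.
have F3' : - complex.Re S3 <= N%:R * nm (H 0) + N%:R * d.
  have : `|complex.Re S3| <= N%:R * d + N%:R * nm (H 0).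
    apply: le_trans (Re_le _) _; rewrite -[S3](subrK (N%:R * H 0)).
    by apply: le_trans (nmD _ _) _; rewrite [nm (N%:R * _)]nmM nmn lerD2r.
  by rewrite ler_norml => /andP[? ?]; lra.
have fin : nm (N%:R * (coef H n * z1 ^+ n)) <= N%:R * d + 2 * Sr + nm S2.
  rewrite (_ : N%:R * _ = - (S1 - N%:R * (coef H n * z1 ^+ n)) + (S1 + S2^*%C) - S2^*%C); last by ring.
  apply: le_trans (nmB _ _) _; rewrite nconj lerD2r; apply: le_trans (nmD _ _) _.
  by rewrite nmN; apply: lerD.
rewrite nmM nmn nmM nmX z1r in fin.
rewrite -(ler_pM2l Nr).
have eN : N%:R * (4 * d + 2 * M * 2 ^+ n / 2 ^+ N) <= N%:R * e.
  rewrite ler_pM2l// (_ : _ + _ = (80 * M + 2 * M * 2 ^+ n) / 2 ^+ N); first exact: ltW.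
  by rewrite /d; ring.
move: fin F2' F3' HS; rewrite SrE -/w.
move: (\sum_(k < N) _) => V.
lra.
Qed.

Lemma coef_eq0_const (H : C -> C) : holo H -> (forall n, coef H n.+1 = 0) -> forall w, H w = H 0.
Proof.
move=> hH cH w; apply/eqP; rewrite -subr_eq0; apply/eqP/nm_le0/ler_addgt0Pr => e e0; rewrite add0r.
have r0 : 0 < 2 * (nm w + 1) by rewrite mulr_gt0// ltr_wpDl// nm_ge0.
have [M HM] := cont_bounded (2 * (nm w + 1)) (holo_cont hH).
have M0 : 0 <= M by apply: le_trans (nm_ge0 _) (HM 0 _); rewrite nm0 ltW.
have [N HN] := pow2_small (mulr_ge0 (ler0n _ 20) M0) e0.
have wr : nm w <= 2 * (nm w + 1) / 2 by have := nm_ge0 w; lra.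
have := taylor N.+1 hH r0 wr (fun z hz => HM z (eq_ind_r (fun t => t <= _) (lexx _) hz)).
rewrite big_ord_recl big1; last by move=> i _; rewrite lift0 cH mul0r.
rewrite expr0 mulr1 addr0 coef0// => h; apply: le_trans h (le_trans _ (ltW HN)).
rewrite ler_wpM2l ?mulr_ge0// -exprVn exprS.
have q0 : 0 <= nm w / (2 * (nm w + 1)) by rewrite divr_ge0 ?nm_ge0 ?(ltW r0).
have q1 : nm w / (2 * (nm w + 1)) <= 2^-1 by rewrite ler_pdivrMr//; lra.
rewrite -[leRHS]mul1r ler_pM ?exprn_ge0//; first by lra.
by rewrite lerXn2r ?nnegrE ?invr_ge0.
Qed.

(* A discrete Jensen inequality: on the circle, the product of the [a (z1 * zeta N ^+ k)] is at least
   [a 0 ^+ N / 4] in norm for some [z1], which bounds the mean of [- ln (nm a)] from above. *)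
Lemma small_quotient0 (a b H : C -> C) : small a -> small b -> holo H -> a 0 != 0 ->
  (forall z, a z * cexp (H z) = b z) -> forall z, H z = H 0.
Proof.
move=> sa sb hH a0 ab; apply: coef_eq0_const => // n.
have n0 := nm_gt0 a0.
have bound e : 0 < e -> exists K, forall r, 0 < r -> nm (coef H n.+1) * r ^+ n.+1 <= 8 * e * r + K.
  move=> e0; have [M1 M10 H1] := small_bound sa e0; have [M2 M20 H2] := small_bound sb e0.
  set c := ln (M1 + M2 + 1).
  have Mp : 0 < M1 + M2 + 1 by rewrite ltr_wpDl// addr_ge0.
  have c0 : 0 <= c by rewrite ln_ge0// lerDr addr_ge0.
  exists (4 * (2 * c - ln (nm (a 0)) + ln 4) + 2 * nm (H 0)) => r r0.
  set m := c + e * r.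
  have m0 : 0 <= m by rewrite addr_ge0// mulr_ge0// ltW.
  have em : expR m = (M1 + M2 + 1) * expR (e * r) by rewrite expRD lnK.
  have am z : nm z = r -> nm (a z) <= expR m.
    by move=> zr; apply: le_trans (H1 z) _; rewrite zr em ler_wpM2r ?expR_ge0//; lra.
  have bm z : nm z = r -> nm (b z) <= expR m.
    by move=> zr; apply: le_trans (H2 z) _; rewrite zr em ler_wpM2r ?expR_ge0//; lra.
  suff : nm (coef H n.+1) * r ^+ n.+1 <= 4 * (2 * m - ln (nm (a 0)) + ln 4) + 2 * nm (H 0).
    by move/le_trans; apply; rewrite /m; lra.
  apply: borel_caratheodory => // N0; exists N0.+1.
  set N := N0.+1.
  pose G z := \prod_(k < N) a (z * zeta N ^+ k).
  have hG : holo G.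
    apply: holo_prod => k; apply: (@holo_comp _ a (fun z => z * zeta N ^+ k)); first exact: small_holo.
    by apply: holoM; [exact: holo_id|exact: holo_cst].
  have G0 : nm (G 0) = nm (a 0) ^+ N.
    rewrite /G nm_prod; under eq_bigr do rewrite mul0r.
    by rewrite prodr_const card_ord.
  (* Otherwise Cauchy's inequality for the constant coefficient would give
     [nm (G 0) <= nm (G 0) / 2]. *)
  have [z1 z1r Hz1] : exists2 z1, nm z1 = r & nm (G 0) / 4 < nm (G z1).
    apply: contrapT => Hn; have := @coef_bound R G 0 r (nm (G 0) / 4) hG r0.
    rewrite expr0 mulr1 coef0// => /(_ _)/wrap[].
      by move=> z zr; rewrite leNgt; apply/negP => h; apply: Hn; exists z.
    have : 0 < nm (G 0) by rewrite G0 exprn_gt0.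
    lra.
  exists z1; split => //.
  have wr (k : nat) : nm (z1 * zeta N ^+ k) = r by rewrite nmM nmX nm_zeta expr1n mulr1.
  have Gz1 : nm (G z1) = \prod_(k < N) nm (a (z1 * zeta N ^+ k)) by rewrite nm_prod.
  have ak (k : 'I_N) : 0 < nm (a (z1 * zeta N ^+ k)).
    rewrite lt_neqAle nm_ge0 andbT eq_sym; apply/eqP => h.
    move: Hz1; rewrite Gz1 (bigD1 k)//= h mul0r; apply/negP; rewrite -leNgt.
    by rewrite divr_ge0// nm_ge0.
  (* Each summand dominates both 0 and the real part of [H], because [ln (nm (a w)) <= m] and
     [0 <= m]. *)
  apply: (@le_trans _ _ (\sum_(k < N) (2 * m - ln (nm (a (z1 * zeta N ^+ k)))))).
    apply: ler_sum => k _; set w := z1 * _.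
    have l1 : ln (nm (a w)) <= m by rewrite -[m]expRK ler_ln ?posrE ?expR_gt0 ?am ?wr//; exact: ak.
    have l2 : complex.Re (H w) <= m - ln (nm (a w)).
      rewrite lerBrDr -ler_expR expRD lnK ?posrE ?ak// -nm_cexp mulrC -nmM ab.
      by apply: bm; rewrite wr.
    by rewrite ge_max; apply/andP; split; lra.
  rewrite sumrB sumr_const card_ord -[_ *+ N]mulr_natr.
  have lnprod : \sum_(k < N) ln (nm (a (z1 * zeta N ^+ k))) = ln (nm (G z1)).
    rewrite Gz1; suff K (t : seq 'I_N) : 0 < \prod_(k <- t) nm (a (z1 * zeta N ^+ k)) /\
       \sum_(k <- t) ln (nm (a (z1 * zeta N ^+ k))) = ln (\prod_(k <- t) nm (a (z1 * zeta N ^+ k))).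
      by have [] := K (index_enum 'I_N).
    elim: t => [|k t [IH1 IH2]]; first by rewrite !big_nil ln1.
    by rewrite !big_cons IH2 lnM ?posrE ?mulr_gt0.
  rewrite lnprod.
  have : ln (nm (G 0) / 4) <= ln (nm (G z1)).
    rewrite ler_ln ?posrE ?(ltW Hz1)// ?G0 ?divr_gt0 ?exprn_gt0//.
    by apply: lt_trans Hz1; rewrite G0 divr_gt0 ?exprn_gt0.
  rewrite ln_div ?posrE ?G0 ?exprn_gt0// lnXn// -[_ *+ N]mulr_natr.
  have N1 : 1 <= N%:R :> R by rewrite ler1n.
  have l4 : 0 <= ln 4 :> R by rewrite ln_ge0// ler1n.
  move: (ln 4) (ln (nm (a 0))) (ln (nm (G z1))) (N%:R) N1 l4 => p u v NR; nra.
apply: contrapT => /eqP cn; have c0 := nm_gt0 cn.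
(* With this [e] the bound has slope [c / 2] in [r], whereas its left-hand side is at least [c r]
   for [r >= 1]. *)
have [K HK] := bound (nm (coef H n.+1) / 16) (divr_gt0 c0 (ltr0n _ 16)).
set c := nm (coef H n.+1) in c0 HK.
pose r := 2 * (`|K| + 1) / c + 1.
have r1 : 1 <= r by rewrite lerDr divr_ge0 ?(ltW c0)// mulr_ge0// addr_ge0.
have := HK r (lt_le_trans ltr01 r1).
have : c * r <= c * r ^+ n.+1 by rewrite ler_wpM2l ?(ltW c0)// exprS ler_peMr ?exprn_ege1// (le_trans ler01).
have : c * r = 2 * (`|K| + 1) + c by rewrite /r; field; exact: lt0r_neq0.
have := ler_norm K.
rewrite (_ : 8 * (c / 16) * r = c * r / 2); last by field.
lra.
Qed.

Lemma small_quotient (a b H : C -> C) : small a -> small b -> holo H -> (exists z, a z != 0) ->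
  (forall z, a z * cexp (H z) = b z) -> forall z, H z = H 0.
Proof.
move=> sa sb hH [u au] ab z.
have := @small_quotient0 (fun z => a (z + u)) (fun z => b (z + u)) (fun z => H (z + u))
  (small_shift u sa) (small_shift u sb) (holo_shift u hH).
rewrite add0r => /(_ au (fun z => ab (z + u))) K.
have E (x : C) : H x = H u by rewrite -(K (x - u)) subrK.
by rewrite (E z) (E 0).
Qed.

(** Only the centre is new: there the derivative is the second Taylor coefficient, and the third
    order remainder divided by [h] gives the estimate. *)
Lemma holo_dquot f w : holo f -> holo (dquot f w).
Proof.
move=> hf z; have [->|zw] := eqVneq z w; last exact: hasd_dquot.
pose g u := f (u + w).
have hg : holo g by exact: holo_shift.
exists (coef g 2) => e e0.
have [M HM] := cont_bounded 1 (holo_cont hg).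
have M0 : 0 <= M by apply: le_trans (nm_ge0 _) (HM 0 _); rewrite nm0.
have q0 : 0 < 20 * M + 1 by rewrite ltr_wpDl// mulr_ge0.
exists (Num.min (1 / 2) (e / (20 * M + 1))).
  by rewrite lt_min !divr_gt0.
move=> h; rewrite lt_min => /andP[h1 h2].
have [->|h0] := eqVneq h 0; first by rewrite addr0 mulr0 !subrr nm0 mulr0.
have dE : dquot f w (w + h) = (g h - g 0) / h.
  rewrite /dquot ifF; last by apply/negbTE; rewrite -subr_eq0 addrC addrA addNr add0r.
  by rewrite /g add0r [h + w]addrC [w + h - w]addrAC subrr add0r.
have dw : dquot f w w = coef g 1 by rewrite /dquot eqxx dd_coef.
have := taylor 3 hg ltr01 (ltW h1) (fun z hz => HM z (eq_ind_r (fun t => t <= _) (lexx _) hz)).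
rewrite !big_ord_recl big_ord0 addr0 !lift0 /= expr0 mulr1 coef0// expr1 divr1.
rewrite dE dw (_ : (g h - g 0) / h - coef g 1 - coef g 2 * h =
   (g h - (g 0 + (coef g 1 * h + coef g 2 * h ^+ 2))) / h); last by field.
rewrite nmM nmV ler_pdivrMr ?nm_gt0// => /le_trans; apply.
rewrite (_ : 20 * M * nm h ^+ 3 = 20 * M * nm h * nm h * nm h); last by ring.
rewrite ler_wpM2r ?nm_ge0// ler_wpM2r ?nm_ge0//.
move: h2; rewrite ltr_pdivlMr// => h2; have := nm_ge0 h; lra.
Qed.

Lemma divide_zero f w : holo f -> f w = 0 -> exists2 g, holo g & forall z, f z = (z - w) * g z.
Proof.
move=> hf fw; exists (dquot f w); first exact: holo_dquot.
by move=> z; rewrite dquotE fw subr0.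
Qed.

Lemma divide_zeros f (p : nat -> C) (n : nat) : holo f -> injective p -> (forall k : nat, f (p k) = 0) ->
  exists2 g, holo g & forall z, f z = (\prod_(k < n) (z - p k)) * g z.
Proof.
move=> hf pi fp; elim: n => [|n [g hg gE]].
  by exists f => // z; rewrite big_ord0 mul1r.
have gp : g (p n) = 0.
  have := fp n; rewrite gE => /eqP; rewrite mulf_eq0 => /orP[|/eqP //].
  rewrite prodf_seq_eq0 => /hasP[/= k _]; rewrite subr_eq0 => /eqP/pi kn.
  by have := ltn_ord k; rewrite -kn ltnn.
have [g' hg' g'E] := divide_zero hg gp.
by exists g' => // z; rewrite big_ord_recr /= gE g'E mulrA.
Qed.

(** A zero count. [F = f - f 0] vanishes at [k c] for [k < n]; put [K = n nm c]. On the circle of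
    radius [6 K], [F] is at most [M (5/4)^n] and the product of the linear factors at least
    [(5 K)^n]. On the disc of radius [K] that product is at most [(2 K)^n], so [F] is bounded there
    by [4 M (2 (5/4) / 5)^n = 4 M / 2^n]. *)
Lemma small_periodic f c : small f -> c != 0 -> (forall z, f (z + c) = f z) -> forall z, f z = f 0.
Proof.
move=> sf c0 per.
pose F z := f z - f 0.
have sF : small F by apply: smallB => //; exact: small_cst.
have nc := nm_gt0 c0.
have Fz (k : nat) : F (k%:R * c) = 0.
  apply/eqP; rewrite subr_eq0; apply/eqP; elim: k => [|k IH]; first by rewrite mul0r.
  by rewrite -natr1 mulrDl mul1r per.
pose p (k : nat) := k%:R * c.
have pinj : injective p by move=> i j /(mulIf c0)/eqP; rewrite eqr_nat => /eqP.
move=> z; apply/eqP; rewrite -subr_eq0 -/(F z); apply/eqP/nm_le0/ler_addgt0Pr => e e0; rewrite add0r.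
have l54 : 0 < ln (5 / 4) :> R by rewrite ln_gt0// ltr_pdivlMr// mul1r ltr_nat.
have e1 : 0 < ln (5 / 4) / (6 * nm c) by rewrite divr_gt0// mulr_gt0.
have [M M0 HM] := small_bound sF e1.
have [N1 HN1] := @pow2_small_ge (4 * M) e 0 (mulr_ge0 (ler0n _ 4) M0) e0.
set n := maxn (maxn N1 1) (Num.bound (nm z / nm c)).
have n1 : (1 <= n)%N by rewrite !leq_max leqnn orbT.
apply: le_trans (ltW (HN1 n _)); last by rewrite !leq_max leqnn.
have nz : nm z <= n%:R * nm c.
  have := archi_boundP (divr_ge0 (nm_ge0 z) (ltW nc)); rewrite ltr_pdivrMr// => /ltW/le_trans; apply.
  by rewrite ler_wpM2r ?(ltW nc)// ler_nat leq_max leqnn orbT.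
have n0 : 0 < n%:R :> R by rewrite ltr0n.
have K0 : 0 < n%:R * nm c by rewrite mulr_gt0.
set K := n%:R * nm c in nz K0.
have pk (k : 'I_n) : nm (p k) <= K.
  by rewrite nmM nmn ler_wpM2r ?(ltW nc)// ler_nat ltnW.
have [g hg gE] := divide_zeros n (small_holo sF) pinj Fz.
have gb w : nm w = 6 * K -> nm (g w) <= M * (5 / 4) ^+ n / (5 * K) ^+ n.
  move=> wK; rewrite ler_pdivlMr ?exprn_gt0 ?mulr_gt0//.
  have := HM w; rewrite wK (_ : ln _ / _ * _ = ln (5 / 4) *+ n); last first.
    by rewrite -mulr_natr /K; field; exact: lt0r_neq0.
  rewrite -lnXn ?divr_gt0// lnK ?posrE ?exprn_gt0 ?divr_gt0// gE nmM nm_prod; apply: le_trans.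
  have -> : (5 * K) ^+ n = \prod_(k < n) (5 * K) by rewrite prodr_const card_ord.
  rewrite mulrC ler_wpM2r ?nm_ge0//; apply: ler_prod => k _; rewrite mulr_ge0 ?(ltW K0)//=.
  by have := nm_tri w (p k); have := pk k; rewrite wK; lra.
have := @cauchy_bound R g z (6 * K) _ hg ltac:(by rewrite mulr_gt0) ltac:(lra) gb.
move=> gz; rewrite gE nmM nm_prod.
apply: (@le_trans _ _ ((2 * K) ^+ n * (4 * (M * (5 / 4) ^+ n / (5 * K) ^+ n)))).
  have -> : (2 * K) ^+ n = \prod_(k < n) (2 * K) by rewrite prodr_const card_ord.
  apply: ler_pM => //; [by apply: prodr_ge0 => k _; exact: nm_ge0|exact: nm_ge0|].
  apply: ler_prod => k _; rewrite nm_ge0/=.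
  by apply: le_trans (nmB _ _) _; have := pk k; lra.
rewrite le_eqVlt; apply/orP; left; apply/eqP.
rewrite -exprVn [(5 * K) ^+ n]exprMn [(2 * K) ^+ n]exprMn.
have -> : (2^-1 : R) ^+ n = 2 ^+ n * (5 / 4) ^+ n / 5 ^+ n.
  by rewrite -exprMn -expr_div_n; congr (_ ^+ _); field.
have Kn : K ^+ n != 0 by rewrite expf_neq0// gt_eqF.
have F5 : (5 : R) ^+ n != 0 by rewrite expf_neq0.
move: (K ^+ n) (5 ^+ n) ((5 / 4) ^+ n) (2 ^+ n) Kn F5 => x y u v x0 y0.
by field; rewrite x0 y0.
Qed.

Definition isconst (f : C -> C) := forall z, f z = f 0.

(** A theorem of Borel type, by induction on the number of exponentials. Those congruent to [H i0]
    modulo constants merge into one term [X = al e^{H i0}]. If [al] vanishes, the relation is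
    shorter. Otherwise eliminate between the relation and its derivative: [b' X - b X'] plus terms
    over [S2] is 0. Division by [e^{H i0}] leaves a shorter relation with non-constant exponents, so
    [b' X = b X'] by induction. If [b] were not identically zero, [X] would be a multiple of [b],
    and [small_quotient] would make [H i0] constant. *)
Lemma small_borel (I : finType) (n : nat) : forall (A : {set I}) (a H : I -> C -> C) (b : C -> C),
  (#|A| <= n)%N -> (forall i, i \in A -> small (a i)) -> (forall i, i \in A -> small (H i)) ->
  (forall i, i \in A -> ~ isconst (H i)) -> small b ->
  (forall z, \sum_(i in A) a i z * cexp (H i z) = b z) -> forall z, b z = 0.
Proof.
elim: n => [|n IH] A a H b cA sa sH nH sb E.
  move=> z; rewrite -E big_pred0// => i; move: cA; rewrite leqn0 cards_eq0 => /eqP ->.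
  by rewrite inE.
have [A0|[i0 i0A]] := set_0Vmem A.
  by move=> z; rewrite -E A0 big_pred0// => i; rewrite inE.
pose S1 := [set i in A | `[< isconst (fun z => H i z - H i0 z) >]].
pose S2 := A :\: S1.
have i0S1 : i0 \in S1 by rewrite inE i0A; apply/asboolP => z; rewrite !subrr.
have S1A i : i \in S1 -> i \in A by rewrite inE => /andP[].
have S2A i : i \in S2 -> i \in A by rewrite inE => /andP[].
have cS2 : (#|S2| <= n)%N.
  rewrite -ltnS; apply: leq_trans cA; apply: proper_card; apply/properP; split.
    exact: subsetDl.
  by exists i0 => //; rewrite inE i0S1.
pose al z := \sum_(i in S1) cexp (H i 0 - H i0 0) * a i z.
have sal : small al by apply: small_sum => i /S1A/sa; exact: smallZ.
have split z : \sum_(i in A) a i z * cexp (H i z) = al z * cexp (H i0 z) + \sum_(i in S2) a i z * cexp (H i z).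
  rewrite (big_setID S1) /= (finset.setIidPr _); last by apply/fintype.subsetP => i; exact: S1A.
  congr (_ + _); rewrite mulr_suml; apply: eq_bigr => i.
  rewrite inE => /andP[_ /asboolP/(_ z) Hc]; rewrite mulrAC mulrC; congr (_ * _).
  by rewrite -cexpD -Hc subrK.
clearbody al.
have [al0|[u alu]] : (forall z, al z = 0) \/ exists z, al z != 0.
  have [h|h] := pselect (exists z, al z != 0); first by right.
  by left=> z; apply/eqP/negPn/negP => hz; apply: h; exists z.
  apply: (IH S2 a H b cS2) => // i.
  - by move=> /S2A/sa.
  - by move=> /S2A/sH.
  - by move=> /S2A/nH.
  - by rewrite -E split al0 mul0r add0r.
apply: contrapT => /existsNP[v /eqP bv].
have hH i : i \in A -> holo (H i) by move=> /sH/small_holo.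
have ha i : i \in A -> holo (a i) by move=> /sa/small_holo.
have hb := small_holo sb; have hal := small_holo sal.
pose T i z := a i z * cexp (H i z).
have hT i : i \in A -> holo (T i).
  by move=> iA; apply: holoM; [exact: ha|apply: holo_cexp_comp; exact: hH].
have dT i : i \in A -> dd (T i) = fun z => (dd (a i) z + a i z * dd (H i) z) * cexp (H i z).
  move=> iA; rewrite /T ddM; [|exact: ha|apply: holo_cexp_comp; exact: hH].
  rewrite (dd_cexp (hH i iA)).
  apply/funext => z.
  move: (dd _ _) (cexp _) (a i z) (dd _ _) => p q u0 v0.
  by ring.
pose X z := al z * cexp (H i0 z).
have hX : holo X by apply: holoM => //; apply: holo_cexp_comp; exact: hH.
have dX : dd X = fun z => (dd al z + al z * dd (H i0) z) * cexp (H i0 z).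
  rewrite /X (ddM hal (holo_cexp_comp (hH i0 i0A))).
  rewrite (dd_cexp (hH i0 i0A)).
  apply/funext => z.
  move: (dd _ _) (cexp _) (al z) (dd _ _) => p q u0 v0.
  by ring.
have [hS dS] := @holo_sum _ (mem S2) T (fun i iS => hT i (S2A i iS)).
have Eb z : dd b z = dd X z + \sum_(i in S2) (dd (a i) z + a i z * dd (H i) z) * cexp (H i z).
  have -> : b = fun z => X z + \sum_(i in S2) T i z by apply/funext => y; rewrite -E split.
  rewrite (ddD hX hS) dS; congr (_ + _); apply: eq_bigr => i iS; rewrite dT//; exact: S2A.
(* The coefficient of [cexp (H i z)] in [b' T_i - b T_i']. *)
pose d i z := dd b z * a i z - b z * (dd (a i) z + a i z * dd (H i) z).
have key z : dd b z * al z - b z * (dd al z + al z * dd (H i0) z) = 0.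
  apply/eqP; rewrite -oppr_eq0; apply/eqP.
  apply: (IH S2 d (fun i z => H i z - H i0 z)
     (fun z => - (dd b z * al z - b z * (dd al z + al z * dd (H i0) z))) cS2) z.
  - move=> i /S2A iA; apply: smallB; first by apply: smallM; [exact: small_dd|exact: sa].
    apply: smallM => //; apply: smallD; first exact/small_dd/sa.
    by apply: smallM; [exact: sa|exact/small_dd/sH].
  - by move=> i /S2A iA; apply: smallB; exact: sH.
  - move=> i; rewrite !inE => /andP[h iA] hc; move: h; rewrite iA /=.
    by move/asboolPn; apply.
  - rewrite (_ : (fun z => - _) = fun z => b z * (dd al z + al z * dd (H i0) z) - dd b z * al z); last first.
      by apply/funext => z; rewrite opprB.
    apply: smallB; last by apply: smallM => //; exact: small_dd.
    apply: smallM => //; apply: smallD; first exact: small_dd.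
    by apply: smallM => //; exact/small_dd/sH.
  - move=> z; apply: (mulIf (cexp_neq0 (H i0 z))).
    have EB : b z = X z + \sum_(i in S2) T i z by rewrite -E split.
    have DB := Eb z; rewrite dX in DB.
    rewrite mulr_suml.
    have -> : \sum_(i in S2) d i z * cexp (H i z - H i0 z) * cexp (H i0 z) =
       dd b z * \sum_(i in S2) T i z - b z * \sum_(i in S2) (dd (a i) z + a i z * dd (H i) z) * cexp (H i z).
      rewrite !mulr_sumr -sumrB; apply: eq_bigr => i _.
      rewrite -mulrA -cexpD subrK /d /T.
      by move: (dd b z) (b z) (dd (a i) z) (dd (H i) z) (a i z) (cexp _) => x1 x2 x3 x4 x5 x6; ring.
    have -> : \sum_(i in S2) T i z = b z - X z by rewrite EB addrC addKr.
    have -> : \sum_(i in S2) (dd (a i) z + a i z * dd (H i) z) * cexp (H i z)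
       = dd b z - (dd al z + al z * dd (H i0) z) * cexp (H i0 z) by rewrite DB addrC addKr.
    rewrite /X.
    by move: (dd b z) (b z) (dd al z) (dd (H i0) z) (al z) (cexp _) => x1 x2 x3 x4 x5 x6; ring.
have W z : dd X z * b z = X z * dd b z.
  rewrite dX; move: (key z) => /eqP; rewrite subr_eq0 => /eqP kz.
  rewrite mulrAC [_ * b z]mulrC -kz /X.
  by move: (dd b z) (al z) (cexp _) => x1 x2 x3; ring.
have [k Hk] := wronskian0 hX hb (ex_intro _ v bv) W.
apply: (nH i0 i0A).
apply: (@small_quotient al (fun z => k * b z)) => //.
- exact: smallZ.
- exact: hH.
- by exists u.
Qed.

End ExponentialTypeZero.

Transparent coef circ cint.

(** * Growth and hyper-order *)

Section Growth.
Variable R : realType.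
Local Notation C := R[i].
Local Notation nm := (@Normc.normc R).
Local Notation cexp := (@cexp R).
Implicit Types (f g q : C -> C) (z w h l a b : C) (x y t M r e : R).

Lemma logp_ge0 x : 0 <= logp x.
Proof. by rewrite /logp le_max lexx. Qed.

Lemma logp_expR x y : logp x <= y -> x <= expR y.
Proof.
rewrite /logp ge_max => /andP[y0 xy]; have [x0|x0] := leP x 0.
  exact: le_trans x0 (expR_ge0 _).
by rewrite -(lnK x0) ler_expR.
Qed.

Lemma logpE x : logp x = ln (Num.max 1 x).
Proof.
rewrite /logp; have [x1|x1] := leP x 1; last by rewrite max_r// ltW// ln_gt0.
by rewrite ln1 max_l//; apply: ln_le0.
Qed.

Lemma logp_lip x y : `|logp x - logp y| <= `|x - y|.
Proof.
wlog xy : x y / y <= x.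
  move=> H; have [h|/ltW h] := leP y x; first exact: H.
  by rewrite distrC [leRHS]distrC; exact: H.
have p1 (s : R) : 0 < Num.max 1 s by rewrite lt_max ltr01.
have m1 : Num.max 1 y <= Num.max 1 x by rewrite ge_max !le_max lexx xy orbT.
rewrite !logpE !ger0_norm ?subr_ge0 ?ler_ln ?posrE//.
rewrite -ln_div ?posrE//.
have -> : Num.max 1 x / Num.max 1 y = 1 + (Num.max 1 x - Num.max 1 y) / Num.max 1 y.
  by rewrite mulrBl divff ?gt_eqF// addrC subrK.
apply: le_trans (le_ln1Dx _) _.
  by apply: (lt_le_trans (ltrN10 R)); rewrite divr_ge0 ?subr_ge0// ltW.
rewrite ler_pdivrMr//; apply: (@le_trans _ _ (x - y)); last first.
  by rewrite ler_peMr ?subr_ge0// le_max lexx.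
have [hx|hx] := leP 1 x; have [hy|hy] := leP 1 y => //; lra.
Qed.

Lemma cont_logp f : cont f -> cont (fun z => (logp (nm (f z)))%:C%C).
Proof.
move=> cf z e e0; have [d d0 H] := cf z e e0; exists d => // h /H hd.
rewrite -rmorphB nmR; apply: le_trans (logp_lip _ _) _.
apply: le_trans hd; rewrite ler_norml lerNl opprB nm_tri andbT.
by rewrite nmBC nm_tri.
Qed.

(* With the Fejer kernel in place of the Poisson kernel, [logp (nm f)] is majorized on a circle by the real
   part of a polynomial whose coefficients are controlled by the characteristic. *)
Section Fejer.
Variable n : nat.

(** An analytic function whose real part on the unit circle is the Fejer kernel: convolution with it
    gives a polynomial, and its real part gives a positive kernel of mean 1. *)
Definition fejer (v : C) : C := 1 + 2 / n.+1%:R * \sum_(j < n.+1) \sum_(k < j) v ^+ (j - k).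

Lemma fejer_Re (v : C) : nm v = 1 ->
  complex.Re (fejer v) = nm (\sum_(j < n.+1) v ^+ j) ^+ 2 / n.+1%:R.
Proof.
move=> v1.
have v0 : v != 0 by apply/eqP => h; move: v1; rewrite h nm0 => /eqP; rewrite eq_sym oner_eq0.
have nmDsq (x y : C) : nm (x + y) ^+ 2 = nm x ^+ 2 + nm y ^+ 2 + 2 * complex.Re (y * x^*%C).
  case: x y => [p q] [p' q']; rewrite /Normc.normc /= !sqr_sqrtr ?addr_ge0 ?sqr_ge0//; ring.
have key m : nm (\sum_(j < m) v ^+ j) ^+ 2 = m%:R + 2 * complex.Re (\sum_(j < m) \sum_(k < j) v ^+ (j - k)).
  elim: m => [|m IH]; first by rewrite !big_ord0 nm0 expr0n /= mulr0 addr0.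
  rewrite !big_ord_recr /= nmDsq IH nmX v1 !expr1n raddfD /= -[m.+1%:R]natr1 mulrDr.
  have -> : v ^+ m * (\sum_(i < m) v ^+ i)^*%C = \sum_(k < m) v ^+ (m - k); last by ring.
  rewrite conj_sum mulr_sumr; apply: eq_bigr => k _; rewrite conj_unit ?nmX ?v1 ?expr1n//.
  apply: (mulIf (expf_neq0 k v0)); rewrite divfK ?expf_neq0//.
  by rewrite -exprD subnK// ltnW.
rewrite key mulrDl divff ?pnatr_eq0// /fejer raddfD /=; congr (_ + _).
have -> : (2 / n.+1%:R : C) = (2 / n.+1%:R)%:C%C by rewrite fmorph_div /= !rmorph_nat.
rewrite mulrAC; set S := \sum_(j < _) _.
by case: S => p q /=; rewrite mul0r subr0.
Qed.

Lemma fejer_far (v : C) : nm v = 1 -> v != 1 ->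
  complex.Re (fejer v) <= 4 / (nm (v - 1) ^+ 2 * n.+1%:R).
Proof.
move=> v1 v0; rewrite fejer_Re// invfM mulrA ler_wpM2r ?invr_ge0//.
have p : 0 < nm (v - 1) by rewrite nm_gt0// subr_eq0.
rewrite ler_pdivlMr ?exprn_gt0// -exprMn mulrC -nmM -subrX1.
rewrite (_ : 4 = 2 ^+ 2); last by rewrite -natrX.
rewrite lerXn2r ?nnegrE ?nm_ge0//; apply: le_trans (nmB _ _) _.
by rewrite nmX v1 expr1n nm1; lra.
Qed.

Lemma fejer_Re_ge0 (v : C) : nm v = 1 -> 0 <= complex.Re (fejer v).
Proof. by move=> v1; rewrite fejer_Re// divr_ge0// exprn_ge0// nm_ge0. Qed.

End Fejer.

Lemma cint_sum (I : Type) (s : seq I) (F : I -> C -> C) x y : (forall i, cont (F i)) -> x <= y ->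
  cint (fun z => \sum_(i <- s) F i z) x y = \sum_(i <- s) cint (F i) x y.
Proof.
move=> H xy; elim: s => [|i s IH].
  under [X in cint X]eq_fun do rewrite big_nil.
  by rewrite big_nil cint_cst// mul0r.
under [X in cint X]eq_fun do rewrite big_cons.
by rewrite big_cons cintD ?IH//; exact: cont_sum.
Qed.

Definition expi (m : nat) z : C := cexp (- (m%:R * (z * 'i%C))).

Lemma cont_muli : cont (fun z => z * 'i%C).
Proof. by apply: contM; [exact: cont_id|exact: cont_cst]. Qed.

Lemma cont_expi m : cont (expi m).
Proof. by apply: (@cont_comp _ (fun z => cexp (- (m%:R * z)))); [exact: cont_expn|exact: cont_muli]. Qed.

Lemma cint_expi m : cint (expi m.+1) 0 (2 * pi) = 0.
Proof.
rewrite -(circ_expn0 0 m) /circ /vseg; congr cint; apply/funext => z.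
by rewrite /expi /vert add0r [z * _]mulrC.
Qed.

Lemma expi_nm m t : nm (expi m t%:C%C) = 1.
Proof.
rewrite /expi nm_cexp (_ : complex.Re _ = 0) ?expR0//.
rewrite -(rmorph_nat (@real_complex R)) [_ * 'i%C]mulrC mulrCA -rmorphM /=; ring.
Qed.

Lemma expiX m z : expi 1 z ^+ m = expi m z.
Proof. by rewrite /expi -cexpMn mul1r mulNrn -[_ *+ m]mulr_natl. Qed.

Lemma fejer_expi n v : (fun z => fejer n (v * expi 1 z)) = fun z => 1 + 2 / n.+1%:R *
   \sum_(j < n.+1) \sum_(k < j) v ^+ (j - k) * expi (j - k) z.
Proof.
apply/funext => z; rewrite /fejer; congr (_ + _ * _); apply: eq_bigr => j _.
by apply: eq_bigr => k _; rewrite exprMn expiX.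
Qed.

Lemma cont_fejer_sum n v : cont (fun z => \sum_(j < n.+1) \sum_(k < j) v ^+ (j - k) * expi (j - k) z).
Proof.
apply: (@cont_sum R _ _ (fun j z => \sum_(k < nat_of_ord j) v ^+ (j - k) * expi (j - k) z)) => j.
apply: (@cont_sum R _ _ (fun k z => v ^+ (j - nat_of_ord k) * expi (j - k) z)) => k.
by apply: contZ; exact: cont_expi.
Qed.

Lemma cont_fejer n v : cont (fun z => fejer n (v * expi 1 z)).
Proof.
rewrite fejer_expi; apply: contD; first exact: cont_cst.
by apply: contZ; exact: cont_fejer_sum.
Qed.

Lemma cint_fejer n v : cint (fun z => fejer n (v * expi 1 z)) 0 (2 * pi) = (2 * pi)%:C%C.
Proof.
have p0 := @pi2_ge0 R.
rewrite fejer_expi cintD; [|exact: cont_cst|by apply: contZ; exact: cont_fejer_sum].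
rewrite cint_cst// mul1r subr0 cintZ; last exact: cont_fejer_sum.
have c2 (j : nat) (k : 'I_j) : cont (fun z => v ^+ (j - k) * expi (j - k) z).
  by apply: contZ; exact: cont_expi.
have c1 (j : nat) : cont (fun z => \sum_(k < j) v ^+ (j - k) * expi (j - k) z).
  exact: (@cont_sum R _ _ (fun k z => v ^+ (j - nat_of_ord k) * expi (j - k) z)).
rewrite (@cint_sum _ _ (fun (j : 'I_n.+1) z => \sum_(k < j) v ^+ (j - k) * expi (j - k) z))//.
rewrite big1 ?mulr0 ?addr0// => j _.
rewrite (@cint_sum _ _ (fun (k : 'I_j) z => v ^+ (j - k) * expi (j - k) z))//.
rewrite big1// => k _; rewrite cintZ; last exact: cont_expi.
have : (0 < j - k)%N by rewrite subn_gt0.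
by case: (j - k)%N => // m _; rewrite cint_expi mulr0.
Qed.

(** * From the characteristic to pointwise bounds *)

Section PoissonBound.
Variables (f : C -> C) (rho : R).
Hypotheses (hf : holo f) (rho0 : 0 < rho).

Let u t := logp (nm (f (rho%:C%C * cexp (t%:C%C * 'i%C)))).
Let U z : C := (logp (nm (f (rho%:C%C * cexp (z * 'i%C)))))%:C%C.
Let T := nevanlinna_T f rho.

Let cU : cont U.
Proof.
apply: (@cont_comp _ (fun z => (logp (nm (f z)))%:C%C) (fun z => rho%:C%C * cexp (z * 'i%C))).
  exact/cont_logp/holo_cont.
by apply: contZ; apply: (@cont_comp _ cexp); [exact: cont_cexp|exact: cont_muli].
Qed.

Let cu : continuous u. Proof. exact: (cont_Re cU). Qed.

Let TE : 2 * pi * T = rint u 0 (2 * pi).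
Proof.
rewrite /T /nevanlinna_T mulrA divff ?mul1r; first by [].
by rewrite gt_eqF// pi2_gt0.
Qed.

Let uhat (m : nat) : C := ((2 * pi)%:C%C)^-1 * cint (fun z => U z * expi m z) 0 (2 * pi).

Let cUe m : cont (fun z => U z * expi m z).
Proof. by apply: contM => //; exact: cont_expi. Qed.

Let uhat_nm m : nm (uhat m) <= 2 * T.
Proof.
rewrite nmM nmV nmRp ?pi2_ge0// mulrC ler_pdivrMr ?pi2_gt0//.
rewrite [leRHS](_ : _ = 2 * pi * T + 2 * pi * T); last by ring.
rewrite TE; apply: le_trans (nm_ReIm _) _.
have key (v : R -> R) : continuous v -> (forall t, `|v t| <= u t) -> `|rint v 0 (2 * pi)| <= rint u 0 (2 * pi).
  move=> cv Hv; rewrite ler_norml; apply/andP; split.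
    rewrite -mulN1r -rintZ//; apply: rint_le => //.
      by move=> t; apply: cvgM; [exact: cvg_cst|exact: cu].
    by move=> t _; have := Hv t; rewrite ler_norml mulN1r => /andP[].
  by apply: rint_le => // t _; have := Hv t; rewrite ler_norml => /andP[].
have nU t : nm (U t%:C%C * expi m t%:C%C) = u t.
  by rewrite nmM expi_nm mulr1 nmRp ?logp_ge0.
apply: lerD; apply: key.
- exact: (cont_Re (cUe m)).
- by move=> t; rewrite -nU; exact: Re_le.
- exact: (cont_Im (cUe m)).
- by move=> t; rewrite -nU; exact: Im_le.
Qed.

Let T0 : 0 <= T.
Proof. by have := le_trans (nm_ge0 _) (uhat_nm 0); lra. Qed.

(** The convolution of [u] with the analytic Fejer kernel: on the circle of radius [rho] its real
    part is the Fejer mean of [log+ |f|]. *)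
Let Q n w : C := uhat 0 + 2 / n.+1%:R * \sum_(j < n.+1) \sum_(k < j) (w / rho%:C%C) ^+ (j - k) * uhat (j - k).

Let Q_holo n : holo (Q n).
Proof.
apply: holoD; first exact: holo_cst.
apply: holoZ; apply: (holo_sum _).1 => j _; apply: (holo_sum _).1 => k _.
apply: holoM; last exact: holo_cst.
have hl : holo (fun w => w / rho%:C%C) by apply: holoM; [exact: holo_id|exact: holo_cst].
elim: (j - k)%N => [|m IH]; first by under eq_fun do rewrite expr0; exact: holo_cst.
by under eq_fun do rewrite exprS; exact: holoM.
Qed.

(** [uhat 0] contributes [2 T]. Each inner sum is at most [2 T], a geometric series of ratio 1/2,
    and the prefactor doubles the average of these sums. *)
Let Q_nm n w : nm w <= rho / 2 -> nm (Q n w) <= 6 * T.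
Proof.
move=> wr; apply: le_trans (nmD _ _) _.
rewrite (_ : 6 * T = 2 * T + 4 * T); last by ring.
apply: lerD; first exact: uhat_nm.
rewrite nmM nmM nmV !nmn.
have wq : nm (w / rho%:C%C) <= 2^-1.
  by rewrite nmM nmV nmRp ?(ltW rho0)// ler_pdivrMr// mulrC.
have inner (j : nat) : nm (\sum_(k < j) (w / rho%:C%C) ^+ (j - k) * uhat (j - k)) <= 2 * T.
  apply: le_trans (nm_sum _ _ _) _.
  apply: (@le_trans _ _ (\sum_(k < j) 2^-1 ^+ (j - k) * (2 * T))).
    apply: ler_sum => k _; rewrite nmM nmX; apply: ler_pM; rewrite ?exprn_ge0 ?nm_ge0 ?uhat_nm//.
    by apply: lerXn2r; rewrite ?nnegrE ?nm_ge0 ?invr_ge0.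
  have T20 : 0 <= 2 * T := mulr_ge0 (ler0n _ 2) T0.
  rewrite -mulr_suml ler_piMl//.
  suff -> : \sum_(k < j) (2^-1 : R) ^+ (j - k) = 1 - 2^-1 ^+ j.
    by rewrite gerBl exprn_ge0// invr_ge0.
  elim: j => [|j IH]; first by rewrite big_ord0 expr0 subrr.
  rewrite big_ord_recl subn0 (eq_bigr (fun k : 'I_j => (2^-1 : R) ^+ (j - k))) ?IH.
    by rewrite exprS; field.
  by move=> k _; rewrite lift0 subSS.
apply: (@le_trans _ _ (2 / n.+1%:R * (n.+1%:R * (2 * T)))).
  rewrite ler_wpM2l ?divr_ge0//; apply: le_trans (nm_sum _ _ _) _.
  rewrite mulr_natl -[X in _ *+ X]card_ord -sumr_const; exact: ler_sum.
rewrite (_ : 2 / n.+1%:R * (n.+1%:R * (2 * T)) = 4 * T)//; move: T => T'; field.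
by rewrite addrC natr1 pnatr_eq0.
Qed.

Let Q_circle n v : complex.Re (Q n (rho%:C%C * v)) * (2 * pi) =
  rint (fun t => u t * complex.Re (fejer n (v * expi 1 t%:C%C))) 0 (2 * pi).
Proof.
have p0 := @pi2_ge0 R.
have -> : rint (fun t => u t * complex.Re (fejer n (v * expi 1 t%:C%C))) 0 (2 * pi) =
    complex.Re (cint (fun z => U z * fejer n (v * expi 1 z)) 0 (2 * pi)).
  apply: rint_eq => t _; rewrite /U /u.
  by case: (fejer _ _) => p q /=; rewrite mul0r subr0.
have -> : (fun z => U z * fejer n (v * expi 1 z)) = fun z => U z * expi 0 z + 2 / n.+1%:R *
   \sum_(j < n.+1) \sum_(k < j) v ^+ (j - k) * (U z * expi (j - k) z).
  apply/funext => z; rewrite (congr1 (fun g => g z) (fejer_expi n v)) mulrDr.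
  rewrite {2}/expi mul0r oppr0 cexp0; congr (_ + _).
  rewrite mulrCA; congr (_ * _); rewrite mulr_sumr; apply: eq_bigr => j _.
  by rewrite mulr_sumr; apply: eq_bigr => k _; rewrite mulrCA.
have c2 (j : nat) (k : 'I_j) : cont (fun z => v ^+ (j - k) * (U z * expi (j - k) z)).
  exact: contZ.
have c1 (j : nat) : cont (fun z => \sum_(k < j) v ^+ (j - k) * (U z * expi (j - k) z)).
  exact: (@cont_sum R _ _ (fun k z => v ^+ (j - nat_of_ord k) * (U z * expi (j - k) z))).
have c0 : cont (fun z => \sum_(j < n.+1) \sum_(k < j) v ^+ (j - k) * (U z * expi (j - k) z)).
  exact: (@cont_sum R _ _ (fun (j : 'I_n.+1) z => \sum_(k < j) v ^+ (j - k) * (U z * expi (j - k) z))).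
rewrite cintD//; last exact: contZ.
rewrite cintZ// (@cint_sum _ _ (fun (j : 'I_n.+1) z => \sum_(k < j) v ^+ (j - k) * (U z * expi (j - k) z)))//.
transitivity (complex.Re (Q n (rho%:C%C * v) * (2 * pi)%:C%C)).
  by case: (Q _ _) => p q /=; rewrite mulr0 subr0.
congr complex.Re.
  have cuh m : cint (fun z => U z * expi m z) 0 (2 * pi) = uhat m * (2 * pi)%:C%C.
    by rewrite /uhat mulrAC mulVf ?mul1r// pi2C_neq0.
  have rv : rho%:C%C * v / rho%:C%C = v by rewrite mulrAC divff ?mul1r// fmorph_eq0 gt_eqF.
  rewrite cuh /Q rv mulrDl; congr (_ + _); rewrite -[LHS]mulrA; congr (_ * _).
  rewrite mulr_suml; apply: eq_bigr => j _.
  rewrite (@cint_sum _ _ (fun (k : 'I_j) z => v ^+ (j - k) * (U z * expi (j - k) z)))//.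
  by rewrite mulr_suml; apply: eq_bigr => k _; rewrite cintZ// cuh mulrA.
Qed.

(** [u] is continuous, so on a short arc around the point it exceeds [u0 - 1/2]. Off the arc the
    kernel is small and [u] is nonnegative, which costs at most [B <= 1/2]. Integration against the
    kernel of mean 1 loses 1 in all. *)
Let circle_bound : exists n, forall v, nm v = 1 -> logp (nm (f (rho%:C%C * v))) <= complex.Re (Q n (rho%:C%C * v)) + 1.
Proof.
have cL := cont_logp (holo_cont hf).
have h2 : (0 : R) < 2^-1 by rewrite invr_gt0.
have [d d0 Hd] := cont_unif rho cL h2.
have [M HM] := cont_bounded rho cL.
have M0 : 0 <= M by apply: le_trans (nm_ge0 _) (HM 0 _); rewrite nm0 ltW.
have dr : 0 < d / rho by rewrite divr_gt0.
have K0 : 0 <= 8 * M / (d / rho) ^+ 2 by exact: divr_ge0 (mulr_ge0 (ler0n _ 8) M0) (ltW (exprn_gt0 2 dr)).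
(* Off the arc the kernel is at most [4 / ((d / rho)^2 (n + 1))]; this [n] makes [M] times that at
   most 1/2. *)
pose n := Num.bound (8 * M / (d / rho) ^+ 2).
exists n => v v1; set u0 := logp (nm (f (rho%:C%C * v))).
have rv w : nm w = 1 -> nm (rho%:C%C * w) = rho by move=> w1; rewrite nmM w1 mulr1 nmRp ?ltW.
have u0M : u0 <= M.
  by have := HM (rho%:C%C * v); rewrite rv// nmRp ?logp_ge0//; apply.
pose B : R := M * (4 / ((d / rho) ^+ 2 * n.+1%:R)).
have dr2 : 0 < (d / rho) ^+ 2 by rewrite exprn_gt0.
have B2 : B <= 2^-1.
  have nK : 8 * M / (d / rho) ^+ 2 <= n.+1%:R.
    by apply: le_trans (ltW (archi_boundP K0)) _; rewrite ler_nat.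
  rewrite /B mulrA ler_pdivrMr; last exact: mulr_gt0 dr2 (ltr0Sn _ n).
  by move: nK; rewrite ler_pdivrMr// [(d / rho) ^+ 2 * _]mulrC; lra.
pose F t := complex.Re (fejer n (v * expi 1 t%:C%C)).
have cF : continuous F by exact: (cont_Re (cont_fejer n v)).
have e1 t : nm (v * expi 1 t%:C%C) = 1 by rewrite nmM v1 expi_nm mulr1.
have pw t : (u0 - 2^-1) * F t <= u t * F t + B.
  have F0 : 0 <= F t by apply: fejer_Re_ge0; rewrite e1.
  have u0t : 0 <= u t by exact: logp_ge0.
  have B0 : 0 <= B by rewrite mulr_ge0// divr_ge0// mulr_ge0// ltW.
  set z := cexp (t%:C%C * 'i%C).
  have z1 : nm z = 1.
    have := expi_nm 1 t; rewrite /expi mul1r cexpN nmV -/z => h.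
    by rewrite -[nm z]invrK h invr1.
  have ez : expi 1 t%:C%C = z^-1 by rewrite /expi mul1r cexpN.
  have [near|far] := ltP (nm (rho%:C%C * v - rho%:C%C * z)) d.
    have := Hd (rho%:C%C * z) (rho%:C%C * v); rewrite rv// => /(_ (lexx _) near).
    rewrite -rmorphB nmR ler_norml => /andP[_]; rewrite -/u0 -/(u t) => h.
    by apply: ler_wpDr => //; rewrite ler_wpM2r//; lra.
  have z0 : z != 0 by apply/eqP => h; move: z1; rewrite h nm0 => /eqP; rewrite eq_sym oner_eq0.
  have far' : d / rho <= nm (v * expi 1 t%:C%C - 1).
    rewrite ez (_ : v / z - 1 = (v - z) / z); last by field.
    rewrite nmM nmV z1 invr1 mulr1 ler_pdivrMr//.
    by move: far; rewrite -mulrBr nmM nmRp ?(ltW rho0)// mulrC.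
  have FB : F t <= 4 / ((d / rho) ^+ 2 * n.+1%:R).
    apply: le_trans (fejer_far _ (e1 t) _) _.
      by apply/eqP => h; move: far'; rewrite h subrr nm0 leNgt dr.
    have q0 : 0 < nm (v * expi 1 t%:C%C - 1) := lt_le_trans dr far'.
    rewrite ler_wpM2l// lef_pV2 ?posrE; [|exact: mulr_gt0 (exprn_gt0 2 q0) (ltr0Sn _ n)|exact: mulr_gt0 dr2 (ltr0Sn _ n)].
    by rewrite ler_wpM2r// lerXn2r ?nnegrE ?nm_ge0 ?(ltW dr).
  apply: (@le_trans _ _ (M * F t)); first by rewrite ler_wpM2r//; lra.
  by apply: (@le_trans _ _ B); [rewrite ler_wpM2l|rewrite lerDr mulr_ge0].
have cuF : continuous (fun t => u t * F t) by move=> t; apply: cvgM; [exact: cu|exact: cF].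
have cst (k : R) : continuous (fun _ : R => k) by move=> ?; exact: cvg_cst.
have ca : continuous (fun t => (u0 - 2^-1) * F t).
  by move=> t; apply: cvgM; [exact: cvg_cst|exact: cF].
have cb : continuous (fun t => u t * F t + B).
  by move=> t; apply: cvgD; [exact: cuF|exact: cvg_cst].
have := @rint_le R _ _ 0 (2 * pi) ca cb (fun t _ => pw t).
rewrite rintZ// rintD// rint_cst ?pi2_ge0// subr0.
have -> : rint F 0 (2 * pi) = 2 * pi by exact: (congr1 (@complex.Re R) (cint_fejer n v)).
rewrite -(Q_circle n v) -[B * _]/(B * (2 * pi)) -mulrDl => hm.
move: hm; rewrite (ler_pM2r (@pi2_gt0 R)) -/u0.
rewrite lerBlDr => /le_trans; apply; rewrite -addrA lerD2l; apply: le_trans (lerD B2 (lexx _)) _.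
by rewrite -mulr2n -[_ *+ 2]mulr_natr mulVf ?pnatr_eq0.
Qed.

(** On the circle [f e^{-Q}] is at most [e] by [circle_bound], hence at most [4 e] on the half disc,
    where [Q] is at most [6 T]. Multiplication by a zero-free function replaces the subharmonicity
    of [log+ |f|]. *)
Lemma poisson_bound z0 : nm z0 <= rho / 2 -> nm (f z0) <= 4 * expR (1 + 6 * nevanlinna_T f rho).
Proof.
move=> z0r; have [n Hn] := circle_bound.
pose g z := f z * cexp (- 1 * Q n z).
have hg : holo g by apply: holoM => //; apply: holo_cexp_comp; exact: holoZ.
have ngE z : nm (g z) = nm (f z) * expR (- complex.Re (Q n z)).
  by rewrite nmM nm_cexp mulN1r raddfN.
have := @cauchy_bound R g z0 rho (expR 1) hg rho0 z0r.
move=> /(_ _)/wrap[].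
  move=> z zr; have r0 : rho%:C%C != 0 :> C by rewrite fmorph_eq0 gt_eqF.
  have zE : z = rho%:C%C * (z / rho%:C%C) by rewrite mulrC divfK.
  have v1 : nm (z / rho%:C%C) = 1 by rewrite nmM nmV zr nmRp ?(ltW rho0)// divff ?gt_eqF.
  have := Hn _ v1; rewrite -zE ngE expRN => h.
  rewrite ler_pdivrMr ?expR_gt0// -expRD addrC; exact: logp_expR.
rewrite ngE expRN ler_pdivrMr ?expR_gt0// -mulrA -expRD => /le_trans; apply.
rewrite ler_wpM2l// ler_expR lerD2l; apply: le_trans (Q_nm n z0r).
by apply: le_trans (Re_le _); rewrite ler_norm.
Qed.

End PoissonBound.

(** Some [s < 1] satisfies [log log T <= s log r] for all large [r], that is [T <= exp (r^s)], and
    [r^s] is eventually below [e r]. *)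
Lemma hyper_order_T f : (hyper_order f < 1)%E -> forall e, 0 < e ->
  exists r0, forall r, r0 <= r -> nevanlinna_T f r <= expR (e * r).
Proof.
move=> ho.
have [s [s0 s1 [r1 H1]]] : exists s : R, [/\ 0 < s, s < 1 & exists r1, forall r, r1 < r ->
    logp (logp (nevanlinna_T f r)) / ln r <= s].
  have /ereal_inf_lt[_ [V [r1 [_ Hr1]] <-] V1] := ho.
  have ub r : r1 < r -> ((logp (logp (nevanlinna_T f r)) / ln r)%:E <=
     ereal_sup [set (logp (logp (nevanlinna_T f x)) / ln x)%:E | x in V])%E.
    by move=> rr; apply: ereal_sup_ubound => /=; exists r => //; exact: Hr1.
  move: V1 ub; case: (ereal_sup _) => [q| |] //.
    rewrite lte_fin => q1 ub; exists (Num.max q 2^-1); split.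
    - by rewrite lt_max invr_gt0 ltr0n orbT.
    - by rewrite gt_max q1 invf_lt1// ltr1n.
    - by exists r1 => r rr; have := ub r rr; rewrite lee_fin le_max => ->.
  move=> _ ub; exists 2^-1; split; [by rewrite invr_gt0|by rewrite invf_lt1// ltr1n|].
  by exists r1 => r rr; have := ub r rr; rewrite leeNy_eq.
(* The last threshold is the point where [r^s = e r]; the value 2 makes [ln r] positive. *)
move=> e e0; exists (Num.max (r1 + 1) (Num.max 2 (expR (- ln e / (1 - s))))) => r.
rewrite !ge_max => /andP[ra /andP[rb rc]].
have r0 : 0 < r by lra.
have lr : 0 < ln r by rewrite ln_gt0//; lra.
have := H1 r ltac:(lra); rewrite ler_pdivrMr// => h.
apply: logp_expR; apply: le_trans (logp_expR h) _.
have -> : e * r = expR (ln e + ln r) by rewrite expRD !lnK.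
rewrite ler_expR.
have : - ln e / (1 - s) <= ln r by rewrite -[leLHS]expRK ler_ln ?posrE ?expR_gt0.
rewrite ler_pdivrMr ?subr_gt0//; lra.
Qed.

Lemma hyper_order_growth f : holo f -> (hyper_order f < 1)%E -> forall e, 0 < e ->
  exists K, forall z, nm (f z) <= expR (K * expR (e * nm z)).
Proof.
move=> hf ho e e0.
have e2 : 0 < e / 2 by rewrite divr_gt0.
have [r0 H0] := hyper_order_T ho e2.
set r1 := Num.max r0 1.
have [M HM] := cont_bounded r1 (holo_cont hf).
have M0 : 0 <= M.
  by apply: le_trans (nm_ge0 _) (HM 0 _); rewrite nm0 le_max ler01 orbT.
exists (M + (ln 4 + 7)) => z.
have l4 : 0 <= ln 4 :> R by rewrite ln_ge0// ler1n.
have E1 : 1 <= expR (e * nm z) by apply: expR_ge1; rewrite mulr_ge0 ?nm_ge0 ?(ltW e0).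
have [zr|zr] := leP (nm z) r1.
  apply: le_trans (HM _ zr) _; apply: le_trans (expR_ge1Dx _).
  move: (expR _) E1 => E E1.
  have : 0 <= M * (E - 1) by rewrite mulr_ge0// subr_ge0.
  have : 0 <= (ln 4 + 7) * E by rewrite mulr_ge0//; lra.
  lra.
have z1 : 1 <= nm z by apply: ltW; apply: le_lt_trans zr; rewrite le_max lexx orbT.
have rho0 : 0 < 2 * nm z by lra.
apply: le_trans (poisson_bound hf rho0 _) _; first by lra.
rewrite -{1}[4]lnK ?posrE// -expRD ler_expR.
have := H0 (2 * nm z); rewrite (_ : e / 2 * (2 * nm z) = e * nm z); last by field.
move=> /(_ _)/wrap[].
  by apply: (@le_trans _ _ r1); [rewrite le_max lexx|lra].
move: (expR (e * nm z)) E1 => E E1 h.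
have : M * 1 <= M * E by rewrite ler_wpM2l.
have : ln 4 * 1 <= ln 4 * E by rewrite ler_wpM2l.
lra.
Qed.

End Growth.

(** * Logarithms of zero-free functions of double exponential growth *)

Section Logarithm.
Variable R : realType.
Local Notation C := R[i].
Local Notation nm := (@Normc.normc R).
Local Notation cexp := (@cexp R).
Implicit Types (f g F h : C -> C) (z w l c k : C) (x y M K r e : R).

(** The growth inherited from the hyper-order: zero-free entire functions of this class have
    logarithms of exponential type zero. *)
Definition dexp_bounded F := forall e, 0 < e -> exists K, forall z, nm (F z) <= expR (K * expR (e * nm z)).

Lemma dexp_bound F e : dexp_bounded F -> 0 < e -> exists2 K, 0 <= K &
  forall z, nm (F z) <= expR (K * expR (e * nm z)).
Proof.
move=> H e0; have [K HK] := H e e0; exists (Num.max K 0); first by rewrite le_max lexx orbT.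
by move=> z; apply: le_trans (HK z) _; rewrite ler_expR ler_wpM2r ?expR_ge0// le_max lexx.
Qed.

Lemma expR2 : 2 <= expR 1 :> R.
Proof. by apply: le_trans (expR_ge1Dx _). Qed.

Lemma dexp_boundedD f g : dexp_bounded f -> dexp_bounded g -> dexp_bounded (fun z => f z + g z).
Proof.
move=> bf bg e e0; have [K K0 HK] := dexp_bound bf e0; have [K' K'0 HK'] := dexp_bound bg e0.
exists (1 + (K + K')) => z; apply: le_trans (nmD _ _) _.
have E1 : 1 <= expR (e * nm z) by apply: expR_ge1; rewrite mulr_ge0 ?nm_ge0 ?(ltW e0).
apply: le_trans (lerD (HK z) (HK' z)) _; move: (expR (e * nm z)) E1 => E E1.
have E0 : 0 <= E by lra.
have h1 := mulr_ge0 K0 E0; have h2 := mulr_ge0 K'0 E0.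
apply: (@le_trans _ _ (2 * expR ((K + K') * E))).
  rewrite mulr_natl mulr2n mulrDl; apply: lerD; rewrite ler_expR ?lerDl ?lerDr//.
apply: (@le_trans _ _ (expR 1 * expR ((K + K') * E))); first by rewrite ler_wpM2r ?expR_ge0 ?expR2.
by rewrite -expRD ler_expR [(1 + _) * E]mulrDl mul1r lerD2r.
Qed.

Lemma dexp_boundedZ k f : dexp_bounded f -> dexp_bounded (fun z => k * f z).
Proof.
move=> bf e e0; have [K K0 HK] := dexp_bound bf e0; exists (nm k + K) => z.
have E1 : 1 <= expR (e * nm z) by apply: expR_ge1; rewrite mulr_ge0 ?nm_ge0 ?(ltW e0).
rewrite nmM mulrDl expRD; apply: ler_pM; rewrite ?nm_ge0 ?HK//.
apply: (@le_trans _ _ (expR (nm k))).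
  by apply: le_trans (expR_ge1Dx _); rewrite lerDr.
by rewrite ler_expR ler_peMr ?nm_ge0.
Qed.

Lemma dexp_bounded_shift f c : dexp_bounded f -> dexp_bounded (fun z => f (z + c)).
Proof.
move=> bf e e0; have [K K0 HK] := dexp_bound bf e0; exists (K * expR (e * nm c)) => z.
apply: le_trans (HK _) _; rewrite ler_expR -mulrA -expRD ler_wpM2l// ler_expR -mulrDr addrC.
by rewrite ler_wpM2l ?(ltW e0)// nmD.
Qed.

Lemma dexp_bounded_dd f : holo f -> dexp_bounded f -> dexp_bounded (dd f).
Proof.
move=> hf bf e e0; have [K K0 HK] := dexp_bound bf e0; exists (1 + K * expR e) => z.
have E1 : 1 <= expR (e * nm z) by apply: expR_ge1; rewrite mulr_ge0 ?nm_ge0 ?(ltW e0).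
have := @cauchy_est R f z 1 (expR (K * expR e * expR (e * nm z))) hf ltr01.
move=> /(_ _)/wrap[].
  move=> w w1; apply: le_trans (HK _) _; rewrite ler_expR -mulrA -expRD ler_wpM2l// ler_expR.
  have : e * nm (w + z) <= e * (1 + nm z) by rewrite ler_wpM2l ?(ltW e0)// -w1 nmD.
  by rewrite mulrDr mulr1.
rewrite [X in X <= _]mulr1 => /le_trans; apply; rewrite [(1 + K * expR e) * _]mulrDl mul1r expRD ler_wpM2r ?expR_ge0//.
by apply: le_trans expR2 _; rewrite ler_expR.
Qed.

(** The growth of [F] bounds the real part of [h] from above on the circle of radius
    [r = 2 (nm z + 1)]. Borel-Caratheodory then bounds every Taylor coefficient, and the series at
    [z] is geometric of ratio at most 1/2. The exponent [e / 2] compensates the doubled radius: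
    [e / 2 * r = e + e nm z]. *)
Lemma small_log F : holo F -> (forall z, F z != 0) -> dexp_bounded F ->
  exists2 h, small h & forall z, F z = cexp (h z).
Proof.
move=> hF F0 bF; have [h hh Fh] := holo_log hF F0.
exists h => //; split=> // e e0.
have e2 : 0 < e / 2 by rewrite divr_gt0.
have [K K0 HK] := dexp_bound bF e2.
exists (8 * K * expR e + 4 * nm (h 0)) => z.
pose r := 2 * (nm z + 1).
have r0 : 0 < r by rewrite mulr_gt0// ltr_wpDl// nm_ge0.
have zr : nm z <= r / 2 by rewrite /r mulrC mulKf// lerDl.
pose A := K * expR (e / 2 * r).
have A0 : 0 <= A by rewrite mulr_ge0// expR_ge0.
have ReA w : nm w = r -> complex.Re (h w) <= A.
  by move=> wr; have := HK w; rewrite Fh nm_cexp ler_expR wr.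
pose B := 4 * A + 2 * nm (h 0).
have h00 := nm_ge0 (h 0).
have cB n : nm (coef h n) * r ^+ n <= B.
  case: n => [|n].
    rewrite expr0 mulr1 coef0//; apply: (@le_trans _ _ (2 * nm (h 0))).
      by rewrite ler_peMl// ler1n.
    by rewrite lerDr mulr_ge0.
  apply: borel_caratheodory => // N0; exists N0, r%:C%C; split=> //; first by rewrite nmRp ?ltW.
  have -> : A * N0%:R = \sum_(k < N0) A by rewrite sumr_const card_ord mulr_natr.
  apply: ler_sum => k _; rewrite ge_max A0 ReA// nmM nmX nm_zeta expr1n mulr1 nmRp ?ltW//.
have [M HM] := cont_bounded r (holo_cont hh).
have M0 : 0 <= M by apply: le_trans (nm_ge0 _) (HM 0 _); rewrite nm0 ltW.
have B0 : 0 <= B by rewrite /B addr_ge0// mulr_ge0.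
have zr2 : nm z / r <= 2^-1 by rewrite ler_pdivrMr// mulrC.
have zr0 : 0 <= nm z / r by rewrite divr_ge0 ?nm_ge0// ltW.
have tB N : nm (h z) <= 2 * B + 20 * M / 2 ^+ N.
  have -> : h z = \sum_(i < N) coef h i * z ^+ i + (h z - \sum_(i < N) coef h i * z ^+ i) by rewrite addrC subrK.
  apply: le_trans (nmD _ _) _; apply: lerD.
    apply: le_trans (nm_sum _ _ _) _.
    apply: (@le_trans _ _ (\sum_(i < N) B * 2^-1 ^+ i)).
      apply: ler_sum => i _; rewrite nmM nmX.
      rewrite (_ : _ * _ = nm (coef h i) * r ^+ i * (nm z / r) ^+ i); last first.
        by rewrite expr_div_n mulrA [_ * r ^+ i * _]mulrAC mulfK// expf_neq0// gt_eqF.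
      apply: ler_pM; rewrite ?mulr_ge0 ?exprn_ge0 ?nm_ge0 ?(ltW r0)//.
      by rewrite lerXn2r ?nnegrE// invr_ge0.
    rewrite -mulr_sumr mulrC ler_wpM2r//.
    suff -> : \sum_(i < N) (2^-1 : R) ^+ i = 2 - 2 * 2^-1 ^+ N.
      by rewrite gerBl mulr_ge0// exprn_ge0// invr_ge0.
    elim: N => [|N IH]; first by rewrite big_ord0 expr0 mulr1 subrr.
    by rewrite big_ord_recr /= IH exprS; field.
  apply: le_trans (taylor N hh r0 zr (M := M) _) _.
    by move=> w wr; apply: HM; rewrite wr.
  rewrite -exprVn ler_wpM2l ?mulr_ge0// lerXn2r ?nnegrE ?invr_ge0//.
have hz : nm (h z) <= 2 * B.
  apply/ler_addgt0Pr => d d0.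
  have [N HN] := @pow2_small R (20 * M) d (mulr_ge0 (ler0n _ 20) M0) d0.
  by apply: le_trans (tB N) _; rewrite lerD2l ltW.
apply: le_trans hz _.
rewrite /B /A (_ : e / 2 * r = e + e * nm z); last by rewrite /r; field.
rewrite expRD.
have E1 : 1 <= expR (e * nm z) by apply: expR_ge1; rewrite mulr_ge0 ?nm_ge0 ?(ltW e0).
have h4 : 4 * nm (h 0) <= 4 * nm (h 0) * expR (e * nm z) by rewrite ler_peMr// mulr_ge0.
rewrite [leRHS]mulrDl; apply: le_trans (lerD (lexx _) h4).
by rewrite le_eqVlt; apply/orP; left; apply/eqP; ring.
Qed.

End Logarithm.

(** * Linear relations between exponentials *)

Section Separation.
Variable R : realType.
Local Notation C := R[i].
Local Notation nm := (@Normc.normc R).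
Local Notation cexp := (@cexp R).
Implicit Types (f g h a b : C -> C) (z w l c k x y s : C).

Local Notation isconst := (@isconst R).

Definition affine h := isconst (dd h).

Lemma isconst_eq f k : (forall z, f z = k) -> isconst f.
Proof. by move=> H z; rewrite !H. Qed.

Lemma affineE h : holo h -> affine h -> forall z, h z = dd h 0 * z + h 0.
Proof.
move=> hh ah z; have hl : holo (fun z => dd h 0 * z) by apply: holoZ; exact: holo_id.
have := @dd0_const R (fun z => h z - dd h 0 * z) (holoB hh hl).
move=> /(_ _ z)/wrap[].
  move=> w; rewrite (ddB hh hl) ddZ; last exact: holo_id.
  by rewrite dd_id mulr1 ah subrr.
by rewrite mulr0 subr0 => <-; rewrite addrC subrK.
Qed.

(** The derivative of [h] has period [c] and exponential type zero, hence is constant. *)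
Lemma affine_shift h c : small h -> c != 0 -> isconst (fun z => h (z + c) - h z) -> affine h.
Proof.
move=> sh c0 H; have hh := small_holo sh.
have per z : dd h (z + c) = dd h z.
  have -> : dd h (z + c) = dd (fun z => h (z + c) - h z + h z) z.
    have -> : (fun z => h (z + c) - h z + h z) = fun z => h (z + c) by apply/funext => w; rewrite subrK.
    by rewrite (dd_shift c hh).
  have hd : holo (fun z => h (z + c) - h z) by apply: holoB => //; exact: holo_shift.
  rewrite (ddD hd hh) (_ : (fun z => h (z + c) - h z) = fun=> h (0 + c) - h 0); last exact/funext/H.
  by rewrite dd_cst add0r.
by move=> z; exact: small_periodic (small_dd sh) c0 per z.
Qed.

Lemma affine_eq h g k : holo g -> (forall z, h z - g z = k) -> affine g -> affine h.
Proof.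
move=> hg H ag z; have -> : h = fun z => g z + k.
  by apply/funext => w; rewrite -(H w) addrC subrK.
have dg : dd (fun z => g z + k) = dd g.
  by apply: dd_fun => w; have := hasdD (holo_hasd w hg) (hasd_cst k w); rewrite addr0.
by rewrite dg; exact: ag.
Qed.

Lemma affine_shiftE h c : holo h -> affine (fun z => h (z + c)) -> affine h.
Proof.
move=> hh; rewrite /affine (dd_shift c hh) => H z.
by have := H (z - c); rewrite subrK => ->; rewrite -(H (- c)) addNr.
Qed.

(** The factor in [(e^h)'' = D2 h e^h]. *)
Definition D2 h z : C := dd (dd h) z + dd h z ^+ 2.

Lemma small_D2 h : small h -> small (D2 h).
Proof.
move=> sh; apply: smallD; first by do 2 apply: small_dd.
by apply: (@smallM _ (dd h) (dd h)); exact: small_dd.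
Qed.

Lemma dd2_cexp h : holo h -> dd (dd (fun z => cexp (h z))) = fun z => D2 h z * cexp (h z).
Proof.
move=> hh; rewrite (dd_cexp hh) (ddM (holo_cexp_comp hh) (holo_dd hh)) (dd_cexp hh).
by apply/funext => z; rewrite /D2; move: (cexp _) (dd h z) (dd (dd h) z) => x y s; ring.
Qed.

(* [w = h'] solves the Riccati equation [w' = k - w ^ 2], along which [w' e^{2h}] is conserved. *)
Lemma affine_D2 h k : small h -> (forall z, D2 h z = k) -> affine h.
Proof.
move=> sh H; have hh := small_holo sh; have sw := small_dd sh; have hw := small_holo sw.
have hw' := holo_dd hw.
have w'E : dd (dd h) = fun z => k - dd h z * dd h z.
  by apply/funext => z; rewrite -(H z) /D2 expr2 addrK.
have w'' z : hasd (dd (dd h)) z (- (2 * dd h z * dd (dd h) z)).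
  have := hasdB (hasd_cst k z) (hasdM (holo_hasd z hw) (holo_hasd z hw)).
  by rewrite -w'E => /hasd_eq; apply; move: (dd h z) (dd (dd h) z) => x y; ring.
have h2 : holo (fun z => 2 * h z) by exact: holoZ.
have he := holo_cexp_comp h2.
have := @dd0_const R (fun z => dd (dd h) z * cexp (2 * h z)) (holoM hw' he).
move=> /(_ _)/wrap[].
  move=> z; apply: hasd_dd.
  have := hasdM (w'' z) (hasd_cexp_comp (hasdZ 2 (holo_hasd z hh))).
  by move/hasd_eq; apply; move: (cexp _) (dd h z) (dd (dd h) z) => x y s; ring.
(* If [h''] is not identically zero, the conserved quantity and [small_quotient] make [h] itself
   constant; otherwise [h'] is constant. *)
move=> E; have [[u nu]|w'0] := pselect (exists u, dd (dd h) u != 0).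
  have := @small_quotient R (dd (dd h)) (fun=> dd (dd h) 0 * cexp (2 * h 0)) (fun z => 2 * h z).
  move=> /(_ (small_dd sw) (small_cst _) h2 (ex_intro _ u nu) E) ch.
  move=> z; suff -> : h = fun=> h 0 by rewrite dd_cst.
  by apply/funext => v; apply: (mulfI (_ : 2 != 0 :> C)); rewrite ?ch// pnatr_eq0.
apply: (dd0_const hw) => z; apply/eqP; apply: contrapT => /negP n0; apply: w'0.
by exists z.
Qed.

(** The form in which [small_borel] is applied: division by [e^{h0}] isolates a term whose exponent
    is congruent to no other. Shorter relations are padded with zero coefficients or repeated
    exponents. *)
Lemma separate (b : C -> C) (h0 : C -> C) (a1 h1 a2 h2 a3 h3 : C -> C) :
  small b -> small a1 -> small a2 -> small a3 -> small h0 -> small h1 -> small h2 -> small h3 ->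
  ~ isconst (fun z => h1 z - h0 z) -> ~ isconst (fun z => h2 z - h0 z) ->
  ~ isconst (fun z => h3 z - h0 z) ->
  (forall z, b z * cexp (h0 z) + a1 z * cexp (h1 z) + a2 z * cexp (h2 z) + a3 z * cexp (h3 z) = 0) ->
  forall z, b z = 0.
Proof.
move=> sb sa1 sa2 sa3 sh0 sh1 sh2 sh3 n1 n2 n3 E.
pose ai (i : 'I_3) := nth a1 [:: a1; a2; a3] i.
pose hi (i : 'I_3) := nth h1 [:: h1; h2; h3] i.
suff H z : -1 * b z = 0 by move=> z; have := H z; rewrite mulN1r => /eqP; rewrite oppr_eq0 => /eqP.
move: z; apply: (@small_borel R 'I_3 3 [set: 'I_3] ai (fun i z => hi i z - h0 z)).
- by rewrite cardsT card_ord.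
- by case=> [[|[|[|]]]].
- by case=> [[|[|[|]]]] //= ? _; exact: smallB.
- by case=> [[|[|[|]]]].
- exact: smallZ.
- move=> z; have [en0 e0] := (cexp_neq0 (h0 z), cexpB).
  rewrite (eq_bigl xpredT); last by move=> i; rewrite inE.
  rewrite !big_ord_recl big_ord0 /= /ai /hi /= addr0 !cexpB.
  apply: (mulIf en0); have := E z.
  move: (b z) (a1 z) (a2 z) (a3 z) (cexp (h0 z)) (cexp (h1 z)) (cexp (h2 z)) (cexp (h3 z)) en0.
  move=> B A1 A2 A3 E0 E1 E2 E3 en0 EE; apply/eqP; rewrite -subr_eq0 -EE; apply/eqP.
  by field.
Qed.

End Separation.

(** * Relations between two exponentials and their shifts *)

Section Relation.
Variable R : realType.
Local Notation C := R[i].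
Local Notation cexp := (@cexp R).
Implicit Types (f g h a b : C -> C) (z w l c k x y s : C).

Local Notation isconst := (@isconst R).

Lemma isconst_opp f g : isconst (fun z => f z - g z) -> isconst (fun z => g z - f z).
Proof. by move=> H z; rewrite -opprB H opprB. Qed.

Lemma affine_near h g : holo g -> isconst (fun z => h z - g z) -> affine g -> affine h.
Proof. by move=> hg H; apply: (affine_eq hg H). Qed.

(* Two exponentials satisfying a difference-differential relation: a non-affine exponent cannot be
   absorbed by the other one, so its derivative term has to disappear. *)
Lemma relation_step h1 h2 c x1 x2 y1 y2 s1 s2 : small h1 -> small h2 -> c != 0 ->
  (forall z, (x1 + y1 * D2 h1 z) * cexp (h1 z) + (x2 + y2 * D2 h2 z) * cexp (h2 z) +
     s1 * cexp (h1 (z + c)) + s2 * cexp (h2 (z + c)) = 0) ->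
  ~ isconst (fun z => h1 z - h2 z) -> ~ affine h1 ->
  y1 = 0 /\ (affine h2 -> x1 = 0 /\ s1 = 0).
Proof.
move=> S1 S2 c0 E p nl.
have n12 := contra_not (@isconst_opp h2 h1) p.
have nc := contra_not (affine_shift S1 c0) nl.
have sX (x y : C) h : small h -> small (fun z => x + y * D2 h z).
  by move=> sh; apply: smallD; [exact: small_cst|apply: smallZ; exact: small_D2].
have D1c k : (forall z, x1 + y1 * D2 h1 z + k = 0) -> y1 = 0.
  move=> H; apply: contrapT => /eqP y0; apply: nl.
  apply: (@affine_D2 _ _ (- (x1 + k) / y1) S1) => z; apply: (mulIf y0); rewrite divfK//.
  by apply/eqP; rewrite -subr_eq0 -(H z); apply/eqP; ring.
have sc1 := small_shift c S1; have sc2 := small_shift c S2.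
(* Only [h2 (z + c)] can be congruent to [h1] modulo constants: [h2] is excluded by hypothesis, and
   [h1 (z + c)] because [h1] is not affine. *)
have [cc|ncc] := pselect (isconst (fun z => h2 (z + c) - h1 z)); last first.
  have X0 z : x1 + y1 * D2 h1 z = 0.
    exact: (separate (sX x1 y1 h1 S1) (sX x2 y2 h2 S2) (small_cst s1) (small_cst s2) S1 S2 sc1 sc2 n12 nc ncc E).
  have y0 : y1 = 0 by apply: (D1c 0) => z; rewrite addr0.
  have x0 : x1 = 0 by have := X0 0; rewrite y0 mul0r addr0.
  split=> [|a2]; first exact: y0.
  split; first exact: x0.
  have hh1 := small_holo S1; have hh2 := small_holo S2.
  have n2c : ~ isconst (fun z => h2 z - h1 (z + c)).
    move=> /isconst_opp H; apply: nl; apply: (affine_shiftE hh1 (c := c)).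
    exact: affine_near hh2 H a2.
  have n2cc : ~ isconst (fun z => h2 (z + c) - h1 (z + c)).
    move=> H; apply: p; apply/isconst_opp => z; have := H (z - c); rewrite subrK => ->.
    by rewrite -(H (- c)) addNr.
  have sz := @small_cst R 0.
  apply: (separate (small_cst s1) (sX x2 y2 h2 S2) (small_cst s2) sz sc1 S2 sc2 S2 n2c n2cc n2c _ 0) => z.
  by rewrite mul0r addr0 -[RHS](E z) X0 mul0r add0r [s1 * _ + _]addrC.
have X0 z : x1 + y1 * D2 h1 z + s2 * cexp (h2 (0 + c) - h1 0) = 0.
  have sz := @small_cst R 0.
  have := separate (smallD (sX x1 y1 h1 S1) (small_cst (s2 * cexp (h2 (0 + c) - h1 0))))
    (sX x2 y2 h2 S2) (small_cst s1) sz S1 S2 sc1 S2 n12 nc n12.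
  apply => w; rewrite mul0r addr0 -[RHS](E w).
  rewrite (_ : h2 (w + c) = h1 w + (h2 (0 + c) - h1 0)); last first.
    by have /eqP := cc w; rewrite subr_eq => /eqP ->; exact: addrC.
  by rewrite [cexp (h1 w + _)]cexpD; move: (D2 h1 w) (D2 h2 w) (cexp _) (cexp _) (cexp _) (cexp _) => *; ring.
split; first exact: D1c X0.
move=> a2; exfalso; apply: nl.
have hh2 := small_holo S2; have hc := small_holo sc2.
apply: (affine_near hc (isconst_opp cc)).
by rewrite /affine (dd_shift c hh2) => z; rewrite a2 [RHS]a2.
Qed.

(** The rank hypothesis says that the triples [(x1, y1, s1)] and [(x2, y2, s2)] are independent. If
    [h1 - h2] is constant, the relation collapses to one exponential; were its exponent not affine,
    a combination of the triples with weights [e] and 1 would vanish. If exactly one exponent is not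
    affine, [relation_step] makes its own triple vanish. *)
Lemma relation_cases h1 h2 c x1 x2 y1 y2 s1 s2 : small h1 -> small h2 -> c != 0 ->
  (forall z, (x1 + y1 * D2 h1 z) * cexp (h1 z) + (x2 + y2 * D2 h2 z) * cexp (h2 z) +
     s1 * cexp (h1 (z + c)) + s2 * cexp (h2 (z + c)) = 0) ->
  (forall k1 k2, k1 * x1 + k2 * x2 = 0 -> k1 * y1 + k2 * y2 = 0 -> k1 * s1 + k2 * s2 = 0 ->
     k1 = 0 /\ k2 = 0) ->
  (affine h1 /\ affine h2) \/
  [/\ ~ isconst (fun z => h1 z - h2 z), ~ affine h1, ~ affine h2, y1 = 0 & y2 = 0].
Proof.
move=> S1 S2 c0 E rk.
have E' z : (x2 + y2 * D2 h2 z) * cexp (h2 z) + (x1 + y1 * D2 h1 z) * cexp (h1 z) +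
     s2 * cexp (h2 (z + c)) + s1 * cexp (h1 (z + c)) = 0.
  by rewrite -(E z) [X in X + _ + _]addrC -!addrA; congr (_ + (_ + _)); rewrite addrC.
have [p|np] := pselect (isconst (fun z => h1 z - h2 z)).
  left; have hh1 := small_holo S1; have hh2 := small_holo S2.
  suff a2 : affine h2 by split; [exact: affine_near hh2 p a2|exact: a2].
  apply: contrapT => nl.
  pose e := cexp (h1 0 - h2 0).
  have e1 z : cexp (h1 z) = e * cexp (h2 z) by rewrite /e -(p z) -cexpD subrK.
  have dh : dd h1 = dd h2.
    apply: dd_fun => w; have := hasdD (holo_hasd w hh2) (hasd_cst (h1 0 - h2 0) w).
    rewrite addr0 (_ : (fun z => h2 z + _) = h1)//.
    by apply/funext => z; rewrite -(p z) addrC subrK.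
  have DE z : D2 h1 z = D2 h2 z by rewrite /D2 dh.
  have nc := contra_not (affine_shift S2 c0) nl.
  have sX : small (fun z => (e * x1 + x2) + (e * y1 + y2) * D2 h2 z).
    by apply: smallD; [exact: small_cst|apply: smallZ; exact: small_D2].
  have sz := @small_cst R 0; have sc2 := small_shift c S2.
  have X0 := separate sX (small_cst (e * s1 + s2)) sz sz S2 sc2 sc2 sc2 nc nc nc.
  have Ee z : ((e * x1 + x2) + (e * y1 + y2) * D2 h2 z) * cexp (h2 z) +
      (e * s1 + s2) * cexp (h2 (z + c)) = 0.
    rewrite -(E z) !e1 DE.
    by move: (D2 h2 z) (cexp (h2 z)) (cexp (h2 (z + c))) => u v w; ring.
  move: X0 => /(_ _)/wrap[]; first by move=> z; rewrite !mul0r !addr0.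
  move=> X0.
  have Y : e * y1 + y2 = 0.
    apply: contrapT => /eqP y0; apply: nl.
    apply: (@affine_D2 _ _ (- (e * x1 + x2) / (e * y1 + y2)) S2) => z; apply: (mulIf y0); rewrite divfK//.
    by apply/eqP; rewrite -subr_eq0 -(X0 z); apply/eqP; ring.
  have X : e * x1 + x2 = 0 by have := X0 0; rewrite Y mul0r addr0.
  have S : e * s1 + s2 = 0.
    have := Ee 0; rewrite X0 mul0r add0r => /eqP; rewrite mulf_eq0 (negPf (cexp_neq0 _)) orbF.
    by move/eqP.
  have := rk e 1; rewrite !mul1r => /(_ X Y S)[_ /eqP]; by rewrite oner_eq0.
have np' := contra_not (@isconst_opp h2 h1) np.
have [a1|n1] := pselect (affine h1); have [a2|n2] := pselect (affine h2).
- by left; split; [exact: a1|exact: a2].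
- have [y0 /(_ a1)[x0 s0]] := relation_step S2 S1 c0 E' np' n2.
  have := rk 0 1; rewrite x0 y0 s0 !mul0r !mulr0 !addr0 => /(_ erefl erefl erefl)[_ /eqP].
  by rewrite oner_eq0.
- have [y0 /(_ a2)[x0 s0]] := relation_step S1 S2 c0 E np n1.
  have := rk 1 0; rewrite x0 y0 s0 !mul0r !mulr0 !addr0 => /(_ erefl erefl erefl)[/eqP].
  by rewrite oner_eq0.
- right; split; [exact: np|exact: n1|exact: n2| |].
  + exact: (relation_step S1 S2 c0 E np n1).1.
  + exact: (relation_step S2 S1 c0 E' np' n2).1.
Qed.

(** Without the congruence of [h2 (z + c)] with [h1], each of these two exponents is alone in its
    class, and [separate] applies to both. *)
Lemma cross_shift h1 h2 c x1 x2 s1 s2 : small h1 -> small h2 -> c != 0 ->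
  (forall z, x1 * cexp (h1 z) + x2 * cexp (h2 z) +
     s1 * cexp (h1 (z + c)) + s2 * cexp (h2 (z + c)) = 0) ->
  ~ isconst (fun z => h1 z - h2 z) -> ~ affine h1 -> ~ affine h2 ->
  ~ isconst (fun z => h2 (z + c) - h1 z) -> x1 = 0 /\ s2 = 0.
Proof.
move=> S1 S2 c0 E p n1 n2 n.
have np := contra_not (@isconst_opp h2 h1) p.
have sc1 := small_shift c S1; have sc2 := small_shift c S2.
have nc1 := contra_not (affine_shift S1 c0) n1.
have nc2 := contra_not (affine_shift S2 c0) n2.
have nc2' := contra_not (@isconst_opp _ _) nc2.
have n' := contra_not (@isconst_opp _ _) n.
have ncc : ~ isconst (fun z => h1 (z + c) - h2 (z + c)).
  move=> H; apply: p => z; have := H (z - c); rewrite subrK => ->.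
  by rewrite -(H (- c)) addNr.
split.
  exact: (separate (small_cst x1) (small_cst x2) (small_cst s1) (small_cst s2) S1 S2 sc1 sc2 np nc1 n E 0).
apply: (separate (small_cst s2) (small_cst x1) (small_cst x2) (small_cst s1) sc2 S1 S2 sc1 n' nc2' ncc _ 0) => z.
by rewrite -[RHS](E z) [RHS]addrC !addrA.
Qed.

End Relation.

(** * Difference equations *)

Section ShiftedPolynomials.
Variable F : numFieldType.
Implicit Types (p q r g : {poly F}) (c k z : F).

Lemma horner_inj p q : (forall z, p.[z] = q.[z]) -> p = q.
Proof.
move=> H; apply/eqP; rewrite -subr_eq0; apply/eqP.
apply: (@roots_geq_poly_eq0 _ _ [seq i%:R | i <- iota 0 (size (p - q))]).
- by apply/allP => x _; rewrite /root hornerD hornerN H subrr.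
- by rewrite map_inj_uniq ?iota_uniq// => i j /eqP; rewrite eqr_nat => /eqP.
- by rewrite size_map size_iota.
Qed.

Lemma size_deriv0 p : size p^`() = (size p).-1.
Proof.
have [p1|p1] := leqP (size p) 1.
  by rewrite (size1_polyC p1) derivC size_poly0 size_polyC; case: (_ != 0).
have p0 : p != 0 by rewrite -size_poly_gt0 (ltn_trans _ p1).
apply/eqP; rewrite eqn_leq; apply/andP; split.
  by have := lt_size_deriv p0; case: (size p) p1.
have : p^`()`_(size p).-2 != 0.
  rewrite coef_deriv prednK; last by case: (size p) p1 => [|[]].
  by rewrite -mulr_natr mulf_neq0 ?pnatr_eq0 -?lead_coefE ?lead_coef_eq0//; case: (size p) p1 => [|[]].
apply: contraNT; rewrite -ltnNge => h.
by rewrite nth_default//; case: (size p) p1 h => [|[]].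
Qed.

(** Induction through the derivative, which commutes with the difference operator and lowers the
    degree by one as well. *)
Lemma size_shift_sub p c : c != 0 -> size (p \Po ('X + c%:P) - p) = (size p).-1.
Proof.
move=> c0; have [n] := ubnP (size p); elim: n p => // n IH p.
have [p1|p1] := leqP (size p) 1.
  by rewrite (size1_polyC p1) comp_polyC subrr size_poly0 size_polyC; case: (_ != 0).
move=> pn; have dE : (p \Po ('X + c%:P) - p)^`() = p^`() \Po ('X + c%:P) - p^`().
  by rewrite derivB deriv_comp derivD derivX derivC addr0 mulr1.
have := size_deriv0 (p \Po ('X + c%:P) - p); rewrite dE IH ?size_deriv0; last first.
  by case: (size p) p1 pn.
have [p2|p2] := ltnP 2 (size p).
  case: (size p) p2 => [|[|[|m]]]//= _; by case: (size _) => [|m']//= ->.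
(* For degree one the derivative cannot tell a non-zero constant difference from 0, so the
   difference is computed. *)
have s2 : size p = 2%N by apply/eqP; rewrite eqn_leq p1 p2.
move=> _; have -> : p = p`_1 *: 'X + (p`_0)%:P.
  apply/polyP => -[|[|i]]; rewrite coefD poly.coefZ coefX coefC ?mulr0 ?mulr1 ?add0r ?addr0//.
  by rewrite nth_default// s2.
have l0 : p`_1 != 0 by have := lead_coef_eq0 p; rewrite lead_coefE s2 /= => ->; rewrite -size_poly_eq0 s2.
have s1 : size (p`_1 *: 'X + (p`_0)%:P) = 2%N.
  rewrite size_polyDl; first by rewrite size_scale// size_polyX.
  by rewrite size_scale// size_polyX (leq_ltn_trans (size_polyC_leq1 _)).
rewrite s1 comp_polyD comp_polyZ comp_polyX comp_polyC scalerDr.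
rewrite (_ : _ - _ = (p`_1 * c)%:P); first by rewrite size_polyC mulf_neq0.
by rewrite -!mul_polyC polyCM; ring.
Qed.

(** [r / 2] solves the equation up to half the difference [r(z + c) - r(z)], which has lower degree
    and is corrected by induction; the leading term, hence the size, is that of [r / 2]. *)
Lemma shift_add_surj c r : exists2 q : {poly F},
  size q = size r & forall z, q.[z + c] + q.[z] = r.[z].
Proof.
have h20 : 2 != 0 :> F by rewrite pnatr_eq0.
have [->|c0] := eqVneq c 0.
  exists (2^-1 *: r); first by rewrite size_scale// invr_eq0.
  by move=> z; rewrite addr0 !hornerZ; field.
have [n] := ubnP (size r); elim: n r => // n IH r rn.
have [->|r0] := eqVneq r 0; first by exists 0 => // z; rewrite !horner0 addr0.
pose d := (- 2^-1) *: (r \Po ('X + c%:P) - r).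
have sd : (size d < size r)%N.
  by rewrite size_scale ?oppr_eq0 ?invr_eq0// size_shift_sub// prednK ?size_poly_gt0.
have [|q sq Hq] := IH d; first by rewrite (leq_trans sd).
exists (2^-1 *: r + q).
  by rewrite size_polyDl size_scale ?invr_eq0// sq.
move=> z; have := Hq z; rewrite !hornerD !hornerZ hornerD hornerN horner_comp !hornerE => h.
rewrite [LHS](_ : _ = 2^-1 * r.[z + c] + 2^-1 * r.[z] + (q.[z + c] + q.[z])); last by rewrite addrACA addrA.
by rewrite h; field.
Qed.

End ShiftedPolynomials.

(** * Exponents exchanged by the shift *)

Section CrossShift.
Variable R : realType.
Local Notation C := R[i].
Implicit Types (h : C -> C) (z c k : C) (g p : {poly C}).
Local Notation isconst := (@isconst R).

Lemma antiperiodic0 h c : small h -> c != 0 -> (forall z, h (z + c) = - h z) -> forall z, h z = 0.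
Proof.
move=> sh c0 H; have c2 : c + c != 0 by rewrite -mulr2n mulrn_eq0.
have hk z : h z = h 0.
  apply: (small_periodic sh c2) => w; by rewrite addrA !H opprK.
have h00 : h 0 = - h 0 by rewrite -(H 0); apply/esym.
move=> z; rewrite hk; apply/eqP; have := h00; move: (h 0) => x /eqP.
by rewrite -addr_eq0 -mulr2n mulrn_eq0.
Qed.

(** With [h1 = g + p] and [h2 = g - p], the hypothesis reads
    [p(z + c) + p(z) = k - (g(z + c) - g(z))]. A polynomial solution exists, and [p] differs from it
    by an antiperiodic function of exponential type zero, which is 0. If [g] had degree at most one,
    the right-hand side and hence [p] would be constant, against the last but one hypothesis. *)
Lemma cross_poly g h1 h2 c k : small h1 -> small h2 -> c != 0 ->
  (forall z, h1 z + h2 z = 2 * g.[z]) -> ~ isconst (fun z => h1 z - h2 z) ->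
  (forall z, h1 (z + c) - h2 z = k) ->
  exists p, [/\ (1 < (size g).-1)%N, (size p).-1 = ((size g).-1 - 1)%N
    & forall z, h1 z = g.[z] + p.[z]].
Proof.
move=> s1 s2 c0 hg nc hk.
pose r := k%:P - (g \Po ('X + c%:P) - g).
have [q sq Hq] := shift_add_surj c r.
have rE z : r.[z] = k - (g.[z + c] - g.[z]).
  by rewrite /r !hornerD !hornerN !hornerC hornerD hornerN horner_comp !hornerE.
have s : small (fun z => h1 z - g.[z] - q.[z]).
  by apply: smallB (small_poly q); apply: smallB (small_poly g).
have E z : h1 z = g.[z] + q.[z].
  have H := antiperiodic0 s c0.
  have : h1 z - g.[z] - q.[z] = 0.
    apply: H => w.
    have e1 := hg w; have e2 := hk w; have e3 := Hq w; rewrite rE in e3.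
    have -> : h1 (w + c) = k + h2 w by rewrite -e2 subrK.
    have -> : h2 w = 2 * g.[w] - h1 w by rewrite -e1 addrAC subrr add0r.
    have -> : q.[w + c] = k - (g.[w + c] - g.[w]) - q.[w] by rewrite -e3 addrK.
    ring.
  by move/eqP; rewrite -addrA -opprD subr_eq0 => /eqP.
have g2 : (1 < (size g).-1)%N.
  rewrite ltnNge; apply/negP => g1; apply: nc.
  have sr : (size r <= 1)%N.
    rewrite /r (leq_trans (size_polyD _ _))// geq_max size_polyC_leq1 size_polyN size_shift_sub//.
  move=> z; have h2E w : h2 w = 2 * g.[w] - h1 w by rewrite -hg addrAC subrr add0r.
  rewrite !h2E !E; have -> : q = (q`_0)%:P by apply: size1_polyC; rewrite sq.
  by rewrite !hornerC; ring.
exists q; split=> //; rewrite sq /r addrC size_polyDl size_polyN size_shift_sub ?subn1//.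
by rewrite (leq_ltn_trans (size_polyC_leq1 _)).
Qed.

End CrossShift.

(** * Elimination of the unknown function *)

Section Elimination.
Variable R : realType.
Local Notation C := R[i].
Local Notation cexp := (@cexp R).
Local Notation isconst := (@isconst R).
Implicit Types (h : C -> C) (z k x y : C).

Lemma det2_eq0 (k1 k2 p1 p2 q1 q2 : C) : p1 * q2 - p2 * q1 != 0 ->
  k1 * p1 + k2 * p2 = 0 -> k1 * q1 + k2 * q2 = 0 -> k1 = 0 /\ k2 = 0.
Proof.
move=> d0 H1 H2; split; apply: (mulIf d0); rewrite mul0r.
  by rewrite -[RHS](_ : (k1 * p1 + k2 * p2) * q2 - (k1 * q1 + k2 * q2) * p2 = 0); [ring|rewrite H1 H2; ring].
by rewrite -[RHS](_ : (k1 * q1 + k2 * q2) * p1 - (k1 * p1 + k2 * p2) * q1 = 0); [ring|rewrite H1 H2; ring].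
Qed.

Lemma dd2_comb k l (f g : C -> C) : holo f -> holo g ->
  dd (dd (fun z => k * f z + l * g z)) = fun z => k * dd (dd f) z + l * dd (dd g) z.
Proof.
move=> hf hg; have one (f' g' : C -> C) : holo f' -> holo g' ->
    dd (fun z => k * f' z + l * g' z) = fun z => k * dd f' z + l * dd g' z.
  by move=> hf' hg'; apply: dd_fun => z; apply: hasdD; apply: hasdZ; exact: holo_hasd.
by rewrite (one f g hf hg) (one _ _ (holo_dd hf) (holo_dd hg)).
Qed.

Lemma dd2_shift (f : C -> C) (c : C) : holo f -> dd (dd (fun z => f (z + c))) = fun z => dd (dd f) (z + c).
Proof.
move=> hf; apply: dd_fun => z; have := @hasd_shift R (dd f) c z _ (holo_hasd (z + c) (holo_dd hf)).
by rewrite (dd_shift c hf).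
Qed.

Variables (a0 a1 a2 b0 b1 b2 c w1 w2 : C) (F h1 h2 : C -> C).
Local Notation A1 := (a0 * b1 - a1 * b0).
Local Notation A2 := (a1 * b2 - a2 * b1).
Local Notation A3 := (a0 * b2 - a2 * b0).
Hypotheses (hF : holo F) (S1 : small h1) (S2 : small h2) (c0 : c != 0) (w12 : w2 - w1 != 0).
Hypothesis E1 : forall z, a0 * F z + a1 * dd (dd F) z + a2 * F (z + c) = w2 * cexp (h1 z) - w1 * cexp (h2 z).
Hypothesis E2 : forall z, b0 * F z + b1 * dd (dd F) z + b2 * F (z + c) = cexp (h1 z) - cexp (h2 z).

(** Cramer's rule in its three forms: [elim_shift], [elim_dd] and [elim_id] get rid of [F (z + c)],
    [F''] and [F] respectively. *)
Lemma elim_shift z : A3 * F z + A2 * dd (dd F) z =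
  (b2 * w2 - a2) * cexp (h1 z) + (a2 - b2 * w1) * cexp (h2 z).
Proof.
have := E1 z; have := E2 z; move: (F z) (dd (dd F) z) (F (z + c)) (cexp (h1 z)) (cexp (h2 z)) => x y t e e' H2 H1.
transitivity (b2 * (a0 * x + a1 * y + a2 * t) - a2 * (b0 * x + b1 * y + b2 * t)); first by ring.
by rewrite H1 H2; ring.
Qed.

Lemma elim_dd z : A1 * F z - A2 * F (z + c) =
  (b1 * w2 - a1) * cexp (h1 z) + (a1 - b1 * w1) * cexp (h2 z).
Proof.
have := E1 z; have := E2 z; move: (F z) (dd (dd F) z) (F (z + c)) (cexp (h1 z)) (cexp (h2 z)) => x y t e e' H2 H1.
transitivity (b1 * (a0 * x + a1 * y + a2 * t) - a1 * (b0 * x + b1 * y + b2 * t)); first by ring.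
by rewrite H1 H2; ring.
Qed.

Lemma elim_id z : - A1 * dd (dd F) z - A3 * F (z + c) =
  (b0 * w2 - a0) * cexp (h1 z) + (a0 - b0 * w1) * cexp (h2 z).
Proof.
have := E1 z; have := E2 z; move: (F z) (dd (dd F) z) (F (z + c)) (cexp (h1 z)) (cexp (h2 z)) => x y t e e' H2 H1.
transitivity (b0 * (a0 * x + a1 * y + a2 * t) - a0 * (b0 * x + b1 * y + b2 * t)); first by ring.
by rewrite H1 H2; ring.
Qed.

Let dd2_exps k l : dd (dd (fun z => k * cexp (h1 z) + l * cexp (h2 z))) =
  fun z => k * (D2 h1 z * cexp (h1 z)) + l * (D2 h2 z * cexp (h2 z)).
Proof.
have hh1 := small_holo S1; have hh2 := small_holo S2.
apply: etrans (dd2_comb k l (holo_cexp_comp hh1) (holo_cexp_comp hh2)) _; apply/funext => z.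
exact: (f_equal2 (fun x y => k * x + l * y) (congr1 (fun f => f z) (dd2_cexp hh1))
  (congr1 (fun f => f z) (dd2_cexp hh2))).
Qed.

(** These identities turn a non-zero minor of the coefficient matrix into the independence of the
    right-hand sides of the eliminated equations, which [relation_cases] asks for. *)
Let det32 : (b2 * w2 - a2) * (a0 - b0 * w1) - (a2 - b2 * w1) * (b0 * w2 - a0) = (w2 - w1) * A3.
Proof. ring. Qed.

Let det21 : (b2 * w2 - a2) * (a1 - b1 * w1) - (a2 - b2 * w1) * (b1 * w2 - a1) = (w2 - w1) * A2.
Proof. ring. Qed.

Let det13 : (b1 * w2 - a1) * (a0 - b0 * w1) - (a1 - b1 * w1) * (b0 * w2 - a0) = (w2 - w1) * A1.
Proof. ring. Qed.

(** All values of [F] cancel in [A1] times [elim_shift] at [z], minus [A3] times [elim_dd], minus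
    [A2] times its second derivative [V2], minus [A2] times [elim_shift] at [z + c]. The non-affine
    alternative would annihilate both coefficients of [elim_dd], contrary to [det21]. *)
Lemma exponents_A2 : A2 != 0 -> affine h1 /\ affine h2.
Proof.
move=> A20.
have V2 z : A1 * dd (dd F) z + - A2 * dd (dd F) (z + c) =
    (b1 * w2 - a1) * (D2 h1 z * cexp (h1 z)) + (a1 - b1 * w1) * (D2 h2 z * cexp (h2 z)).
  have hFc : holo (fun z => F (z + c)) by exact: holo_shift.
  apply: etrans (esym (f_equal (fun x => A1 * dd (dd F) z + - A2 * x) (congr1 (fun f => f z) (dd2_shift c hF)))) _.
  apply: etrans (esym (congr1 (fun f => f z) (dd2_comb A1 (- A2) hF hFc))) _.
  apply: etrans (congr1 (fun f => f z) (dd2_exps (b1 * w2 - a1) (a1 - b1 * w1))).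
  by congr (dd (dd _) z); apply/funext => v; rewrite mulNr elim_dd.
have := @relation_cases R h1 h2 c
   (A1 * (b2 * w2 - a2) - A3 * (b1 * w2 - a1)) (A1 * (a2 - b2 * w1) - A3 * (a1 - b1 * w1))
   (- A2 * (b1 * w2 - a1)) (- A2 * (a1 - b1 * w1))
   (- A2 * (b2 * w2 - a2)) (- A2 * (a2 - b2 * w1)) S1 S2 c0.
have NA : - A2 != 0 by rewrite oppr_eq0.
have dA : (w2 - w1) * A2 != 0 by rewrite mulf_neq0.
case.
- move=> z; have := elim_shift z; have := elim_shift (z + c); have := elim_dd z; have := V2 z.
  move: (F z) (F (z + c)) (dd (dd F) z) (dd (dd F) (z + c)) (D2 h1 z) (D2 h2 z) (cexp (h1 z)) (cexp (h2 z))
  (cexp (h1 (z + c))) (cexp (h2 (z + c))).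
  move=> f fc f2 f2c d1 d2 e1 e2 e1c e2c H1 H2 H3 H4.
  transitivity (A1 * ((b2 * w2 - a2) * e1 + (a2 - b2 * w1) * e2)
    - A3 * ((b1 * w2 - a1) * e1 + (a1 - b1 * w1) * e2)
    - A2 * ((b1 * w2 - a1) * (d1 * e1) + (a1 - b1 * w1) * (d2 * e2))
    - A2 * ((b2 * w2 - a2) * e1c + (a2 - b2 * w1) * e2c)); first by ring.
  by rewrite -H1 -H2 -H3 -H4; ring.
- move=> k1 k2 _ Hy Hs; apply: (det2_eq0 (p1 := b2 * w2 - a2) (p2 := a2 - b2 * w1)
    (q1 := b1 * w2 - a1) (q2 := a1 - b1 * w1)); first by rewrite det21.
    by apply: (mulfI NA); rewrite mulr0 -[RHS]Hs; ring.
  by apply: (mulfI NA); rewrite mulr0 -[RHS]Hy; ring.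
- by [].
case=> _ _ _ /eqP + /eqP; rewrite !mulf_eq0 (negPf NA) /= => /eqP v1 /eqP v2.
by move: dA; rewrite -det21 v1 v2 !mulr0 subrr eqxx.
Qed.

(** [elim_dd] now expresses [A1 F] and [elim_id] expresses [- A1 F'']; the second derivative of the
    former added to the latter is a relation free of shifts. *)
Lemma exponents_A1 : A2 = 0 -> A3 = 0 -> A1 != 0 -> affine h1 /\ affine h2.
Proof.
move=> A20 A30 A10.
have dA : (w2 - w1) * A1 != 0 by rewrite mulf_neq0.
have V2 z : A1 * dd (dd F) z =
    (b1 * w2 - a1) * (D2 h1 z * cexp (h1 z)) + (a1 - b1 * w1) * (D2 h2 z * cexp (h2 z)).
  have := congr1 (fun f => f z) (dd2_comb A1 0 hF hF); rewrite /= mul0r addr0 => <-.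
  have := congr1 (fun f => f z) (dd2_exps (b1 * w2 - a1) (a1 - b1 * w1)) => <-.
  by congr (dd (dd _) z); apply/funext => v; rewrite -elim_dd A20 !mul0r subr0 addr0.
have := @relation_cases R h1 h2 c (b0 * w2 - a0) (a0 - b0 * w1)
   (b1 * w2 - a1) (a1 - b1 * w1) 0 0 S1 S2 c0.
case.
- move=> z; have := elim_id z; have := V2 z; rewrite A30.
  move: (F z) (F (z + c)) (dd (dd F) z) (dd (dd F) (z + c)) (D2 h1 z) (D2 h2 z) (cexp (h1 z)) (cexp (h2 z))
  (cexp (h1 (z + c))) (cexp (h2 (z + c))).
  move=> f fc f2 f2c d1 d2 e1 e2 e1c e2c H1 H2.
  transitivity ((b1 * w2 - a1) * (d1 * e1) + (a1 - b1 * w1) * (d2 * e2)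
    + ((b0 * w2 - a0) * e1 + (a0 - b0 * w1) * e2)); first by ring.
  by rewrite -H1 -H2; ring.
- move=> k1 k2 Hx Hy _; apply: (det2_eq0 (p1 := b1 * w2 - a1) (p2 := a1 - b1 * w1)
    (q1 := b0 * w2 - a0) (q2 := a0 - b0 * w1)) => //; by rewrite det13.
- by [].
case=> _ _ _ v1 v2; by move: dA; rewrite -det13 v1 v2 !mul0r subrr eqxx.
Qed.

Let A3F2 : A2 = 0 -> forall z, A3 * dd (dd F) z =
    (b2 * w2 - a2) * (D2 h1 z * cexp (h1 z)) + (a2 - b2 * w1) * (D2 h2 z * cexp (h2 z)).
Proof.
move=> A20 z; have := congr1 (fun f => f z) (dd2_comb A3 0 hF hF); rewrite /= mul0r addr0 => <-.
have := congr1 (fun f => f z) (dd2_exps (b2 * w2 - a2) (a2 - b2 * w1)) => <-.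
by congr (dd (dd _) z); apply/funext => v; rewrite -elim_shift A20 !mul0r !addr0.
Qed.

(** When [A2 = 0], [elim_shift] expresses [A3 F] by exponentials; its second derivative and its
    shift are substituted into [elim_id]. *)
Let rel_A3 : A2 = 0 -> forall z,
  (A3 * (b0 * w2 - a0) + A1 * (b2 * w2 - a2) * D2 h1 z) * cexp (h1 z) +
  (A3 * (a0 - b0 * w1) + A1 * (a2 - b2 * w1) * D2 h2 z) * cexp (h2 z) +
  A3 * (b2 * w2 - a2) * cexp (h1 (z + c)) + A3 * (a2 - b2 * w1) * cexp (h2 (z + c)) = 0.
Proof.
move=> A20 z; have := elim_id z; have := elim_shift (z + c); have := A3F2 A20 z; rewrite A20.
move: (F z) (F (z + c)) (dd (dd F) z) (dd (dd F) (z + c)) (D2 h1 z) (D2 h2 z) (cexp (h1 z)) (cexp (h2 z))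
  (cexp (h1 (z + c))) (cexp (h2 (z + c))).
move=> f fc f2 f2c d1 d2 e1 e2 e1c e2c H1 H2 H3.
transitivity (A1 * ((b2 * w2 - a2) * (d1 * e1) + (a2 - b2 * w1) * (d2 * e2))
  + A3 * ((b2 * w2 - a2) * e1c + (a2 - b2 * w1) * e2c)
  + A3 * ((b0 * w2 - a0) * e1 + (a0 - b0 * w1) * e2)); first by ring.
by rewrite -H1 -H2 -H3; ring.
Qed.

(** In the non-affine alternative [A1] annihilates both coefficients of [elim_shift], which by
    [det32] are not both 0. *)
Lemma exponents_A3 : A2 = 0 -> A3 != 0 -> (affine h1 /\ affine h2) \/
  [/\ A1 = 0, ~ isconst (fun z => h1 z - h2 z), ~ affine h1 & ~ affine h2].
Proof.
move=> A20 A30.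
have dA : (w2 - w1) * A3 != 0 by rewrite mulf_neq0.
case: (relation_cases S1 S2 c0 (rel_A3 A20)).
- move=> k1 k2 Hx _ Hs; apply: (det2_eq0 (p1 := b2 * w2 - a2) (p2 := a2 - b2 * w1)
    (q1 := b0 * w2 - a0) (q2 := a0 - b0 * w1)); first by rewrite det32.
    by apply: (mulfI A30); rewrite mulr0 -[RHS]Hs; ring.
  by apply: (mulfI A30); rewrite mulr0 -[RHS]Hx; ring.
- by left.
case=> nc n1 n2 y1 y2; right; split; [|exact: nc|exact: n1|exact: n2].
apply/eqP; apply: contraNT dA => A10.
move/eqP: y1; move/eqP: y2; rewrite !mulf_eq0 (negPf A10) /= => /eqP v2 /eqP v1.
by rewrite -mulf_eq0 -det32 v1 v2 !mul0r subrr.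
Qed.

(** Exactly one of the congruences of [h2 (z + c)] with [h1] and of [h1 (z + c)] with [h2] holds. If
    neither did, [cross_shift] would annihilate both coefficients of [F], against [det32]; both
    together would make [h1 - h2] constant. The one that holds yields the polynomial by
    [cross_poly], and the failure of the other removes one exponential from [F]. *)
Lemma nonaffine_form (g : {poly C}) : A2 = 0 -> A1 = 0 -> A3 != 0 ->
  (forall z, h1 z + h2 z = 2 * g.[z]) ->
  ~ isconst (fun z => h1 z - h2 z) -> ~ affine h1 -> ~ affine h2 ->
  (1 < (size g).-1)%N /\ exists p : {poly C}, (size p).-1 = ((size g).-1 - 1)%N /\
   ((forall z, A3 * F z = (a2 - b2 * w1) * cexp (g.[z] - p.[z])) \/
    (forall z, A3 * F z = (b2 * w2 - a2) * cexp (g.[z] + p.[z]))).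
Proof.
move=> A20 A10 A30 hg nc n1 n2.
have nc' := contra_not (@isconst_opp _ h2 h1) nc.
have dA : (w2 - w1) * A3 != 0 by rewrite mulf_neq0.
have FE z : A3 * F z = (b2 * w2 - a2) * cexp (h1 z) + (a2 - b2 * w1) * cexp (h2 z).
  by rewrite -elim_shift A20 mul0r addr0.
have rel z : A3 * (b0 * w2 - a0) * cexp (h1 z) + A3 * (a0 - b0 * w1) * cexp (h2 z) +
  A3 * (b2 * w2 - a2) * cexp (h1 (z + c)) + A3 * (a2 - b2 * w1) * cexp (h2 (z + c)) = 0.
  by rewrite -[RHS](rel_A3 A20 z) A10 !mul0r !addr0.
have rel' z : A3 * (a0 - b0 * w1) * cexp (h2 z) + A3 * (b0 * w2 - a0) * cexp (h1 z) +
  A3 * (a2 - b2 * w1) * cexp (h2 (z + c)) + A3 * (b2 * w2 - a2) * cexp (h1 (z + c)) = 0.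
  rewrite -[RHS](rel z) [X in X + _ + _]addrC -!addrA; congr (_ + (_ + _)); exact: addrC.
have A3K k : A3 * k = 0 -> k = 0 by move/eqP; rewrite mulf_eq0 (negPf A30) => /eqP.
have [cc|ncc] := pselect (isconst (fun z => h2 (z + c) - h1 z)).
  have ncc : ~ isconst (fun z => h1 (z + c) - h2 z).
    move=> cc'; apply: nc.
    pose k := h1 (0 + c) - h2 0; pose k' := h2 (0 + c) - h1 0.
    (* Both congruences give [d(z + c) = (k - k') - d(z)] for [d = h1 - h2], so that
       [d - (k - k') / 2] is antiperiodic. *)
    have sd : small (fun z => h1 z - h2 z - (k - k') / 2).
      by apply: (smallB (smallB S1 S2)); exact: small_cst.
    have H := antiperiodic0 sd c0.
    apply: (@isconst_eq _ _ ((k - k') / 2)) => z; apply/eqP; rewrite -subr_eq0; apply/eqP; apply: H => v.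
    have e1 : h1 (v + c) = k + h2 v by rewrite /k -(cc' v) subrK.
    have e2 : h2 (v + c) = k' + h1 v by rewrite /k' -(cc v) subrK.
    by rewrite e1 e2; field.
  have [/A3K x2 /A3K u1] := cross_shift S2 S1 c0 rel' nc' n2 n1 ncc.
  have hg' z : h2 z + h1 z = 2 * g.[z] by rewrite addrC hg.
  have [p [g2 sp hp]] := cross_poly S2 S1 c0 hg' nc' cc.
  split; first exact: g2.
  exists (- p); split; first by rewrite size_polyN.
  by left=> z; rewrite FE u1 mul0r add0r hp hornerN opprK.
have [/A3K x1 /A3K u2] := cross_shift S1 S2 c0 rel nc n1 n2 ncc.
have [cc|ncc'] := pselect (isconst (fun z => h1 (z + c) - h2 z)).
  have [p [g2 sp hp]] := cross_poly S1 S2 c0 hg nc cc.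
  split; first exact: g2.
  exists p; split; first exact: sp.
  by right=> z; rewrite FE u2 mul0r addr0 hp.
have [/A3K x2 /A3K u1] := cross_shift S2 S1 c0 rel' nc' n2 n1 ncc'.
by move: dA; rewrite -det32 u1 u2 !mul0r subrr eqxx.
Qed.

End Elimination.

(** * Explicit solutions *)

Section SecondOrder.
Variable R : realType.
Local Notation C := R[i].
Local Notation cexp := (@cexp R).
Local Notation isconst := (@isconst R).
Implicit Types (f g F G h : C -> C) (z k x y m : C).

(** The first derivative stays existential: the equations to be solved only relate a function to its
    second derivative. *)
Definition hasd2 f f2 := exists f1, (forall z, hasd f z (f1 z)) /\ (forall z, hasd f1 z (f2 z)).

Lemma hasd2_dd f : holo f -> hasd2 f (dd (dd f)).
Proof. by move=> hf; exists (dd f); split=> z; apply: holo_hasd => //; exact: holo_dd. Qed.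

Lemma hasd2_eq f g2 f2 : hasd2 f f2 -> (forall z, f2 z = g2 z) -> hasd2 f g2.
Proof. by move=> [f1 [H1 H2]] E; exists f1; split=> // z; rewrite -E. Qed.

Lemma hasd2_comb k x f f2 g g2 : hasd2 f f2 -> hasd2 g g2 ->
  hasd2 (fun z => k * f z + x * g z) (fun z => k * f2 z + x * g2 z).
Proof.
move=> [f1 [Hf Hf1]] [g1 [Hg Hg1]]; exists (fun z => k * f1 z + x * g1 z).
by split=> z; apply: hasdD; apply: hasdZ.
Qed.

Lemma hasd_exp k z : hasd (fun z => cexp (k * z)) z (k * cexp (k * z)).
Proof. by have := hasd_cexp_comp (hasd_lin k z); move/hasd_eq; apply; exact: mulrC. Qed.

Lemma hasd2_exp k : hasd2 (fun z => cexp (k * z)) (fun z => k ^+ 2 * cexp (k * z)).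
Proof.
exists (fun z => k * cexp (k * z)); split=> z; first exact: hasd_exp.
by have := hasdZ k (hasd_exp k z); move/hasd_eq; apply; rewrite mulrA.
Qed.

Lemma hasd2_idexp k : hasd2 (fun z => z * cexp (k * z)) (fun z => (2 * k + k ^+ 2 * z) * cexp (k * z)).
Proof.
exists (fun z => z * (k * cexp (k * z)) + cexp (k * z) * 1); split=> z.
  exact: hasdM (hasd_id z) (hasd_exp k z).
have := hasdD (hasdM (hasd_id z) (hasdZ k (hasd_exp k z))) (hasdM (hasd_exp k z) (hasd_cst 1 z)).
by move/hasd_eq; apply; move: (cexp _) => e; ring.
Qed.

Lemma hasd2_sqr : hasd2 (fun z => z ^+ 2) (fun=> 2).
Proof.
exists (fun z => 2 * z); split=> z; last by have := hasdZ 2 (hasd_id z); move/hasd_eq; apply; rewrite mulr1.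
by have := hasdM (hasd_id z) (hasd_id z); move/hasd_eq; apply; ring.
Qed.

Lemma hasd2_0 F : hasd2 F (fun=> 0) -> exists C3 C4, forall z, F z = C3 * z + C4.
Proof.
move=> [F1 [H H1]]; have hF := hasd_holo' H; have hF1 := hasd_holo' H1.
have F1c := dd0_const hF1 (fun z => hasd_dd (H1 z)).
exists (dd F 0), (F 0); apply: (affineE hF) => z.
by rewrite (dd_fun H) F1c.
Qed.

(* The first-order factors of [F'' = mu ^ 2 F]. *)
Lemma hasd2_harmonic mu F : mu != 0 -> hasd2 F (fun z => mu ^+ 2 * F z) ->
  exists C1 C2, forall z, F z = C1 * cexp (mu * z) + C2 * cexp (- mu * z).
Proof.
move=> mu0 [F1 [H H1]].
have cst k z : k ^+ 2 = mu ^+ 2 -> (F1 z + k * F z) * cexp (- k * z) = F1 0 + k * F 0.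
  move=> k2; have D w : hasd (fun z => (F1 z + k * F z) * cexp (- k * z)) w 0.
    have := hasdM (hasdD (H1 w) (hasdZ k (H w))) (hasd_exp (- k) w).
    by move/hasd_eq; apply; rewrite -k2; move: (cexp _) => e; ring.
  by rewrite (dd0_const (hasd_holo' D) (fun z => hasd_dd (D z))) mulr0 cexp0 mulr1.
have m20 : 2 * mu != 0 by rewrite mulf_neq0// pnatr_eq0.
exists ((F1 0 + mu * F 0) / (2 * mu)), (- (F1 0 - mu * F 0) / (2 * mu)) => z.
have e1 := cst mu z erefl; have := cst (- mu) z (sqrrN mu).
rewrite opprK mulNr => e2.
have E : cexp (mu * z) * cexp (- mu * z) = 1 by rewrite -cexpD mulNr addrN cexp0.
move: e1 e2 E; rewrite mulNr; move: (cexp (mu * z)) (cexp (- (mu * z))) => e e' e1 e2 E.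
have f1 : F1 z + mu * F z = (F1 0 + mu * F 0) * e by rewrite -e1 -mulrA [e' * e]mulrC E mulr1.
have f2 : F1 z - mu * F z = (F1 0 - mu * F 0) * e'.
  by rewrite -[in RHS](mulNr mu (F 0)) -e2 -mulrA E mulr1.
transitivity (((F1 z + mu * F z) - (F1 z - mu * F z)) / (2 * mu)); first by field.
by rewrite f1 f2; field.
Qed.

Lemma solve_dd f G G2 k : holo f -> k != 0 -> hasd2 G G2 -> (forall z, k * dd (dd f) z = G2 z) ->
  exists C3 C4, forall z, f z = k^-1 * (G z + C3 * z + C4).
Proof.
move=> hf k0 H E.
have := hasd2_comb k (- 1) (hasd2_dd hf) H.
move=> /hasd2_eq/(_ (fun z => _ : _ = 0))/hasd2_0; case.
  by move=> z; rewrite E mulN1r subrr.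
move=> C3 [C4 HC]; exists C3, C4 => z.
by rewrite -addrA -HC mulN1r addrCA subrr addr0 mulKf.
Qed.

(** [f] minus the particular solutions [G1] and [G2] solves the homogeneous equation, which
    [hasd2_harmonic] integrates. *)
Lemma solve_forced f G1 G1' G2 G2' (T1 T2 : C -> C) a b mu : holo f -> a != 0 -> b != 0 ->
  mu ^+ 2 = - (b / a) -> hasd2 G1 G1' -> hasd2 G2 G2' ->
  (forall z, b * f z + a * dd (dd f) z = T1 z + T2 z) ->
  (forall z, b * G1 z + a * G1' z = T1 z) -> (forall z, b * G2 z + a * G2' z = T2 z) ->
  exists C1 C2, forall z, f z = C1 * cexp (mu * z) + C2 * cexp (- mu * z) + (G1 z + G2 z).
Proof.
move=> hf a0 b0 hmu H1 H2 E E1 E2.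
have mu0 : mu != 0.
  by rewrite -sqrf_eq0 hmu oppr_eq0 mulf_neq0// invr_eq0.
have H := hasd2_comb 1 (-1) (hasd2_dd hf) (hasd2_comb 1 1 H1 H2).
have [|C1 [C2 HC]] := hasd2_harmonic mu0 (hasd2_eq H _ (g2 :=
    fun z => mu ^+ 2 * (1 * f z + -1 * (1 * G1 z + 1 * G2 z)))).
  move=> z.
  apply: (mulfI a0); have e := E z; have e1 := E1 z; have e2 := E2 z.
  have -> : a * (mu ^+ 2 * (1 * f z + -1 * (1 * G1 z + 1 * G2 z))) = - b * (f z - G1 z - G2 z).
    by rewrite hmu; field.
  move: e; rewrite -e1 -e2; move: (dd (dd f) z) (f z) (G1 z) (G2 z) (G1' z) (G2' z) => f2 x g1 g2 g1' g2' e.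
  transitivity (b * x + a * f2 - b * x - a * (g1' + g2')); first by ring.
  by rewrite e; ring.
exists C1, C2 => z; by rewrite -HC; ring.
Qed.

(** [A] and [B] are the half differences of the coefficients of [h1] and [h2]; the half sums are the
    coefficients of [g], so [alpha] is non-zero because [g] is not constant. *)
Lemma affine_exponents (g : {poly C}) h1 h2 : (1 < size g)%N -> holo h1 -> holo h2 ->
  affine h1 -> affine h2 -> (forall z, h1 z + h2 z = 2 * g.[z]) ->
  exists alpha beta A B, [/\ alpha != 0, g = alpha *: 'X + beta%:P,
    forall z, h1 z = (alpha + A) * z + (beta + B) & forall z, h2 z = (alpha - A) * z + (beta - B)].
Proof.
move=> sg hh1 hh2 l1 l2 hg.
have := affineE hh1 l1; have := affineE hh2 l2.
move: (dd h1 0) (h1 0) (dd h2 0) (h2 0) => k1 m1 k2 m2 H2 H1.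
have two : 2 != 0 :> C by rewrite pnatr_eq0.
have gE : g = ((k1 + k2) / 2) *: 'X + ((m1 + m2) / 2)%:P.
  apply: horner_inj => z; apply: (mulfI two); rewrite -hg H1 H2 hornerD hornerZ hornerX hornerC.
  by field.
exists ((k1 + k2) / 2), ((m1 + m2) / 2), ((k1 - k2) / 2), ((m1 - m2) / 2); split=> //.
- apply/eqP => a0; move: sg; rewrite gE a0 scale0r add0r.
  by rewrite ltnNge size_polyC_leq1.
- by move=> z; rewrite H1; field.
- by move=> z; rewrite H2; field.
Qed.

End SecondOrder.

(** * Minors, exponents and closed forms *)

Section Solutions.
Variable R : realType.
Local Notation C := R[i].
Local Notation nm := (@Normc.normc R).
Local Notation cexp := (@cexp R).
Implicit Types (f h : C -> C) (z k : C).

Lemma LopE (a0 a1 a2 c : C) f z : Lop a0 a1 a2 c f z = a0 * f z + a1 * dd (dd f) z + a2 * f (z + c).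
Proof. by []. Qed.

Lemma dd2Z k f : holo f -> dd (dd (fun z => k * f z)) = fun z => k * dd (dd f) z.
Proof.
by move=> hf; apply: dd_fun => z; rewrite (ddZ k hf); apply: hasdZ; exact/holo_hasd/holo_dd.
Qed.

Lemma LopZ (a0 a1 a2 c k : C) f z : holo f -> let F z := k * f z in
  a0 * F z + a1 * dd (dd F) z + a2 * F (z + c) = k * Lop a0 a1 a2 c f z.
Proof.
move=> hf F; have e : dd (dd F) z = k * dd (dd f) z := congr1 (fun G => G z) (dd2Z k hf).
rewrite e LopE /F {e F}.
by move: (f z) (dd (dd f) z) (f (z + c)) => x y t; ring.
Qed.

(** If the third minor vanished too, each column [(a_j, b_j)] would give a null combination of the
    rows with weights [- b_j] and [a_j]. Independence of the rows then makes every [a_j] zero, so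
    that the first row itself is zero. *)
Lemma minors_rank2 (a0 a1 a2 b0 b1 b2 : C) : \rank (coef_mx a0 a1 a2 b0 b1 b2) = 2%N ->
  a1 * b2 - a2 * b1 = 0 -> a0 * b2 - a2 * b0 = 0 -> a0 * b1 - a1 * b0 != 0.
Proof.
move=> rk A20 A30; apply/eqP => A10.
have free : row_free (coef_mx a0 a1 a2 b0 b1 b2) by rewrite /row_free rk.
have inj (k l : C) : k * a0 + l * b0 = 0 -> k * a1 + l * b1 = 0 -> k * a2 + l * b2 = 0 -> k = 0 /\ l = 0.
  move=> H0 H1 H2; pose v : 'rV[C]_2 := \row_(i < 2) nth 0 [:: k; l] i.
  have /(row_free_inj free) v0 : v *m coef_mx a0 a1 a2 b0 b1 b2 = 0 *m coef_mx a0 a1 a2 b0 b1 b2.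
    rewrite mul0mx; apply/matrixP => i j; rewrite !mxE !big_ord_recl big_ord0 !mxE /= addr0.
    by case: j => [[|[|[|]]]].
  by split; [have := congr1 (fun M : 'rV_2 => M 0 0) v0|have := congr1 (fun M : 'rV_2 => M 0 1) v0]; rewrite !mxE.
have a00 : a0 = 0 by apply: (inj (- b0) a0 _ _ _).2; [ring|rewrite -[RHS]A10; ring|rewrite -[RHS]A30; ring].
have a10 : a1 = 0.
  by apply: (inj (- b1) a1 _ _ _).2; [rewrite -[RHS]oppr0 -A10; ring|ring|rewrite -[RHS]A20; ring].
have a20 : a2 = 0.
  by apply: (inj (- b2) a2 _ _ _).2; [rewrite -[RHS]oppr0 -A30; ring|rewrite -[RHS]oppr0 -A20; ring|ring].
have [] := inj 1 0; rewrite ?a00 ?a10 ?a20 ?mulr0 ?mul0r ?addr0// => /eqP.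
by rewrite oner_eq0.
Qed.

(** The factorization holds because [w1 + w2 = - 2 omega] and [w1 w2 = omega^2 - s^2 = 1]. Only the
    first factor receives a logarithm; defining [h2] as [2 g - h1] makes the sum of the exponents
    exact, not merely modulo periods of the exponential. *)
Lemma exponents_exist (a0 a1 a2 b0 b1 b2 c omega s : C) (g : {poly C}) f :
  holo f -> dexp_bounded f -> s ^+ 2 = omega ^+ 2 - 1 -> s != 0 ->
  (forall z, Lop a0 a1 a2 c f z ^+ 2 + 2 * omega * Lop a0 a1 a2 c f z * Lop b0 b1 b2 c f z
     + Lop b0 b1 b2 c f z ^+ 2 = cexp (2 * g.[z])) ->
  let w1 := - omega + s in let w2 := - omega - s in
  exists h1 h2, [/\ small h1, small h2, forall z, h1 z + h2 z = 2 * g.[z],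
    forall z, (w2 - w1) * Lop a0 a1 a2 c f z = w2 * cexp (h1 z) - w1 * cexp (h2 z) &
    forall z, (w2 - w1) * Lop b0 b1 b2 c f z = cexp (h1 z) - cexp (h2 z)].
Proof.
move=> hf bf hs s0 E w1 w2.
pose F1 z := Lop a0 a1 a2 c f z - w1 * Lop b0 b1 b2 c f z.
pose F2 z := Lop a0 a1 a2 c f z - w2 * Lop b0 b1 b2 c f z.
have F12 z : F1 z * F2 z = cexp (2 * g.[z]).
  rewrite -E /F1 /F2; move: (Lop a0 _ _ _ _ _) (Lop b0 _ _ _ _ _) => x y.
  have e : omega ^+ 2 - s ^+ 2 = 1 by rewrite hs opprB addrC subrK.
  have -> : y ^+ 2 = (omega ^+ 2 - s ^+ 2) * y ^+ 2 by rewrite e mul1r.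
  by rewrite /w1 /w2; ring.
have F10 z : F1 z != 0.
  by apply/eqP => F0; have := F12 z; rewrite F0 mul0r => /esym/eqP; rewrite (negPf (cexp_neq0 _)).
have F1E : F1 = fun z => (a0 - w1 * b0) * f z + ((a1 - w1 * b1) * dd (dd f) z + (a2 - w1 * b2) * f (z + c)).
  apply/funext => z; rewrite /F1 !LopE; move: (f z) (dd (dd f) z) (f (z + c)) => x y t; ring.
have hf' := holo_dd hf; have bf' := dexp_bounded_dd hf bf.
have hF1 : holo F1.
  rewrite F1E; apply: holoD; first exact: holoZ.
  by apply: holoD; apply: holoZ; [exact: holo_dd|exact: holo_shift].
have bF1 : dexp_bounded F1.
  rewrite F1E; apply: dexp_boundedD; first exact: dexp_boundedZ.
  by apply: dexp_boundedD; apply: dexp_boundedZ; [exact: dexp_bounded_dd|exact: dexp_bounded_shift].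
have [h1 S1 h1E] := small_log hF1 F10 bF1.
pose h2 z := 2 * g.[z] - h1 z.
have h2E z : F2 z = cexp (h2 z).
  by apply: (mulfI (F10 z)); rewrite F12 h1E -cexpD /h2 addrC subrK.
exists h1, h2; split.
- exact: S1.
- by apply: smallB S1; apply: (@smallZ _ 2 (horner g)); exact: small_poly.
- by move=> z; rewrite addrC subrK.
- by move=> z; rewrite -h1E -h2E /F1 /F2; move: (Lop a0 _ _ _ _ _) (Lop b0 _ _ _ _ _) => x y; ring.
- by move=> z; rewrite -h1E -h2E /F1 /F2; move: (Lop a0 _ _ _ _ _) (Lop b0 _ _ _ _ _) => x y; ring.
Qed.

Lemma case1_form (N1 N2 d D alpha beta A B x z : C) : d != 0 -> D != 0 ->
  D * (d * x) = N1 * cexp ((alpha + A) * z + (beta + B)) + N2 * cexp ((alpha - A) * z + (beta - B)) ->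
  x = N1 * cexp (B + beta) / (d * D) * cexp ((A + alpha) * z)
      + N2 * cexp (- B + beta) / (d * D) * cexp ((- A + alpha) * z).
Proof.
move=> d0 D0 E; transitivity (D * (d * x) / (D * d)); first by field; rewrite d0 D0.
rewrite E ![in RHS](addrC _ alpha) ![in RHS](addrC _ beta) !(cexpD (_ * z)).
move: (cexp (beta + B)) (cexp (beta - B)) (cexp ((alpha + A) * z)) (cexp ((alpha - A) * z)) => e e' t t'.
by field; rewrite d0 D0.
Qed.

(** The equation only involves [f''] and is integrated twice. When [alpha] is [A] or [- A], one
    exponent becomes constant and contributes a square; since [alpha] is non-zero, so is [A], and
    the other exponential has a non-zero rate. *)
Lemma case2_form (N1 N2 d A2 alpha beta A B : C) f : holo f -> A2 != 0 -> d != 0 -> alpha != 0 ->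
  (forall z, A2 * d * dd (dd f) z =
     N1 * cexp ((alpha + A) * z + (beta + B)) + N2 * cexp ((alpha - A) * z + (beta - B))) ->
  exists C3 C4, [\/ [/\ alpha != A, alpha != - A & forall z, f z = (A2 * d)^-1 *
       ((N1 * cexp (beta + B) / (alpha + A) ^+ 2 * cexp ((alpha + A) * z)
        + N2 * cexp (beta - B) / (alpha - A) ^+ 2 * cexp ((alpha - A) * z)) + C3 * z + C4)],
     alpha = A /\ (forall z, f z = (A2 * d)^-1 *
       ((N1 * cexp (beta + B) / (4 * A ^+ 2) * cexp (2 * A * z)
        + N2 * cexp (beta - B) / 2 * z ^+ 2) + C3 * z + C4))
   | alpha = - A /\ (forall z, f z = (A2 * d)^-1 *
       ((N1 * cexp (beta + B) / 2 * z ^+ 2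
        + N2 * cexp (beta - B) / (4 * A ^+ 2) * cexp (- 2 * A * z)) + C3 * z + C4))].
Proof.
move=> hf A20 d0 al0 E.
have K0 : A2 * d != 0 by rewrite mulf_neq0.
have {}E z : A2 * d * dd (dd f) z = N1 * cexp (beta + B) * cexp ((alpha + A) * z)
    + N2 * cexp (beta - B) * cexp ((alpha - A) * z).
  by rewrite E !cexpD; move: (cexp _) (cexp _) (cexp _) (cexp _) => *; ring.
have [aA|aA] := eqVneq alpha A.
  have A0 : A != 0 by rewrite -aA.
  have [|C3 [C4 H]] := solve_dd hf K0 (hasd2_comb (N1 * cexp (beta + B) / (4 * A ^+ 2))
     (N2 * cexp (beta - B) / 2) (hasd2_exp (2 * A)) (@hasd2_sqr R)).
    move=> z; rewrite E aA subrr mul0r cexp0 (_ : A + A = 2 * A); last by ring.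
    by move: (cexp _) (cexp _) (cexp _) => *; field.
  by exists C3, C4; apply: Or32; split; [exact: aA|exact: H].
have [aN|aN] := eqVneq alpha (- A).
  have A0 : A != 0 by rewrite -oppr_eq0 -aN.
  have [|C3 [C4 H]] := solve_dd hf K0 (hasd2_comb (N1 * cexp (beta + B) / 2)
     (N2 * cexp (beta - B) / (4 * A ^+ 2)) (@hasd2_sqr R) (hasd2_exp (- 2 * A))).
    move=> z; rewrite E aN addNr mul0r cexp0 (_ : - A - A = - 2 * A); last by ring.
    by move: (cexp _) (cexp _) (cexp _) => *; field.
  by exists C3, C4; apply: Or33; split; [exact: aN|exact: H].
have p0 : alpha + A != 0 by rewrite addr_eq0.
have m0 : alpha - A != 0 by rewrite subr_eq0.
have [|C3 [C4 H]] := solve_dd hf K0 (hasd2_comb (N1 * cexp (beta + B) / (alpha + A) ^+ 2)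
   (N2 * cexp (beta - B) / (alpha - A) ^+ 2) (hasd2_exp (alpha + A)) (hasd2_exp (alpha - A))).
  move=> z; rewrite E; move: (cexp _) (cexp _) (cexp _) (cexp _) => *; field.
  by rewrite p0 m0.
by exists C3, C4; apply: Or31; split; [by []|by []|exact: H].
Qed.

Lemma particular_exp (a b k N : C) : a * k ^+ 2 + b != 0 ->
  let P := N / (a * k ^+ 2 + b) in exists2 G2, hasd2 (fun z => P * cexp (k * z)) G2 &
    forall z, b * (P * cexp (k * z)) + a * G2 z = N * cexp (k * z).
Proof.
move=> D P; exists (fun z => P * (k ^+ 2 * cexp (k * z))).
  have := hasd2_comb P 0 (hasd2_exp k) (hasd2_exp k).
  under [X in hasd2 X]eq_fun do rewrite mul0r addr0.
  by move/hasd2_eq; apply => z; rewrite mul0r addr0.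
by move=> z; rewrite /P; move: (cexp _) => e; field.
Qed.

(** Here [cexp (k * z)] solves the homogeneous equation, and the factor [z] supplies the particular
    solution. *)
Lemma particular_resonant (a b k N : C) : a != 0 -> k != 0 -> k ^+ 2 = - (b / a) ->
  let Q := N / (2 * a * k) in exists2 G2, hasd2 (fun z => Q * z * cexp (k * z)) G2 &
    forall z, b * (Q * z * cexp (k * z)) + a * G2 z = N * cexp (k * z).
Proof.
move=> a0 k0 kk Q; exists (fun z => Q * ((2 * k + k ^+ 2 * z) * cexp (k * z))).
  have := hasd2_comb Q 0 (hasd2_idexp k) (hasd2_exp k).
  under [X in hasd2 X]eq_fun do rewrite mul0r addr0 mulrA.
  by move/hasd2_eq; apply => z; rewrite mul0r addr0.
move=> z; have -> : b = - (a * k ^+ 2) by rewrite kk; field.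
by rewrite /Q; move: (cexp _) => e; field; rewrite a0 k0.
Qed.

(** Resonance of [k] means that [A2 k^2 + A3] vanishes, and each forcing term is solved according to
    its own resonance. If both are resonant then [k1^2 = k2^2], that is [alpha A = 0]; for non-zero
    [alpha] this is [A = 0], where both terms have the same exponent. *)
Lemma case3_form (N1 N2 d A2 A3 mu alpha beta A B : C) f : holo f -> A2 != 0 -> A3 != 0 -> d != 0 ->
  mu ^+ 2 = - (A3 / A2) ->
  (forall z, A3 * (d * f z) + A2 * (d * dd (dd f) z) =
     N1 * cexp ((alpha + A) * z + (beta + B)) + N2 * cexp ((alpha - A) * z + (beta - B))) ->
  let k1 := alpha + A in let k2 := alpha - A in
  let P1 := N1 * cexp (beta + B) / (d * (A2 * (alpha + A) ^+ 2 + A3)) in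
  let P2 := N2 * cexp (beta - B) / (d * (A2 * (alpha - A) ^+ 2 + A3)) in
  let Q1 := N1 * cexp (beta + B) / (2 * A2 * d * (alpha + A)) in
  let Q2 := N2 * cexp (beta - B) / (2 * A2 * d * (alpha - A)) in
  let resonant k := k = mu \/ k = - mu in
  exists C1 C2,
   [\/ [/\ ~ resonant k1, ~ resonant k2 & forall z, f z = C1 * cexp (mu * z) + C2 * cexp (- mu * z)
         + (P1 * cexp (k1 * z) + P2 * cexp (k2 * z))],
       [/\ resonant k1, ~ resonant k2 & forall z, f z = C1 * cexp (mu * z) + C2 * cexp (- mu * z)
         + (Q1 * z * cexp (k1 * z) + P2 * cexp (k2 * z))],
       [/\ ~ resonant k1, resonant k2 & forall z, f z = C1 * cexp (mu * z) + C2 * cexp (- mu * z)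
         + (P1 * cexp (k1 * z) + Q2 * z * cexp (k2 * z))]
     | [/\ resonant k1, resonant k2 & forall z, f z = C1 * cexp (mu * z) + C2 * cexp (- mu * z)
         + (Q1 * z * cexp (k1 * z) + Q2 * z * cexp (k2 * z))]].
Proof.
move=> hf A20 A30 d0 hmu E k1 k2 P1 P2 Q1 Q2 resonant.
have mu0 : mu != 0 by rewrite -sqrf_eq0 hmu oppr_eq0 mulf_neq0// invr_eq0.
have {}E z : A3 * f z + A2 * dd (dd f) z =
    N1 * cexp (beta + B) / d * cexp (k1 * z) + N2 * cexp (beta - B) / d * cexp (k2 * z).
  apply: (mulfI d0); rewrite [LHS](_ : _ = A3 * (d * f z) + A2 * (d * dd (dd f) z)); last first.
    by move: (f z) (dd _ z) => *; ring.
  by rewrite E -/k1 -/k2 !cexpD; move: (cexp _) (cexp _) (cexp _) (cexp _) => *; field.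
have res_sqr k : resonant k -> k ^+ 2 = mu ^+ 2 /\ k != 0.
  by case=> ->; rewrite ?sqrrN ?oppr_eq0.
have nres_sqr k : ~ resonant k -> A2 * k ^+ 2 + A3 != 0.
  move=> nr; apply/eqP => h; apply: nr; have : k ^+ 2 = mu ^+ 2.
    by rewrite hmu; apply: (mulfI A20); rewrite -[LHS](addrK A3) h; field.
  by move/eqP; rewrite eqf_sqr => /orP[] /eqP; [left|right].
have Pex k N : ~ resonant k -> exists2 G2, hasd2 (fun z => N / (d * (A2 * k ^+ 2 + A3)) * cexp (k * z)) G2 &
    forall z, A3 * (N / (d * (A2 * k ^+ 2 + A3)) * cexp (k * z)) + A2 * G2 z = N / d * cexp (k * z).
  move=> nk; have nr := nres_sqr k nk.
  have -> : N / (d * (A2 * k ^+ 2 + A3)) = N / d / (A2 * k ^+ 2 + A3) by rewrite invfM mulrA.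
  exact: particular_exp.
have Qex k N : resonant k -> exists2 G2, hasd2 (fun z => N / (2 * A2 * d * k) * z * cexp (k * z)) G2 &
    forall z, A3 * (N / (2 * A2 * d * k) * z * cexp (k * z)) + A2 * G2 z = N / d * cexp (k * z).
  move=> rk; have [kk k0] := res_sqr k rk; have := particular_resonant (N / d) A20 k0 (etrans kk hmu).
  by rewrite (_ : N / d / (2 * A2 * k) = N / (2 * A2 * d * k)) //; field; rewrite A20 k0 d0.
have solve G1 G1' G2 G2' := @solve_forced R f G1 G1' G2 G2' _ _ A2 A3 mu hf A20 A30 hmu.
have [r1|n1] := pselect (resonant k1); have [r2|n2] := pselect (resonant k2).
- have [G1' H1 E1] := Qex _ (N1 * cexp (beta + B)) r1; have [G2' H2 E2] := Qex _ (N2 * cexp (beta - B)) r2.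
  have [C1 [C2 H]] := solve _ _ _ _ _ _ H1 H2 E E1 E2.
  by exists C1, C2; apply: Or44; split; [exact: r1|exact: r2|exact: H].
- have [G1' H1 E1] := Qex _ (N1 * cexp (beta + B)) r1; have [G2' H2 E2] := Pex _ (N2 * cexp (beta - B)) n2.
  have [C1 [C2 H]] := solve _ _ _ _ _ _ H1 H2 E E1 E2.
  by exists C1, C2; apply: Or42; split; [exact: r1|exact: n2|exact: H].
- have [G1' H1 E1] := Pex _ (N1 * cexp (beta + B)) n1; have [G2' H2 E2] := Qex _ (N2 * cexp (beta - B)) r2.
  have [C1 [C2 H]] := solve _ _ _ _ _ _ H1 H2 E E1 E2.
  by exists C1, C2; apply: Or43; split; [exact: n1|exact: r2|exact: H].
- have [G1' H1 E1] := Pex _ (N1 * cexp (beta + B)) n1; have [G2' H2 E2] := Pex _ (N2 * cexp (beta - B)) n2.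
  have [C1 [C2 H]] := solve _ _ _ _ _ _ H1 H2 E E1 E2.
  by exists C1, C2; apply: Or41; split; [exact: n1|exact: n2|exact: H].
Qed.

End Solutions.

(** * The four cases assembled *)

Theorem theorem2p1 (R : realType) (a0 a1 a2 b0 b1 b2 c omega s mu : R[i])
    (g : {poly R[i]}) (f : CC R -> CC R) :
  let L1 := Lop a0 a1 a2 c f in
  let L2 := Lop b0 b1 b2 c f in
  let w1 := - omega + s in
  let w2 := - omega - s in
  let A1 := a0 * b1 - a1 * b0 in
  let A2 := a1 * b2 - a2 * b1 in
  let A3 := a0 * b2 - a2 * b0 in
  c != 0 ->
  omega != 0 -> omega != 1 -> omega != -1 ->
  s ^+ 2 = omega ^+ 2 - 1 ->
  (A2 != 0 -> mu ^+ 2 = - (A3 / A2)) ->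
  (1 < size g)%N ->
  \rank (coef_mx a0 a1 a2 b0 b1 b2) = 2%N ->
  entire f ->
  (hyper_order f < 1)%E ->
  (forall z, L1 z ^+ 2 + 2 * omega * L1 z * L2 z + L2 z ^+ 2
             = cexp (2 * g.[z])) ->
  [\/
    (* case 1 *)
    exists alpha beta A B C1 C2 : R[i],
      [/\ alpha != 0, g = alpha *: 'X + beta%:P, A2 = 0,
          (forall z, f z = C1 * cexp ((A + alpha) * z)
                           + C2 * cexp ((- A + alpha) * z))
        & [/\ A3 != 0,
              C1 = (b2 * w2 - a2) * cexp (B + beta) / ((w2 - w1) * A3)
            & C2 = (a2 - b2 * w1) * cexp (- B + beta) / ((w2 - w1) * A3)]
          \/
          [/\ A1 != 0,
              C1 = (b1 * w2 - a1) * cexp (B + beta) / ((w2 - w1) * A1)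
            & C2 = (a1 - b1 * w1) * cexp (- B + beta) / ((w2 - w1) * A1)]],
    (* case 2 *)
    exists alpha beta A B C3 C4 : R[i],
      let A_1 := (b2 * w2 - a2) * cexp (beta + B) / (alpha + A) ^+ 2 in
      let A_2 := (a2 - b2 * w1) * cexp (beta - B) / (alpha - A) ^+ 2 in
      let D_1 := (b2 * w2 - a2) * cexp (beta + B) / (4 * A ^+ 2) in
      let D_2 := (a2 - b2 * w1) * cexp (beta - B) / 2 in
      let C_1 := (b2 * w2 - a2) * cexp (beta + B) / 2 in
      let C_2 := (a2 - b2 * w1) * cexp (beta - B) / (4 * A ^+ 2) in
      [/\ alpha != 0, g = alpha *: 'X + beta%:P, A2 != 0, A3 = 0
        & [\/ [/\ alpha != A, alpha != - A
                & forall z, f z = (A2 * (w2 - w1))^-1 *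
                    ((A_1 * cexp ((alpha + A) * z)
                      + A_2 * cexp ((alpha - A) * z)) + C3 * z + C4)],
              alpha = A /\
                (forall z, f z = (A2 * (w2 - w1))^-1 *
                    ((D_1 * cexp (2 * A * z) + D_2 * z ^+ 2) + C3 * z + C4))
            | alpha = - A /\
                (forall z, f z = (A2 * (w2 - w1))^-1 *
                    ((C_1 * z ^+ 2 + C_2 * cexp (- 2 * A * z))
                     + C3 * z + C4))]],
    (* case 3 *)
    exists alpha beta C1 C2 A B : R[i],
      let k1 := alpha + A in
      let k2 := alpha - A in
      let P1 := (b2 * w2 - a2) * cexp (beta + B)
                / ((w2 - w1) * (A2 * (alpha + A) ^+ 2 + A3)) in
      let P2 := (a2 - b2 * w1) * cexp (beta - B)
                / ((w2 - w1) * (A2 * (alpha - A) ^+ 2 + A3)) in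
      let Q1 := (b2 * w2 - a2) * cexp (beta + B)
                / (2 * A2 * (w2 - w1) * (alpha + A)) in
      let Q2 := (a2 - b2 * w1) * cexp (beta - B)
                / (2 * A2 * (w2 - w1) * (alpha - A)) in
      let resonant k := k = mu \/ k = - mu in
      [/\ alpha != 0, g = alpha *: 'X + beta%:P, A2 != 0, A3 != 0
        & [\/ [/\ ~ resonant k1, ~ resonant k2
                & forall z, f z = C1 * cexp (mu * z) + C2 * cexp (- mu * z)
                    + (P1 * cexp (k1 * z) + P2 * cexp (k2 * z))],
              [/\ resonant k1, ~ resonant k2
                & forall z, f z = C1 * cexp (mu * z) + C2 * cexp (- mu * z)
                    + (Q1 * z * cexp (k1 * z) + P2 * cexp (k2 * z))],
              [/\ ~ resonant k1, resonant k2
                & forall z, f z = C1 * cexp (mu * z) + C2 * cexp (- mu * z)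
                    + (P1 * cexp (k1 * z) + Q2 * z * cexp (k2 * z))]
            | (* both resonant: not covered by the paper's three lines *)
              [/\ resonant k1, resonant k2
                & forall z, f z = C1 * cexp (mu * z) + C2 * cexp (- mu * z)
                    + (Q1 * z * cexp (k1 * z) + Q2 * z * cexp (k2 * z))]]]
  | (* case 4 *)
    [/\ (1 < (size g).-1)%N, A2 = 0, A1 = 0
      & exists p : {poly R[i]},
          (size p).-1 = ((size g).-1 - 1)%N /\
          ((forall z, f z = (a2 - b2 * w1) * cexp (g.[z] - p.[z])
                            / (A3 * (w2 - w1)))
           \/
           (forall z, f z = (b2 * w2 - a2) * cexp (g.[z] + p.[z])
                            / (A3 * (w2 - w1))))]].
Proof.
move=> L1 L2 w1 w2 A1 A2 A3 c0 _ om1 omN hs hmu sg rk ef ho E.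
have hf : holo f := entire_holo ef.
(* [omega] differs from 1 and -1, so the two factors are distinct: [w2 - w1 = - 2 s] is non-zero. *)
have s0 : s != 0.
  rewrite -sqrf_eq0 hs subr_eq0 -(expr1n _ 2) eqf_sqr negb_or om1; exact: omN.
have w12 : w2 - w1 != 0.
  by rewrite (_ : w2 - w1 = - (2 * s)) /w1 /w2 ?oppr_eq0 ?mulf_neq0 ?pnatr_eq0//; ring.
have [h1 [h2 [S1 S2 hg E1 E2]]] := exponents_exist hf (hyper_order_growth hf ho) hs s0 E.
rewrite -/w1 -/w2 in E1 E2.
(* Scaling by [w2 - w1] clears the denominators when [L1] and [L2] are solved for in terms of the
   two factors. *)
pose F (z : R[i]) : R[i] := (w2 - w1) * f z.
have hF : holo F by exact: holoZ.
have F2 z : dd (dd F) z = (w2 - w1) * dd (dd f) z := congr1 (fun G => G z) (dd2Z (w2 - w1) hf).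
have E1' z : a0 * F z + a1 * dd (dd F) z + a2 * F (z + c) = w2 * cexp (h1 z) - w1 * cexp (h2 z).
  by rewrite -E1; exact: LopZ.
have E2' z : b0 * F z + b1 * dd (dd F) z + b2 * F (z + c) = cexp (h1 z) - cexp (h2 z).
  by rewrite -E2; exact: LopZ.
have hh1 := small_holo S1; have hh2 := small_holo S2.
have param : affine h1 /\ affine h2 -> _ := fun H => affine_exponents sg hh1 hh2 H.1 H.2 hg.
have eU z : A3 * F z + A2 * ((w2 - w1) * dd (dd f) z) =
    (b2 * w2 - a2) * cexp (h1 z) + (a2 - b2 * w1) * cexp (h2 z).
  by rewrite -F2; exact: (elim_shift E1' E2').
have eV z : A1 * F z - A2 * F (z + c) = (b1 * w2 - a1) * cexp (h1 z) + (a1 - b1 * w1) * cexp (h2 z).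
  exact: (elim_dd E1' E2').
have [A20|A20] := eqVneq A2 0; last first.
  have [al [be [A [B [al0 gE h1E h2E]]]]] := param (exponents_A2 hF S1 S2 c0 w12 E1' E2' A20).
  have [A30|A30] := eqVneq A3 0.
    apply: Or42; exists al, be, A, B.
    have [|C3 [C4 H]] := @case2_form R (b2 * w2 - a2) (a2 - b2 * w1) (w2 - w1) A2 al be A B f hf A20 w12 al0.
      move=> z; rewrite -h1E -h2E; apply: etrans (eU z).
      by rewrite A30 mul0r add0r mulrA.
    by exists C3, C4; split; [exact: al0|exact: gE|by []|by []|exact: H].
  apply: Or43; exists al, be.
  have [|C1 [C2 H]] := @case3_form R (b2 * w2 - a2) (a2 - b2 * w1) (w2 - w1) A2 A3 mu al be A B f hf A20 A30 w12 (hmu A20).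
    move=> z; rewrite -h1E -h2E; exact: eU.
  by exists C1, C2, A, B; split; [exact: al0|exact: gE|by []|by []|exact: H].
have [A30|A30] := eqVneq A3 0.
  have A10 := minors_rank2 rk A20 A30.
  have [al [be [A [B [al0 gE h1E h2E]]]]] := param (exponents_A1 hF S1 S2 c0 w12 E1' E2' A20 A30 A10).
  apply: Or41; exists al, be, A, B.
  exists ((b1 * w2 - a1) * cexp (B + be) / ((w2 - w1) * A1)).
  exists ((a1 - b1 * w1) * cexp (- B + be) / ((w2 - w1) * A1)).
  split; [exact: al0|exact: gE|exact: A20| |by right].
  by move=> z; apply: (case1_form w12 A10); rewrite -h1E -h2E -eV A20 mul0r subr0.
(* With [A2 = 0] and [A3] non-zero, affine exponents lead to the first case, with its denominators
   in [A3], and non-affine ones to the last. *)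
have [|[A10 nc n1 n2]] := exponents_A3 hF S1 S2 c0 w12 E1' E2' A20 A30.
  move=> /param[al [be [A [B [al0 gE h1E h2E]]]]].
  apply: Or41; exists al, be, A, B.
  exists ((b2 * w2 - a2) * cexp (B + be) / ((w2 - w1) * A3)).
  exists ((a2 - b2 * w1) * cexp (- B + be) / ((w2 - w1) * A3)).
  split; [exact: al0|exact: gE|exact: A20| |by left].
  by move=> z; apply: (case1_form w12 A30); rewrite -h1E -h2E -eU A20 mul0r addr0.
have [g2 [p [sp H]]] := nonaffine_form hF S1 S2 c0 w12 E1' E2' A20 A10 A30 hg nc n1 n2.
have A3F z (k : R[i]) : A3 * F z = k -> f z = k / (A3 * (w2 - w1)).
  by move=> <-; rewrite /F mulrA mulrAC divff ?mul1r// mulf_neq0.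
apply: Or44; split; [exact: g2|exact: A20|exact: A10|].
exists p; split; first exact: sp.
by case: H => H; [left|right] => z; exact/A3F/H.
Qed.
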